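(* There are exactly $20$ classes of couples of distinct proper non-empty real projective conics under rigid isotopy. A set of representatives is given by the following $14$ couples $([f],[g])$ together with the $6$ couples $([g],[f])$ obtained by swapping $f$ and $g$ in the lines marked $( * )$: IN: $f=3x^2-2y^2-z^2$, $g=3x^2-y^2-2z^2$; IS: $f=3x^2-2y^2-z^2$, $g=x^2-2y^2+z^2$; IaN $( * )$: $f=x^2+y^2+z^2+3xz$, $g=x^2+y^2+z^2+4xz$; IaS: $f=x^2+y^2+z^2+3xz$, $g=x^2+y^2+z^2-3xz$; IbN: $f=x^2+y^2-z^2+xz$, $g=x^2+y^2-z^2-xz$; IIN $( * )$: $f=yz+xy-xz$, $g=yz+2xy-2xz$; IIS: $f=yz+xy-xz$, $g=yz-xy+xz$; IIaN $( * )$: $f=y^2+z^2+xz$, $g=y^2+z^2+2xz$; IIaS: $f=y^2+z^2+xz$, $g=y^2+z^2-xz$; IIIN $( * )$: $f=xz+y^2$, $g=xz+2y^2$; IIIS: $f=xz+y^2$, $g=xz-y^2$; IIIaN $( * )$: $f=x^2+y^2-z^2$, $g=x^2+y^2-2z^2$; IVN: $f=xz-y^2+xy$, $g=xz-y^2-2xy$; VN $( * )$: $f=xz-y^2-x^2$, $g=xz-y^2+x^2$.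
   Context: For a non-zero real ternary quadratic form $f$, $[f]\in\mathbb{P}(S^2{\mathbb{R}^3}^* )$ is the associated algebraic conic and $[f=0]\subset\mathbb{RP}^2$ its zero locus; it is proper if $f$ is non-degenerate, non-empty if $[f=0]\neq\emptyset$. A couple is an ordered pair. Two couples of distinct proper conics are rigidly isotopic if they are connected by a path in the space of couples of distinct proper conics along which the numbers of real and of imaginary (non-real complex) intersection points of each multiplicity do not change. *)

(* Defs.v *)
From HB Require Import structures.
From mathcomp Require Import all_boot all_order all_algebra.
From mathcomp Require Import all_classical all_reals all_analysis.
From mathcomp Require Import complex.

Set Implicit Arguments.
Unset Strict Implicit.
Unset Printing Implicit Defensive.

Import Order.TTheory GRing.Theory Num.Theory.
Import numFieldNormedType.Exports.

Local Open Scope classical_set_scope.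
Local Open Scope card_scope.
Local Open Scope ring_scope.
Local Open Scope quotient_scope.

Section ProjectiveSpace.
Variables (F : fieldType) (n : nat).

Definition nonzero_vectors : set 'rV[F]_n.+1 := [set v | v != 0].

Definition same_line (v w : nonzero_vectors) : bool :=
  `[< exists2 a : F, a != 0 & val w = a *: val v >].

Lemma same_line_refl : reflexive same_line.
Proof. by move=> v; apply/asboolP; exists 1; rewrite ?oner_neq0 ?scale1r. Qed.

Lemma same_line_sym : symmetric same_line.
Proof.
suff H v w : same_line v w -> same_line w v by move=> v w; apply/idP/idP; exact: H.
move=> /asboolP[a a0 wE]; apply/asboolP; exists a^-1; first by rewrite invr_eq0.
by rewrite wE scalerA mulVf ?scale1r.
Qed.

Lemma same_line_trans : transitive same_line.
Proof.
move=> w v u /asboolP[a a0 wE] /asboolP[b b0 uE]; apply/asboolP.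
by exists (b * a); [rewrite mulf_neq0 | rewrite uE wE scalerA].
Qed.

Canonical same_line_equiv :=
  EquivRel same_line same_line_refl same_line_sym same_line_trans.

(* P(F^(n+1)); when F carries a topology, it is the quotient topology of the
   subspace topology on the nonzero vectors. *)
Definition projective : Type := quotient_topology {eq_quot same_line}.

HB.instance Definition _ := Quotient.on projective.
HB.instance Definition _ := Choice.on projective.

Lemma ones_nonzero : const_mx 1 \in nonzero_vectors.
Proof.
rewrite inE /nonzero_vectors /=; apply/eqP => /rowP/(_ ord0).
by rewrite !mxE; apply/eqP; rewrite oner_neq0.
Qed.

Definition ones : nonzero_vectors := SigSub ones_nonzero.

(* The point [v]; junk value (the class of (1, ..., 1)) when v = 0. *)
Definition proj_pt (v : 'rV[F]_n.+1) : projective :=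
  \pi_projective (insubd ones v).

(* Some nonzero vector v such that [v] = p. *)
Definition proj_repr (p : projective) : 'rV[F]_n.+1 := val (repr p).

End ProjectiveSpace.

HB.instance Definition _ (R : realType) (n : nat) :=
  Topological.copy (projective R n)
    (quotient_topology {eq_quot @same_line R n}).

(* The quadratic form with coefficients c = (c0, ..., c5) is
   c0 x^2 + c1 y^2 + c2 z^2 + c3 yz + c4 xz + c5 xy. *)
Section TernaryForms.
Variable S : comNzRingType.
Implicit Types (c : 'rV[S]_6) (v : 'rV[S]_3).

Definition qform_eval c v : S :=
  let x := v 0 (inord 0) in let y := v 0 (inord 1) in let z := v 0 (inord 2) in
  c 0 (inord 0) * x ^+ 2 + c 0 (inord 1) * y ^+ 2 + c 0 (inord 2) * z ^+ 2
  + c 0 (inord 3) * (y * z) + c 0 (inord 4) * (x * z)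
  + c 0 (inord 5) * (x * y).

Definition polar_form c (v w : 'rV[S]_3) : S :=
  qform_eval c (v + w) - qform_eval c v - qform_eval c w.

Definition xx : 'rV[S]_6 := delta_mx 0 (inord 0).
Definition yy : 'rV[S]_6 := delta_mx 0 (inord 1).
Definition zz : 'rV[S]_6 := delta_mx 0 (inord 2).
Definition yz : 'rV[S]_6 := delta_mx 0 (inord 3).
Definition xz : 'rV[S]_6 := delta_mx 0 (inord 4).
Definition xy : 'rV[S]_6 := delta_mx 0 (inord 5).

End TernaryForms.

Arguments xx {S}.
Arguments yy {S}.
Arguments zz {S}.
Arguments yz {S}.
Arguments xz {S}.
Arguments xy {S}.

Section IntersectionMultiplicity.
Variable C : fieldType.

(* Polynomials in two affine coordinates u (inner) and w (outer), and C(u, w). *)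
Local Notation A2 := {poly {poly C}}.
Local Notation K := {fraction A2}.

Definition at_origin (h : A2) : C := h.[0].[0].

Definition local_ring : set K :=
  [set x | exists a s : A2, at_origin s != 0 /\ x = tofrac a / tofrac s].

Definition local_ideal (f g : A2) : set K :=
  [set x | exists a b : K, [/\ local_ring a, local_ring b
                             & x = a * tofrac f + b * tofrac g]].

Definition const_frac (a : C) : K := tofrac (a%:P%:P).

(* k = dim_C (O / (f, g)O) where O is the local ring of the affine plane at the
   origin: there are k elements of O whose classes are a basis. *)
Definition local_multiplicity (f g : A2) (k : nat) : Prop :=
  exists e : 'I_k -> K, (forall i, local_ring (e i)) /\
    forall x, local_ring x ->
      exists! c : 'rV[C]_k,
        local_ideal f g (x - \sum_(i < k) const_frac (c 0 i) * e i).

(* The vector (1, u, w). *)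
Definition affine_vector : 'rV[A2]_3 :=
  \row_j (if j == inord 0 then 1 else if j == inord 1 then ('X)%:P else 'X).

(* Equation of the conic c in the affine chart
   (u, w) |-> [(1, u, w) *m M], centred at the point [row 0 M]. *)
Definition local_equation (c : 'rV[C]_6) (M : 'M[C]_3) : A2 :=
  qform_eval (map_mx (fun a : C => a%:P%:P : A2) c)
    (affine_vector *m map_mx (fun a : C => a%:P%:P : A2) M).

Definition intersection_multiplicity (f g : 'rV[C]_6) (p : projective C 2)
    (k : nat) : Prop :=
  exists M : 'M[C]_3, [/\ M \in unitmx, proj_pt (row 0 M) = p
    & local_multiplicity (local_equation f M) (local_equation g M) k].

End IntersectionMultiplicity.

Section Conics.
Variable R : realType.

Definition conic : Type := projective R 5.

HB.instance Definition _ := Topological.on conic.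

Definition real_zero_locus (q : conic) : set (projective R 2) :=
  [set p | qform_eval (proj_repr q) (proj_repr p) = 0].

Definition nondegenerate (c : 'rV[R]_6) : Prop :=
  forall v : 'rV[R]_3, (forall w, polar_form c v w = 0) -> v = 0.

Definition proper (q : conic) : Prop := nondegenerate (proj_repr q).

Definition nonempty (q : conic) : Prop := real_zero_locus q !=set0.

Definition complexify n (v : 'rV[R]_n) : 'rV[R[i]]_n :=
  map_mx (real_complex R) v.

Definition real_point (p : projective R[i] 2) : Prop :=
  exists2 v : 'rV[R]_3, v != 0 & p = proj_pt (complexify v).

Definition intersection_points (c : conic * conic) (k : nat) :
    set (projective R[i] 2) :=
  let f := complexify (proj_repr c.1) in
  let g := complexify (proj_repr c.2) in
  [set p | [/\ qform_eval f (proj_repr p) = 0, qform_eval g (proj_repr p) = 0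
             & intersection_multiplicity f g p k]].

Definition real_intersections (c : conic * conic) (k : nat) :=
  intersection_points c k `&` [set p | real_point p].

Definition imaginary_intersections (c : conic * conic) (k : nat) :=
  intersection_points c k `\` [set p | real_point p].

Definition proper_couple (c : conic * conic) : Prop :=
  [/\ proper c.1, proper c.2 & c.1 <> c.2].

Definition rigidly_isotopic (c c' : conic * conic) : Prop :=
  exists gamma : R -> conic * conic,
    [/\ {within `[0, 1], continuous gamma}, gamma 0 = c, gamma 1 = c',
        (forall t : R, t \in `[0, 1] -> proper_couple (gamma t))
      & forall (s t : R) (k : nat), s \in `[0, 1] -> t \in `[0, 1] ->
          real_intersections (gamma s) k #= real_intersections (gamma t) k /\
          imaginary_intersections (gamma s) k
            #= imaginary_intersections (gamma t) k].

Definition proper_nonempty_couple (c : conic * conic) : Prop :=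
  [/\ proper_couple c, nonempty c.1 & nonempty c.2].

Definition rigid_class (c : conic * conic) : set (conic * conic) :=
  [set c' | proper_nonempty_couple c' /\ rigidly_isotopic c c'].

Definition rigid_classes : set (set (conic * conic)) :=
  [set rigid_class c | c in [set c | proper_nonempty_couple c]].

Definition couple (f g : 'rV[R]_6) : conic * conic := (proj_pt f, proj_pt g).

Definition starred_couples : seq (conic * conic) :=
  [:: (* IaN *)   couple (xx + yy + zz + 3%:R *: xz) (xx + yy + zz + 4%:R *: xz);
      (* IIN *)   couple (yz + xy - xz) (yz + 2%:R *: xy - 2%:R *: xz);
      (* IIaN *)  couple (yy + zz + xz) (yy + zz + 2%:R *: xz);
      (* IIIN *)  couple (xz + yy) (xz + 2%:R *: yy);
      (* IIIaN *) couple (xx + yy - zz) (xx + yy - 2%:R *: zz);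
      (* VN *)    couple (xz - yy - xx) (xz - yy + xx)].

Definition unstarred_couples : seq (conic * conic) :=
  [:: (* IN *)   couple (3%:R *: xx - 2%:R *: yy - zz)
                        (3%:R *: xx - yy - 2%:R *: zz);
      (* IS *)   couple (3%:R *: xx - 2%:R *: yy - zz) (xx - 2%:R *: yy + zz);
      (* IaS *)  couple (xx + yy + zz + 3%:R *: xz) (xx + yy + zz - 3%:R *: xz);
      (* IbN *)  couple (xx + yy - zz + xz) (xx + yy - zz - xz);
      (* IIS *)  couple (yz + xy - xz) (yz - xy + xz);
      (* IIaS *) couple (yy + zz + xz) (yy + zz - xz);
      (* IIIS *) couple (xz + yy) (xz - yy);
      (* IVN *)  couple (xz - yy + xy) (xz - yy - 2%:R *: xy)].

Definition representatives : seq (conic * conic) :=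
  unstarred_couples ++ starred_couples ++ [seq (c.2, c.1) | c <- starred_couples].

End Conics.

Arguments rigid_classes R : clear implicits.
Arguments representatives R : clear implicits.

(* Main.v *)
(* A real pencil of conics with a nondegenerate member is projectively equivalent
   to one of nine normal pencils, which are told apart by the multiplicities of
   their real and imaginary base points. A couple is thus, up to the action of
   GL_3(R), a pair of members of a normal pencil; the group acts trivially on
   rigid isotopy classes because -1 acts trivially and GL_3(R)/{1, -1} is
   connected, and moving the two parameters without meeting a degenerate member
   brings every couple of non-empty conics to one of the 20 representatives.
   Conversely, the type of the pencil and the non-emptiness are constant along
   a rigid isotopy, and so is the position of the couple in its pencil: it is read
   off signs of polynomials in the coefficients of (f, g), mostly those of
   disc (s f + t g), which cut the couples of a given type into finitely many
   disjoint open sets. *)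

Require Import Defs.
From HB Require Import structures.
From mathcomp Require Import all_boot all_order all_algebra perm.
From mathcomp Require Import all_classical all_reals all_analysis.
From mathcomp Require Import complex ring lra.

Set Implicit Arguments.
Unset Strict Implicit.
Unset Printing Implicit Defensive.

Import Order.TTheory GRing.Theory Num.Theory.
Import numFieldNormedType.Exports.

Local Open Scope classical_set_scope.
Local Open Scope card_scope.
Local Open Scope ring_scope.
Local Open Scope quotient_scope.

(** * Ternary quadratic forms *)

(** Two notions resist. The intersection multiplicity is a dimension over the local ring at a
    complex point, in an unspecified chart. It is computed once per local normal form: modulo the
    two equations one coordinate is a function of the other, whose k-th power vanishes, and the
    lower powers are independent because they stay so along a parametrised arc on which both
    equations vanish to order k. Linear changes carry the result to all charts and pencils. The path
    lives in projective space and is never lifted to forms. Each invariant is therefore an open set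
    of pairs of forms stable under rescaling the two forms separately, negative factors included;
    hence the products such as [disc_diff f g * disc g]. The coefficients of the discriminant do not
    suffice in two types. In type Ia three simple real roots do not tell which arc of the pencil is
    definite, so definite members enter the label. In type V the discriminant is a cube and forgets
    the order of the couple, which is recovered from the sign of the double line of the pencil. *)

Section ProjectivePoints.
Variables (F : fieldType) (n : nat).
Implicit Types (v w : 'rV[F]_n.+1) (p : projective F n).

Lemma proj_repr_neq0 p : proj_repr p != 0.
Proof. by have := valP (repr p); rewrite inE. Qed.

Lemma proj_reprK p : proj_pt (proj_repr p) = p.
Proof. by rewrite /proj_pt /proj_repr valKd reprK. Qed.

Lemma val_insubd_ones v : v != 0 -> val (insubd (ones F n) v) = v.
Proof. by move=> v0; rewrite insubdK// inE. Qed.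

Lemma proj_ptP v w : v != 0 -> w != 0 ->
  proj_pt v = proj_pt w <-> exists2 a, a != 0 & w = a *: v.
Proof.
move=> v0 w0; rewrite /proj_pt; split.
  move=> /eqP; rewrite eqmodE => /asboolP[a a0].
  by rewrite !val_insubd_ones// => wE; exists a.
move=> [a a0 wE]; apply/eqP; rewrite eqmodE; apply/asboolP; exists a => //.
by rewrite !val_insubd_ones.
Qed.

Lemma proj_ptZ a v : a != 0 -> v != 0 -> proj_pt (a *: v) = proj_pt v.
Proof.
move=> a0 v0; apply/esym/proj_ptP => //; first by rewrite scaler_eq0 negb_or a0.
by exists a.
Qed.

Lemma proj_repr_pt v : v != 0 ->
  exists2 a, a != 0 & proj_repr (proj_pt v) = a *: v.
Proof.
by move=> v0; apply/(proj_ptP v0 (proj_repr_neq0 _)); rewrite proj_reprK.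
Qed.

Lemma proj_pt_ind (P : projective F n -> Prop) :
  (forall v, v != 0 -> P (proj_pt v)) -> forall p, P p.
Proof. by move=> H p; rewrite -(proj_reprK p); apply/H/proj_repr_neq0. Qed.

End ProjectivePoints.

Section Forms.
Variable S : comNzRingType.
Implicit Types (c : 'rV[S]_6) (v w : 'rV[S]_3) (M N : 'M[S]_3).

Definition q6 (a b c d e f : S) : 'rV[S]_6 :=
  \row_j nth 0 [:: a; b; c; d; e; f] j.
Definition v3 (x y z : S) : 'rV[S]_3 := \row_j nth 0 [:: x; y; z] j.
Definition m3 (u v w : 'rV[S]_3) : 'M[S]_3 :=
  \matrix_(i, j) (nth 0 [:: u; v; w] i) 0 j.

Lemma q6_eta c : c = q6 (c 0 (inord 0)) (c 0 (inord 1)) (c 0 (inord 2))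
  (c 0 (inord 3)) (c 0 (inord 4)) (c 0 (inord 5)).
Proof.
apply/rowP => j; rewrite mxE -{1}(inord_val j).
by case: j; do 6![case=> //].
Qed.

Lemma v3_eta v : v = v3 (v 0 (inord 0)) (v 0 (inord 1)) (v 0 (inord 2)).
Proof.
apply/rowP => j; rewrite mxE -{1}(inord_val j).
by case: j; do 3![case=> //].
Qed.

Lemma m3_eta M : M = m3 (row (inord 0) M) (row (inord 1) M) (row (inord 2) M).
Proof.
apply/matrixP => i j; rewrite mxE.
by case: i => -[|[|[|//]]] ?; rewrite /= mxE; congr (M _ j);
  apply/val_inj; rewrite /= inordK.
Qed.

Lemma q6E (a b c d e f : S) :
  (q6 a b c d e f 0 (inord 0) = a) * (q6 a b c d e f 0 (inord 1) = b)
  * (q6 a b c d e f 0 (inord 2) = c) * (q6 a b c d e f 0 (inord 3) = d)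
  * (q6 a b c d e f 0 (inord 4) = e) * (q6 a b c d e f 0 (inord 5) = f).
Proof. by rewrite !mxE !inordK. Qed.

Lemma v3E x y z :
  (v3 x y z 0 (inord 0) = x) * (v3 x y z 0 (inord 1) = y)
  * (v3 x y z 0 (inord 2) = z).
Proof. by rewrite !mxE !inordK. Qed.

Lemma q6D (a b c d e f a' b' c' d' e' f' : S) :
  q6 a b c d e f + q6 a' b' c' d' e' f' =
  q6 (a + a') (b + b') (c + c') (d + d') (e + e') (f + f').
Proof. by rewrite [LHS]q6_eta !mxE !inordK. Qed.

Lemma q6Z (k a b c d e f : S) :
  k *: q6 a b c d e f = q6 (k * a) (k * b) (k * c) (k * d) (k * e) (k * f).
Proof. by rewrite [LHS]q6_eta !mxE !inordK. Qed.

Lemma q6N (a b c d e f : S) :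
  - q6 a b c d e f = q6 (- a) (- b) (- c) (- d) (- e) (- f).
Proof. by rewrite [LHS]q6_eta !mxE !inordK. Qed.

Lemma q60 : 0 = q6 0 0 0 0 0 0.
Proof. by rewrite [LHS]q6_eta !mxE. Qed.

Lemma v3D x y z x' y' z' : v3 x y z + v3 x' y' z' = v3 (x + x') (y + y') (z + z').
Proof. by rewrite [LHS]v3_eta !mxE !inordK. Qed.

Lemma v3Z k x y z : k *: v3 x y z = v3 (k * x) (k * y) (k * z).
Proof. by rewrite [LHS]v3_eta !mxE !inordK. Qed.

Lemma v30 : 0 = v3 0 0 0.
Proof. by rewrite [LHS]v3_eta !mxE. Qed.

Lemma q6_xx : xx = q6 1 0 0 0 0 0.
Proof. by rewrite [LHS]q6_eta !mxE -!val_eqE /= !inordK. Qed.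
Lemma q6_yy : yy = q6 0 1 0 0 0 0.
Proof. by rewrite [LHS]q6_eta !mxE -!val_eqE /= !inordK. Qed.
Lemma q6_zz : zz = q6 0 0 1 0 0 0.
Proof. by rewrite [LHS]q6_eta !mxE -!val_eqE /= !inordK. Qed.
Lemma q6_yz : yz = q6 0 0 0 1 0 0.
Proof. by rewrite [LHS]q6_eta !mxE -!val_eqE /= !inordK. Qed.
Lemma q6_xz : xz = q6 0 0 0 0 1 0.
Proof. by rewrite [LHS]q6_eta !mxE -!val_eqE /= !inordK. Qed.
Lemma q6_xy : xy = q6 0 0 0 0 0 1.
Proof. by rewrite [LHS]q6_eta !mxE -!val_eqE /= !inordK. Qed.
Definition q6_monomials := (q6_xx, q6_yy, q6_zz, q6_yz, q6_xz, q6_xy).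

Lemma qform_evalE (a b c d e f x y z : S) : qform_eval (q6 a b c d e f) (v3 x y z) =
  a * x ^+ 2 + b * y ^+ 2 + c * z ^+ 2 + d * (y * z) + e * (x * z) + f * (x * y).
Proof. by rewrite /qform_eval !q6E !v3E. Qed.

Lemma qform_evalD c c' v : qform_eval (c + c') v = qform_eval c v + qform_eval c' v.
Proof. by rewrite /qform_eval !mxE; ring. Qed.

Lemma qform_evalZ k c v : qform_eval (k *: c) v = k * qform_eval c v.
Proof. by rewrite /qform_eval !mxE; ring. Qed.

Lemma qform_eval_scale k c v : qform_eval c (k *: v) = k ^+ 2 * qform_eval c v.
Proof. by rewrite /qform_eval !mxE; ring. Qed.

Lemma polar_formE c v w : polar_form c v w =
  2%:R * c 0 (inord 0) * v 0 (inord 0) * w 0 (inord 0)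
  + 2%:R * c 0 (inord 1) * v 0 (inord 1) * w 0 (inord 1)
  + 2%:R * c 0 (inord 2) * v 0 (inord 2) * w 0 (inord 2)
  + c 0 (inord 3) * (v 0 (inord 1) * w 0 (inord 2) + v 0 (inord 2) * w 0 (inord 1))
  + c 0 (inord 4) * (v 0 (inord 0) * w 0 (inord 2) + v 0 (inord 2) * w 0 (inord 0))
  + c 0 (inord 5) * (v 0 (inord 0) * w 0 (inord 1) + v 0 (inord 1) * w 0 (inord 0)).
Proof. by rewrite /polar_form /qform_eval !mxE; ring. Qed.

(* Coefficients of the quadratic form v |-> c(v M). *)
Definition act M c : 'rV[S]_6 :=
  let r i := row (inord i) M in
  q6 (qform_eval c (r 0)) (qform_eval c (r 1)) (qform_eval c (r 2))
     (polar_form c (r 1) (r 2)) (polar_form c (r 0) (r 2)) (polar_form c (r 0) (r 1)).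

Lemma row_m3 u v w :
  (row (inord 0) (m3 u v w) = u) * (row (inord 1) (m3 u v w) = v)
  * (row (inord 2) (m3 u v w) = w).
Proof. by split; [split|]; apply/rowP => j; rewrite !mxE inordK. Qed.

Lemma act_m3 c u v w : act (m3 u v w) c =
  q6 (qform_eval c u) (qform_eval c v) (qform_eval c w)
     (polar_form c v w) (polar_form c u w) (polar_form c u v).
Proof. by rewrite /act !row_m3. Qed.

Lemma mulv3 x y z M : v3 x y z *m M =
  x *: row (inord 0) M + y *: row (inord 1) M + z *: row (inord 2) M.
Proof.
apply/rowP => j; rewrite !mxE !big_ord_recl big_ord0 !mxE /=.
rewrite addr0 -!addrA; congr (_ * M _ _ + (_ * M _ _ + _ * M _ _));
  by apply/val_inj; rewrite /= inordK.
Qed.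

Lemma qform_eval_act c M v : qform_eval (act M c) v = qform_eval c (v *m M).
Proof.
rewrite [v in RHS]v3_eta mulv3 /act /qform_eval !q6E !polar_formE !mxE; ring.
Qed.

(** The basis vectors and their pairwise sums recover the six coefficients without any division, so
    identities about [act] can be checked on values, over polynomial rings as well as over
    fields. *)
Lemma qform_eval_inj c c' : (forall v, qform_eval c v = qform_eval c' v) -> c = c'.
Proof.
move=> H; rewrite (q6_eta c) (q6_eta c').
have E0 := H (v3 1 0 0); have E1 := H (v3 0 1 0); have E2 := H (v3 0 0 1).
have E3 := H (v3 0 1 1); have E4 := H (v3 1 0 1); have E5 := H (v3 1 1 0).
move: E0 E1 E2 E3 E4 E5; rewrite /qform_eval !v3E.
rewrite ?(expr1n, expr0n, mulr0, mul0r, mulr1, mul1r, addr0, add0r) /=.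
move=> -> -> ->.
rewrite ?(expr1n, expr0n, mulr0, mul0r, mulr1, mul1r, addr0, add0r) /=.
by move=> /addrI -> /addrI -> /addrI ->.
Qed.

Lemma act_comp M N c : act N (act M c) = act (N *m M) c.
Proof. by apply: qform_eval_inj => v; rewrite !qform_eval_act mulmxA. Qed.

Lemma act1 c : act 1%:M c = c.
Proof. by apply: qform_eval_inj => v; rewrite qform_eval_act mulmx1. Qed.

Lemma actD M c c' : act M (c + c') = act M c + act M c'.
Proof.
by apply: qform_eval_inj => v; rewrite qform_evalD !qform_eval_act qform_evalD.
Qed.

Lemma actZ k M c : act M (k *: c) = k *: act M c.
Proof.
by apply: qform_eval_inj => v; rewrite qform_evalZ !qform_eval_act qform_evalZ.
Qed.

Lemma act_scalar k M c : act (k *: M) c = k ^+ 2 *: act M c.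
Proof.
apply: qform_eval_inj => v.
by rewrite qform_evalZ !qform_eval_act -scalemxAr qform_eval_scale.
Qed.

Lemma act0 M : act M 0 = 0.
Proof. by have := actZ 0 M 0; rewrite !scale0r. Qed.

(* Four times the discriminant, so that no division is needed. *)
Definition disc c : S :=
  4%:R * c 0 (inord 0) * c 0 (inord 1) * c 0 (inord 2)
  + c 0 (inord 3) * c 0 (inord 4) * c 0 (inord 5)
  - c 0 (inord 0) * c 0 (inord 3) ^+ 2 - c 0 (inord 1) * c 0 (inord 4) ^+ 2
  - c 0 (inord 2) * c 0 (inord 5) ^+ 2.

Lemma discE (a b c d e f : S) : disc (q6 a b c d e f) =
  4%:R * a * b * c + d * e * f - a * d ^+ 2 - b * e ^+ 2 - c * f ^+ 2.
Proof. by rewrite /disc !q6E. Qed.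

Lemma discZ k c : disc (k *: c) = k ^+ 3 * disc c.
Proof. by rewrite /disc !mxE; ring. Qed.

Definition det3 (x y z x' y' z' x'' y'' z'' : S) :=
  x * (y' * z'' - z' * y'') - y * (x' * z'' - z' * x'') + z * (x' * y'' - y' * x'').

Lemma det_m3 x y z x' y' z' x'' y'' z'' :
  \det (m3 (v3 x y z) (v3 x' y' z') (v3 x'' y'' z'')) =
  det3 x y z x' y' z' x'' y'' z''.
Proof.
rewrite (expand_det_row _ 0) !big_ord_recl big_ord0 /cofactor.
rewrite !(expand_det_row _ 0) !big_ord_recl !big_ord0 /cofactor !det_mx11 !mxE /=.
rewrite /det3 /bump /=. ring.
Qed.

(** Matrix of the polar form, twice the usual symmetric matrix: its determinant is 8 times the
    discriminant, that is twice [disc]. *)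
Definition gram c : 'M[S]_3 :=
  m3 (v3 (2%:R * c 0 (inord 0)) (c 0 (inord 5)) (c 0 (inord 4)))
     (v3 (c 0 (inord 5)) (2%:R * c 0 (inord 1)) (c 0 (inord 3)))
     (v3 (c 0 (inord 4)) (c 0 (inord 3)) (2%:R * c 0 (inord 2))).

Lemma det_gram c : \det (gram c) = 2%:R * disc c.
Proof. by rewrite det_m3 /det3 /disc; ring. Qed.

Lemma gramE c v w : (v *m gram c *m w^T) = (polar_form c v w)%:M.
Proof.
apply/matrixP => i j; rewrite !ord1 [v]v3_eta mulv3 !row_m3 !v3Z !v3D [w]v3_eta.
rewrite !mxE !big_ord_recl big_ord0 !mxE /= polar_formE !v3E ?mulr1n; ring.
Qed.

Lemma polar_act c M v w : polar_form (act M c) v w = polar_form c (v *m M) (w *m M).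
Proof. by rewrite /polar_form !qform_eval_act mulmxDl. Qed.

End Forms.

Section FieldForms.
Variable F : fieldType.
Hypothesis two_neq0 : (2%:R : F) != 0.
Implicit Types (c : 'rV[F]_6) (M : 'M[F]_3).

Lemma gram_act c M : gram (act M c) = M *m gram c *m M^T.
Proof.
have H (A B : 'M[F]_3) : (forall v w : 'rV_3, v *m A *m w^T = v *m B *m w^T) -> A = B.
  move=> AB; apply/matrixP => i j; have := AB (delta_mx 0 i) (delta_mx 0 j).
  by rewrite trmx_delta -!rowE -!colE => /matrixP/(_ 0 0); rewrite !mxE.
apply: H => v w; rewrite gramE polar_act -gramE trmx_mul !mulmxA //.
Qed.

Lemma disc_act c M : disc (act M c) = (\det M) ^+ 2 * disc c.
Proof.
apply: (mulfI two_neq0).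
by rewrite -det_gram gram_act !det_mulmx det_tr det_gram; ring.
Qed.

Lemma act_eq0 c M : M \in unitmx -> (act M c == 0) = (c == 0).
Proof.
move=> Mu; apply/eqP/eqP => [H|->]; last by rewrite act0.
by rewrite -[c]act1 -(mulVmx Mu) -act_comp H act0.
Qed.

End FieldForms.

(** * Rigid isotopy *)

Section ProjectiveTopology.
Variables (R : realType) (n : nat).

Lemma continuous_proj_pt (T : topologicalType) (h : T -> 'rV[R]_n.+1) :
  continuous h -> (forall t, h t != 0) -> continuous (fun t => proj_pt (h t)).
Proof.
move=> hc h0.
have -> : (fun t => proj_pt (h t)) =
    \pi_(projective R n) \o (fun t => insubd (ones R n) (h t)) by [].
move=> t; apply: continuous_comp; last exact: pi_continuous.
apply: continuous_comp_initial.
have -> : set_val \o (fun t => insubd (ones R n) (h t)) = h; last exact: hc.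
by apply/funext => s /=; rewrite set_valE val_insubd_ones.
Qed.

(* A product of quotient maps need not be a quotient map; here the projections
   are open because each of them is the quotient by a group of homeomorphisms. *)
Lemma open_saturated (W : set ('rV[R]_n.+1 * 'rV[R]_n.+1)) :
  open W ->
  (forall a b v w, a != 0 -> b != 0 -> W (v, w) -> W (a *: v, b *: w)) ->
  open [set c : projective R n * projective R n |
         W (proj_repr c.1, proj_repr c.2)].
Proof.
move=> oW sW; rewrite openE => -[p q] /= Wpq.
have [[V1 V2] [/= V1p V2q] V12] : nbhs (proj_repr p, proj_repr q) W.
  exact: open_nbhs_nbhs.
pose img (V : set 'rV[R]_n.+1) :=
  [set r : projective R n | exists2 a, a != 0 & (V°) (a *: proj_repr r)].
have oimg V : open (img V).
  rewrite /open /= /quotient_open.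
  (* Among the nonzero vectors, the preimage of [img V] is cut out by the union of all dilates of
     the interior of [V]. *)
  exists (\bigcup_(a in [set a : R | a != 0]) ((fun v => a *: v) @^-1` V°)).
    apply: bigcup_open => a _; apply: open_comp; last exact: open_interior.
    by move=> v _; exact: scaler_continuous.
  apply/seteqP; split=> v /=.
    move=> [a a0 /= Va].
    have v0 : val v != 0 by have := valP v; rewrite inE.
    have [b b0 bE] := proj_repr_pt v0.
    exists (a / b); first by rewrite mulf_neq0// invr_eq0.
    suff -> : proj_repr (\pi_(projective R n) v) = b *: val v.
      by rewrite scalerA mulfVK.
    by rewrite -bE /proj_pt valKd.
  move=> [a a0 Va].
  have v0 : val v != 0 by have := valP v; rewrite inE.
  have [b b0 bE] := proj_repr_pt v0.
  exists (a * b) => /=; first by rewrite mulf_neq0.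
  by rewrite set_valE -scalerA -bE /proj_pt valKd.
exists (img V1, img V2).
  split; apply: open_nbhs_nbhs; split; rewrite ?oimg//=;
    by exists 1; rewrite ?oner_eq0// scale1r.
move=> [r s] /= [[a a0 Vr] [b b0 Vs]].
have : W (a *: proj_repr r, b *: proj_repr s).
  by apply: V12; split => /=; exact: interior_subset.
move=> /(sW a^-1 b^-1); rewrite !scalerA !mulVf// !scale1r.
by apply; rewrite invr_eq0.
Qed.

Lemma continuous_rV m (T : topologicalType) (h : T -> 'rV[R]_m) :
  (forall j, continuous (fun t => h t 0 j)) -> continuous h.
Proof.
move=> hc t A [P Pn PA]; rewrite /nbhs /=.
have H : \forall s \near t, forall ij : 'I_1 * 'I_m, P ij.1 ij.2 (h s ij.1 ij.2).
  apply: filter_forall => -[i j]; rewrite (ord1 i) /=.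
  by apply: hc; have := Pn 0 j.
by apply: filterS H => s Hs; apply: PA => i j; exact: (Hs (i, j)).
Qed.

End ProjectiveTopology.

Section RigidIsotopy.
Variable R : realType.
Implicit Types c : conic R * conic R.

Definition same_intersections c c' := forall k,
  real_intersections c k #= real_intersections c' k /\
  imaginary_intersections c k #= imaginary_intersections c' k.

Lemma same_intersections_sym c c' : same_intersections c c' -> same_intersections c' c.
Proof. by move=> H k; have [? ?] := H k; split; rewrite card_eq_sym. Qed.

Lemma same_intersections_trans c c' c'' : same_intersections c c' ->
  same_intersections c' c'' -> same_intersections c c''.
Proof.
move=> H1 H2 k; have [r1 i1] := H1 k; have [r2 i2] := H2 k.
by split; [exact: card_eq_trans r1 r2 | exact: card_eq_trans i1 i2].
Qed.

(** Comparing each couple of the path with its starting point is enough, because equality of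
    cardinals is an equivalence relation. *)
Lemma rigidly_isotopicP c c' : rigidly_isotopic c c' <->
  exists gamma : R -> conic R * conic R,
    [/\ {within `[0, 1], continuous gamma}, gamma 0 = c, gamma 1 = c' &
      forall t, 0 <= t <= 1 ->
        proper_couple (gamma t) /\ same_intersections c (gamma t)].
Proof.
split=> [[gamma [gc g0 g1 gp gs]]|[gamma [gc g0 g1 gp]]]; exists gamma; split.
- exact: gc.
- exact: g0.
- exact: g1.
- move=> t t01; have tI : t \in `[0, 1] by rewrite in_itv.
  split; first exact: gp.
  by move=> k; rewrite -g0; apply: gs => //; rewrite in_itv /= lexx ler01.
- exact: gc.
- exact: g0.
- exact: g1.
- by move=> t; rewrite in_itv /= => /gp[].
- move=> s t k; rewrite !in_itv /= => /gp[_ hs] /gp[_ ht].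
  exact: (same_intersections_trans (same_intersections_sym hs) ht).
Qed.

Lemma rigidly_isotopic_refl c : proper_couple c -> rigidly_isotopic c c.
Proof.
move=> pc; apply/rigidly_isotopicP; exists (fun=> c); split; [|by []|by []|by move=> t _; split].
by apply: continuous_subspaceT; exact: cst_continuous.
Qed.

Lemma within_comp (T U : topologicalType) (A : set R) (B : set T) (f : R -> T) (g : T -> U) :
  continuous f -> (forall x, A x -> B (f x)) -> {within B, continuous g} ->
  {within A, continuous (g \o f)}.
Proof.
move=> fc AB /subspace_continuousP gc; apply/subspace_continuousP => x Ax.
apply: (@cvg_comp _ _ _ f g _ (within B (nbhs (f x)))); last exact: gc (AB _ Ax).
move=> V BV.
have H : \forall y \near x, B (f y) -> V (f y) := fc x _ BV.
apply: (@filterS _ (nbhs x) _ _ _ _ H) => y /= + Ay.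
by apply; exact: AB.
Qed.

Lemma rigidly_isotopic_sym c c' : rigidly_isotopic c c' -> rigidly_isotopic c' c.
Proof.
move=> /rigidly_isotopicP[gamma [gc g0 g1 gp]].
apply/rigidly_isotopicP; exists (gamma \o (fun t => 1 - t)); split => /=.
- apply: (@within_comp R _ _ `[0 : R, 1]%classic (fun t : R => 1 - t) gamma _ _ gc).
    by move=> x; apply: continuousB; [exact: cst_continuous | exact: cvg_id].
  by move=> x /=; rewrite !in_itv /=; lra.
- by rewrite subr0.
- by rewrite subrr.
- move=> t t01; have /gp[pt h] : 0 <= 1 - t <= 1 by lra.
  split; first exact: pt.
  apply: same_intersections_trans h.
  by apply: same_intersections_sym; rewrite -g1; apply: (gp 1 _).2; rewrite ler01 lexx.
Qed.

Lemma rigidly_isotopic_trans c c' c'' : rigidly_isotopic c c' ->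
  rigidly_isotopic c' c'' -> rigidly_isotopic c c''.
Proof.
move=> /rigidly_isotopicP[g [gc g0 g1 gp]] /rigidly_isotopicP[h [hc h0 h1 hp]].
apply/rigidly_isotopicP.
exists (fun t => if t <= 2^-1 then g (2 * t) else h (2 * t - 1)); split.
- have -> : `[0 : R, 1]%classic = `[0, 2^-1] `|` `[2^-1, 1].
    apply/seteqP; split=> x /=; rewrite !in_itv /=; last by case; lra.
    by move=> ?; case: (lerP x 2^-1) => ?; [left|right]; lra.
  apply: withinU_continuous; [exact: interval_closed | exact: interval_closed | |].
    apply: (@subspace_eq_continuous _ _ _ (g \o (fun t => 2 * t))).
      by move=> x; rewrite inE /= in_itv /= => /andP[_ x2]; rewrite /from_subspace x2.
    apply: (@within_comp R _ _ `[0 : R, 1]%classic (fun t : R => 2 * t) g _ _ gc).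
      exact: mulrl_continuous.
    by move=> x /=; rewrite !in_itv /=; lra.
  apply: (@subspace_eq_continuous _ _ _ (h \o (fun t => 2 * t - 1))).
    move=> x; rewrite inE /= in_itv /= => /andP[x2 _]; rewrite /from_subspace /=.
    case: ifPn => // x2'; have -> : x = 2^-1 :> R by lra.
    by rewrite divff ?pnatr_eq0// subrr h0 g1.
  apply: (@within_comp R _ _ `[0 : R, 1]%classic (fun t : R => 2 * t - 1) h _ _ hc).
    move=> x; apply: continuousB; last exact: cst_continuous.
    exact: mulrl_continuous.
  by move=> x /=; rewrite !in_itv /=; lra.
- by rewrite invr_ge0 ler0n mulr0.
- rewrite ifF; last by apply/negbTE; rewrite -ltNge; lra.
  by rewrite -h1; congr h; lra.
- move=> t t01; case: ifPn => [t2|]; first by apply: gp; lra.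
  rewrite -ltNge => t2; have /hp[pt hs] : 0 <= 2 * t - 1 <= 1 by lra.
  split; first exact: pt.
  apply: same_intersections_trans hs.
  by rewrite -g1; apply: (gp 1 _).2; rewrite ler01 lexx.
Qed.

Lemma rigid_class_eq c c' : proper_nonempty_couple c' ->
  rigidly_isotopic c c' -> rigid_class c = rigid_class c'.
Proof.
move=> pc' cc'; apply/seteqP; split=> d [pd H]; split=> //.
  exact: rigidly_isotopic_trans (rigidly_isotopic_sym cc') H.
exact: rigidly_isotopic_trans cc' H.
Qed.

(* Connectedness of [0, 1]: a property that is open along the path, and whose
   negation is, propagates. *)
Lemma path_open_invariant (gamma : R -> conic R * conic R)
    (U V : set (conic R * conic R)) :
  {within `[0, 1], continuous gamma} -> open U -> open V ->
  (forall t, 0 <= t <= 1 -> U (gamma t) \/ V (gamma t)) ->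
  (forall t, 0 <= t <= 1 -> U (gamma t) -> V (gamma t) -> False) ->
  U (gamma 0) -> forall t, 0 <= t <= 1 -> U (gamma t).
Proof.
move=> gc oU oV UV nUV U0 t t01.
have cI := connected_continuous_connected (@segment_connected R 0 1) gc.
pose I := gamma @` `[0, 1].
have inI s : 0 <= s <= 1 -> I (gamma s) by move=> s01; exists s; rewrite //= in_itv.
have IUE : I `&` U = I.
  apply: cI.
  - by exists (gamma 0); split => //; apply: inI; rewrite lexx ler01.
  - by exists U.
  - exists (~` V); first by rewrite closedC.
    apply/seteqP; split=> _ [[s /= s01 <-]]; rewrite /= in_itv /= in s01 *.
      by move=> Us; split; [exists s; rewrite //= in_itv | exact: nUV].
    move=> nVs; split; first by exists s; rewrite //= in_itv.
    by have [] := UV s s01.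
by have := inI t t01; rewrite -IUE => -[].
Qed.

End RigidIsotopy.

(** * Local intersection multiplicities *)

Lemma map_q6 (S T : comNzRingType) (phi : {rmorphism S -> T}) a b c d e f :
  map_mx phi (q6 a b c d e f) = q6 (phi a) (phi b) (phi c) (phi d) (phi e) (phi f).
Proof. by rewrite [LHS]q6_eta !mxE !inordK. Qed.

Lemma map_v3 (S T : comNzRingType) (phi : {rmorphism S -> T}) a b c :
  map_mx phi (v3 a b c) = v3 (phi a) (phi b) (phi c).
Proof. by rewrite [LHS]v3_eta !mxE !inordK. Qed.

Lemma rmorph_qform_eval (S T : comNzRingType) (phi : {rmorphism S -> T}) c v :
  phi (qform_eval c v) = qform_eval (map_mx phi c) (map_mx phi v).
Proof.
by rewrite /qform_eval !mxE !rmorphD !rmorphM.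
Qed.

Lemma map_act (S T : comNzRingType) (phi : {rmorphism S -> T}) M c :
  map_mx phi (act M c) = act (map_mx phi M) (map_mx phi c).
Proof.
have polarE v w : phi (polar_form c v w) =
    polar_form (map_mx phi c) (map_mx phi v) (map_mx phi w).
  by rewrite /polar_form 2!rmorphB !rmorph_qform_eval map_mxD.
by rewrite /act map_q6 !polarE !rmorph_qform_eval !map_row.
Qed.

(** Peels one power of [W] off a remainder [W ^+ n * y]: with y = c + U y1 + W y2, the element U is
    replaced by W y0, at the cost of a multiple of U - W y0. *)
Lemma local_power_step (S : comNzRingType) (x s c U W y0 y1 y2 : S) n :
  x - (s + c * W ^+ n) - W ^+ n.+1 * (y2 + y0 * y1) =
  (x - s - W ^+ n * (c + U * y1 + W * y2)) + (W ^+ n * y1) * (U - W * y0).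
Proof. by rewrite exprS; ring. Qed.

(** * The local ring of the affine plane at the origin *)

Section LocalRing.
Variable C : fieldType.
Local Notation A2 := {poly {poly C}}.
Local Notation K := {fraction A2}.
Local Notation u := (('X)%:P : A2).
Local Notation w := ('X : A2).
Implicit Types (x y : K) (a b s f g : A2).

Lemma at_originD a b : at_origin (a + b) = at_origin a + at_origin b.
Proof. by rewrite /at_origin !hornerD. Qed.
Lemma at_originM a b : at_origin (a * b) = at_origin a * at_origin b.
Proof. by rewrite /at_origin !hornerM. Qed.
Lemma at_originN a : at_origin (- a) = - at_origin a.
Proof. by rewrite /at_origin !hornerN. Qed.
Lemma at_originC (c : C) : at_origin c%:P%:P = c.
Proof. by rewrite /at_origin !hornerC. Qed.
Lemma at_origin1 : at_origin (1 : A2) = 1.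
Proof. by rewrite /at_origin !hornerC. Qed.
Lemma at_origin_u : at_origin u = 0.
Proof. by rewrite /at_origin hornerC hornerX. Qed.
Lemma at_origin_w : at_origin w = 0.
Proof. by rewrite /at_origin hornerX hornerC. Qed.

Definition at_originE :=
  (at_originD, at_originM, at_originN, at_originC, at_origin1, at_origin_u, at_origin_w).

Lemma at_origin_neq0 s : at_origin s != 0 -> s != 0.
Proof. by apply: contra_neq => ->; rewrite /at_origin !horner0. Qed.

Lemma tofrac_neq0 s : at_origin s != 0 -> tofrac s != 0 :> K.
Proof. by move=> /at_origin_neq0; rewrite tofrac_eq0. Qed.

Definition local_max : set K :=
  [set x | exists a s : A2, [/\ at_origin s != 0, at_origin a = 0 & x = tofrac a / tofrac s]].

Lemma local_maxW x : local_max x -> local_ring x.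
Proof. by move=> [a [s [s0 _ ->]]]; exists a, s. Qed.

Lemma local_ringD x y : local_ring x -> local_ring y -> local_ring (x + y).
Proof.
move=> [a [s [s0 ->]]] [b [t [t0 ->]]]; exists (a * t + b * s), (s * t).
split; first by rewrite at_originE mulf_neq0.
have ? := tofrac_neq0 s0; have ? := tofrac_neq0 t0.
by rewrite ?addf_div ?mulf_div ?tofrac_neq0// !(tofracD, tofracM).
Qed.

Lemma local_ringM x y : local_ring x -> local_ring y -> local_ring (x * y).
Proof.
move=> [a [s [s0 ->]]] [b [t [t0 ->]]]; exists (a * b), (s * t).
split; first by rewrite at_originE mulf_neq0.
have ? := tofrac_neq0 s0; have ? := tofrac_neq0 t0.
by rewrite ?addf_div ?mulf_div ?tofrac_neq0// !(tofracD, tofracM).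
Qed.

Lemma local_ring_tofrac a : local_ring (tofrac a).
Proof. by exists a, 1; rewrite rmorph1 divr1 at_originE oner_neq0. Qed.

Lemma local_ring_inv s : at_origin s != 0 -> local_ring (tofrac s)^-1.
Proof. by move=> s0; exists 1, s; rewrite rmorph1 mul1r. Qed.

Lemma local_ring_const c : local_ring (const_frac c : K).
Proof. exact: local_ring_tofrac. Qed.

Lemma local_ring1 : local_ring (1 : K).
Proof. by have := local_ring_tofrac 1; rewrite rmorph1. Qed.

Lemma local_ring0 : local_ring (0 : K).
Proof. by have := local_ring_tofrac 0; rewrite rmorph0. Qed.

Lemma local_ringN x : local_ring x -> local_ring (- x).
Proof.
by move=> Ox; rewrite -mulN1r; apply: local_ringM Ox;
  have := local_ring_tofrac (-1); rewrite rmorphN1.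
Qed.

Lemma local_ringX x n : local_ring x -> local_ring (x ^+ n).
Proof.
move=> Ox; elim: n => [|n IH]; first exact: local_ring1.
by rewrite exprS; exact: local_ringM.
Qed.

Lemma local_maxD x y : local_max x -> local_max y -> local_max (x + y).
Proof.
move=> [a [s [s0 a0 ->]]] [b [t [t0 b0 ->]]]; exists (a * t + b * s), (s * t).
split; [by rewrite at_originE mulf_neq0|by rewrite !at_originE a0 b0 !mul0r addr0|].
have ? := tofrac_neq0 s0; have ? := tofrac_neq0 t0.
by rewrite ?addf_div ?mulf_div ?tofrac_neq0// !(tofracD, tofracM).
Qed.

Lemma local_maxM x y : local_max x -> local_ring y -> local_max (x * y).
Proof.
move=> [a [s [s0 a0 ->]]] [b [t [t0 ->]]]; exists (a * b), (s * t).
split; [by rewrite at_originE mulf_neq0|by rewrite !at_originE a0 !mul0r|].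
have ? := tofrac_neq0 s0; have ? := tofrac_neq0 t0.
by rewrite ?addf_div ?mulf_div ?tofrac_neq0// !(tofracD, tofracM).
Qed.

(** A fraction with nonzero value at the origin has an admissible denominator as numerator, so its
    inverse is again in the local ring. *)
Lemma local_unit c x : c != 0 -> local_max x ->
  const_frac c + x != 0 /\ local_ring (const_frac c + x)^-1.
Proof.
move=> c0 [a [s [s0 a0 ->]]].
have n0 : at_origin (c%:P%:P * s + a) != 0.
  by rewrite !at_originE a0 addr0 mulf_neq0.
have ts0 := tofrac_neq0 s0; have nn := tofrac_neq0 n0.
have E : const_frac c + tofrac a / tofrac s = tofrac (c%:P%:P * s + a) / tofrac s.
  by rewrite (tofracD (c%:P%:P * s) a) (tofracM c%:P%:P s) mulrDl (mulfK ts0).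
rewrite E; split; first exact: mulf_neq0 nn (invr_neq0 ts0).
by rewrite (invf_div (tofrac _) (tofrac s)); exists s, (c%:P%:P * s + a).
Qed.

Lemma const_fracD c d : const_frac (c + d) = const_frac c + const_frac d :> K.
Proof. by rewrite /const_frac polyCD polyCD tofracD. Qed.
Lemma const_fracM c d : const_frac (c * d) = const_frac c * const_frac d :> K.
Proof. by rewrite /const_frac polyCM polyCM tofracM. Qed.

Lemma const_frac0 : const_frac 0 = 0 :> K.
Proof. by rewrite /const_frac !polyC0 tofrac0. Qed.
Lemma const_frac1 : const_frac 1 = 1 :> K.
Proof. by rewrite /const_frac !polyC1 tofrac1. Qed.
Lemma const_fracN c : const_frac (- c) = - const_frac c :> K.
Proof. by rewrite /const_frac !polyCN tofracN. Qed.
Lemma const_frac_sum n (F : 'I_n -> C) :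
  const_frac (\sum_i F i) = \sum_i const_frac (F i) :> K.
Proof. exact: (big_morph _ const_fracD const_frac0). Qed.

(** The maximal ideal is generated by the two coordinates: w divides the difference of [a] and its
    restriction to w = 0, and u divides that restriction. *)
Lemma at_origin0_split a : at_origin a = 0 -> exists a1 a2, a = u * a1 + w * a2.
Proof.
move=> a0.
have /factor_theorem[q qE] : root (a - (a.[0])%:P) 0.
  by rewrite rootE !hornerE subrr.
have /factor_theorem[r rE] : root a.[0] 0 by rewrite rootE -[_.[_]]/(at_origin a) a0.
exists r%:P, q; rewrite -[a in LHS](subrK (a.[0])%:P) qE rE !subr0 polyCM.
by rewrite addrC mulrC [q * _]mulrC.
Qed.

Lemma local_idealD f g x y : local_ideal f g x -> local_ideal f g y ->
  local_ideal f g (x + y).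
Proof.
move=> [a [b [Oa Ob ->]]] [c [d [Oc Od ->]]].
exists (a + c), (b + d); split; [exact: local_ringD|exact: local_ringD|].
by rewrite !mulrDl addrACA.
Qed.

Lemma local_idealM f g x y : local_ring x -> local_ideal f g y ->
  local_ideal f g (x * y).
Proof.
move=> Ox [c [d [Oc Od ->]]].
exists (x * c), (x * d); split; [exact: local_ringM|exact: local_ringM|].
by rewrite mulrDr !mulrA.
Qed.

Lemma local_idealN f g x : local_ideal f g x -> local_ideal f g (- x).
Proof.
by move=> Ix; rewrite -mulN1r; apply: local_idealM => //; exact/local_ringN/local_ring1.
Qed.

Lemma local_idealB f g x y : local_ideal f g x -> local_ideal f g y ->
  local_ideal f g (x - y).
Proof. by move=> Ix /local_idealN; exact: local_idealD. Qed.

Lemma local_ideal0 f g : local_ideal f g 0.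
Proof. by exists 0, 0; split; [exact: local_ring0|exact: local_ring0|rewrite !mul0r addr0]. Qed.

Lemma local_ideal_sum f g n (F : 'I_n -> K) :
  (forall i, local_ideal f g (F i)) -> local_ideal f g (\sum_i F i).
Proof.
by move=> OF; elim/big_ind : _ => [||i _];
  [exact: local_ideal0|exact: local_idealD|exact: OF].
Qed.

(** Invariance of dimension without forming the quotient: expanding two bases in each other gives
    matrices A and B, and uniqueness of coordinates forces A B = 1, which bounds one size by the
    other. *)
Lemma local_multiplicity_unique f g k l :
  local_multiplicity f g k -> local_multiplicity f g l -> k = l.
Proof.
have le m n : local_multiplicity f g m -> local_multiplicity f g n -> (m <= n)%N.
  move=> [d [Od Hd]] [e [Oe He]].
  have /choice[A AE] : forall i : 'I_m, exists c : 'rV[C]_n,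
    local_ideal f g (d i - \sum_j const_frac (c 0 j) * e j).
    by move=> i; have [c [? _]] := He _ (Od i); exists c.
  have /choice[B BE] : forall j : 'I_n, exists c : 'rV[C]_m,
    local_ideal f g (e j - \sum_i const_frac (c 0 i) * d i).
    by move=> j; have [c [? _]] := Hd _ (Oe j); exists c.
  apply: (@mulmx1_min _ m n (\matrix_(i, j) A i 0 j) (\matrix_(j, i) B j 0 i)).
  set P := _ *m _; apply/row_matrixP => i.
  have [c [_ cU]] := Hd _ (Od i).
  (* Both row i of [P] and the i-th unit row are coordinates of [d i], so they coincide. *)
  rewrite -(cU (row i P)); last first.
    have -> : d i - \sum_k0 const_frac (row i P 0 k0) * d k0 =
      (d i - \sum_j const_frac (A i 0 j) * e j) +
      \sum_j const_frac (A i 0 j) * (e j - \sum_k0 const_frac (B j 0 k0) * d k0).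
      under [X in _ = _ + X]eq_bigr do rewrite mulrBr.
      rewrite sumrB addrA subrK; congr (_ - _).
      under [RHS]eq_bigr do rewrite mulr_sumr.
      rewrite exchange_big /=; apply: eq_bigr => k0 _.
      under [RHS]eq_bigr do rewrite mulrA -const_fracM.
      rewrite -mulr_suml; congr (_ * _); rewrite !mxE const_frac_sum.
      by apply: eq_bigr => j _; rewrite !mxE.
    apply: local_idealD => //; apply: local_ideal_sum => j.
    by apply: local_idealM => //; exact: local_ring_const.
  apply: cU; rewrite (bigD1 i)//= big1 => [|j ji].
    rewrite mxE mxE eqxx addr0 mulr1n const_frac1 mul1r subrr.
    exact: local_ideal0.
  by rewrite mxE mxE eq_sym (negbTE ji) mulr0n const_frac0 mul0r.
by move=> Hk Hl; apply/eqP; rewrite eqn_leq !le.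
Qed.

(** The maximal ideal is (U, W) and U is a multiple of W modulo the ideal, so every element expands
    in powers of W; since W^k lies in the ideal, the powers below k span the quotient. The last
    hypothesis is their independence. *)
Lemma local_multiplicity_powers f g k (U W y0 : K) :
  (forall x, local_ring x -> exists c y z,
     [/\ local_ring y, local_ring z & x = const_frac c + U * y + W * z]) ->
  local_ring W -> local_ring y0 ->
  local_ideal f g (U - W * y0) -> local_ideal f g (W ^+ k) ->
  (forall c : 'rV[C]_k,
     local_ideal f g (\sum_(i < k) const_frac (c 0 i) * W ^+ i) -> c = 0) ->
  local_multiplicity f g k.
Proof.
move=> HM OW Oy0 IU IW ind; exists (fun i => W ^+ i).
split=> [i|x Ox]; first exact: local_ringX.
have H n : exists (c : 'rV[C]_n) y, local_ring y /\
    local_ideal f g (x - \sum_(i < n) const_frac (c 0 i) * W ^+ i - W ^+ n * y).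
  elim: n => [|n [c [y [Oy Iy]]]].
    exists 0, x; split=> //; rewrite big_ord0 subr0 mul1r subrr.
    exact: local_ideal0.
  have [d [y1 [y2 [Oy1 Oy2 yE]]]] := HM y Oy.
  pose c' : 'rV[C]_n.+1 := \row_i (if insub (i : nat) is Some j then c 0 j else d).
  exists c', (y2 + y0 * y1).
  split; first by apply: local_ringD => //; exact: local_ringM.
  rewrite big_ord_recr /=.
  have -> : c' 0 ord_max = d by rewrite mxE insubF//= ltnn.
  have -> : \sum_(i < n) const_frac (c' 0 (widen_ord (leqnSn n) i)) * W ^+ i =
            \sum_(i < n) const_frac (c 0 i) * W ^+ i.
    by apply: eq_bigr => i _; rewrite mxE /= valK.
  rewrite (_ : _ - _ = (x - \sum_(i < n) const_frac (c 0 i) * W ^+ i - W ^+ n * y)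
    + (W ^+ n * y1) * (U - W * y0)); last first.
    by rewrite yE; exact: local_power_step.
  apply: local_idealD => //; apply: local_idealM => //.
  by apply: local_ringM => //; exact: local_ringX.
have [c [y [Oy Iy]]] := H k.
have {}Iy : local_ideal f g (x - \sum_(i < k) const_frac (c 0 i) * W ^+ i).
  rewrite -[_ - _](subrK (W ^+ k * y)); apply: local_idealD => //.
  by rewrite mulrC; exact: local_idealM.
exists c; split=> // c' Iy'; apply/eqP; rewrite -subr_eq0; apply/eqP/ind.
have := local_idealB Iy' Iy; rewrite opprB addrC addrA subrK -sumrB => I'.
congr (local_ideal _ _ _) : I'; rewrite /=.
by apply: eq_bigr => i _; rewrite !mxE -mulrBl const_fracD const_fracN.
Qed.

End LocalRing.

(** * Evaluation of the local ring along a parametrised arc *)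

Section ArcEvaluation.
Variable C : fieldType.
Local Notation A2 := {poly {poly C}}.
Local Notation K := {fraction A2}.
Local Notation E := {fraction {poly C}}.
Local Notation u := (('X)%:P : A2).
Local Notation w := ('X : A2).

(** The function [e] of the arc parameter is defined at 0 and takes the value [c] there. *)
Definition regular_at (c : C) (e : E) :=
  exists a b : {poly C}, [/\ b.[0] != 0, a.[0] = c * b.[0] & e = tofrac a / tofrac b].

Lemma tofrac_poly_neq0 (b : {poly C}) : b.[0] != 0 -> tofrac b != 0 :> E.
Proof. by apply: contra_neq => /eqP; rewrite tofrac_eq0 => /eqP ->; rewrite horner0. Qed.

Lemma regular_atD c d e e' : regular_at c e -> regular_at d e' -> regular_at (c + d) (e + e').
Proof.
move=> [a [b [b0 a0 ->]]] [a' [b' [b'0 a'0 ->]]].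
exists (a * b' + a' * b), (b * b'); split.
- by rewrite hornerM mulf_neq0.
- by rewrite hornerD !hornerM a0 a'0; ring.
- have bn := tofrac_poly_neq0 b0; have b'n := tofrac_poly_neq0 b'0.
  by rewrite (addf_div _ _ bn b'n) -!tofracM -tofracD.
Qed.

Lemma regular_atM c d e e' : regular_at c e -> regular_at d e' -> regular_at (c * d) (e * e').
Proof.
move=> [a [b [b0 a0 ->]]] [a' [b' [b'0 a'0 ->]]].
exists (a * a'), (b * b'); split.
- by rewrite hornerM mulf_neq0.
- by rewrite !hornerM a0 a'0; ring.
- by rewrite mulf_div -!tofracM.
Qed.

Lemma regular_at_tofrac (p : {poly C}) : regular_at p.[0] (tofrac p).
Proof. by exists p, 1; rewrite hornerC oner_eq0 mulr1 tofrac1 divr1. Qed.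

Lemma regular_atV c e : c != 0 -> regular_at c e -> regular_at c^-1 e^-1.
Proof.
move=> c0 [a [b [b0 a0 ->]]]; exists b, a; split; last by rewrite invf_div.
  by rewrite a0 mulf_neq0.
by rewrite a0 mulKf.
Qed.

Lemma regular_at_neq0 c e : c != 0 -> regular_at c e -> e != 0.
Proof.
move=> c0 [a [b [b0 a0 ->]]]; rewrite mulf_neq0 ?invr_eq0 ?tofrac_poly_neq0//.
by rewrite a0 mulf_neq0.
Qed.

Variables U0 W0 : E.
Hypotheses (U0_reg : regular_at 0 U0) (W0_reg : regular_at 0 W0).

Definition arc_const : {rmorphism C -> E} := (@tofrac {poly C} \o polyC : C -> E).
Definition arc_inner : {rmorphism {poly C} -> E} :=
  (horner_eval U0 \o map_poly arc_const : {poly C} -> E).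
Definition arc_eval : {rmorphism A2 -> E} :=
  (horner_eval W0 \o map_poly arc_inner : A2 -> E).

Lemma arc_innerE p : arc_inner p = (map_poly arc_const p).[U0].
Proof. by []. Qed.
Lemma arc_evalE a : arc_eval a = (map_poly arc_inner a).[W0].
Proof. by []. Qed.

Lemma arc_evalC c : arc_eval c%:P%:P = tofrac c%:P.
Proof. by rewrite arc_evalE map_polyC hornerC [LHS]arc_innerE map_polyC hornerC. Qed.
Lemma arc_eval_u : arc_eval u = U0.
Proof. by rewrite arc_evalE map_polyC hornerC [LHS]arc_innerE map_polyX hornerX. Qed.
Lemma arc_eval_w : arc_eval w = W0.
Proof. by rewrite arc_evalE map_polyX hornerX. Qed.

Lemma arc_eval_regular (a : A2) : regular_at (at_origin a) (arc_eval a).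
Proof.
have inner (p : {poly C}) : regular_at p.[0] (arc_eval p%:P).
  elim/poly_ind: p => [|p c IH].
    rewrite horner0 polyC0 (rmorph0 arc_eval).
    by have := regular_at_tofrac 0; rewrite horner0 tofrac0.
  rewrite hornerD hornerM hornerX hornerC !(polyCD, polyCM).
  rewrite (rmorphD arc_eval) (rmorphM arc_eval) arc_eval_u.
  apply: regular_atD; first exact: regular_atM.
  by rewrite arc_evalC; have := regular_at_tofrac c%:P; rewrite hornerC.
elim/poly_ind: a => [|p c IH].
  rewrite /at_origin !horner0 (rmorph0 arc_eval).
  by have := regular_at_tofrac 0; rewrite horner0 tofrac0.
rewrite at_originD at_originM at_origin_w (rmorphD arc_eval) (rmorphM arc_eval) arc_eval_w.
apply: regular_atD; first exact: regular_atM.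
by rewrite /at_origin hornerC; exact: inner.
Qed.

(* arc_eval is not injective, so it only extends to the local ring; the
   extension is handled as a functional relation. *)
Definition arc_lift (x : K) (e : E) := exists a s : A2,
  [/\ at_origin s != 0, x = tofrac a / tofrac s & e = arc_eval a / arc_eval s].

Lemma arc_eval_neq0 s : at_origin s != 0 -> arc_eval s != 0.
Proof. by move=> s0; apply: (regular_at_neq0 s0); exact: arc_eval_regular. Qed.

Lemma arc_lift_unique x e e' : arc_lift x e -> arc_lift x e' -> e = e'.
Proof.
move=> [a [s [s0 -> ->]]] [b [t [t0 xE ->]]].
have := arc_eval_neq0 s0; have := arc_eval_neq0 t0.
move: xE => /eqP; rewrite (eqr_div _ _ (tofrac_neq0 s0) (tofrac_neq0 t0)) -!tofracM tofrac_eq.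
by move=> /eqP abE nt ns; apply/eqP; rewrite (eqr_div _ _ ns nt) -!(rmorphM arc_eval) abE.
Qed.

Lemma arc_lift_exists x : local_ring x -> exists e c, arc_lift x e /\ regular_at c e.
Proof.
move=> [a [s [s0 ->]]]; exists (arc_eval a / arc_eval s), (at_origin a / at_origin s).
split; first by exists a, s.
by apply: regular_atM; [|apply: regular_atV => //]; exact: arc_eval_regular.
Qed.

Lemma arc_liftD x y e e' : arc_lift x e -> arc_lift y e' -> arc_lift (x + y) (e + e').
Proof.
move=> [a [s [s0 -> ->]]] [b [t [t0 -> ->]]]; exists (a * t + b * s), (s * t).
have ts := tofrac_neq0 s0; have tt := tofrac_neq0 t0.
have es := arc_eval_neq0 s0; have et := arc_eval_neq0 t0.
split; first by rewrite at_originM mulf_neq0.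
  by rewrite (addf_div _ _ ts tt) -!tofracM -tofracD.
by rewrite (addf_div _ _ es et) -!(rmorphM arc_eval) -(rmorphD arc_eval).
Qed.

Lemma arc_liftM x y e e' : arc_lift x e -> arc_lift y e' -> arc_lift (x * y) (e * e').
Proof.
move=> [a [s [s0 -> ->]]] [b [t [t0 -> ->]]]; exists (a * b), (s * t).
split; first by rewrite at_originM mulf_neq0.
  by rewrite mulf_div -!tofracM.
by rewrite mulf_div -!(rmorphM arc_eval).
Qed.

Lemma arc_lift_tofrac a : arc_lift (tofrac a) (arc_eval a).
Proof. by exists a, 1; rewrite at_origin1 oner_eq0 tofrac1 (rmorph1 arc_eval) !divr1. Qed.

Lemma arc_liftX x e n : arc_lift x e -> arc_lift (x ^+ n) (e ^+ n).
Proof.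
move=> xe; elim: n => [|n IH].
  by have := arc_lift_tofrac 1; rewrite tofrac1 (rmorph1 arc_eval) !expr0.
by rewrite !exprS; exact: arc_liftM.
Qed.

Lemma arc_lift_sum n (F : 'I_n -> K) (G : 'I_n -> E) :
  (forall i, arc_lift (F i) (G i)) -> arc_lift (\sum_i F i) (\sum_i G i).
Proof.
move=> FG; elim/big_ind2 : _ => [|x e y e' |i _]; [|exact: arc_liftD|exact: FG].
by have := arc_lift_tofrac 0; rewrite tofrac0 (rmorph0 arc_eval).
Qed.

(** Along the arc, W becomes the parameter and both f and g are divisible by its k-th power. A
    combination of the powers of W below k becomes a polynomial of degree less than k; if it lies in
    the ideal it is divisible by 'X^k, hence zero. *)
Lemma arc_independent (f g : A2) (W : K) k (c : 'rV[C]_k) d d' f1 g1 :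
  arc_lift W (tofrac 'X) ->
  arc_eval f = tofrac 'X^k * f1 -> regular_at d f1 ->
  arc_eval g = tofrac 'X^k * g1 -> regular_at d' g1 ->
  local_ideal f g (\sum_(i < k) const_frac (c 0 i) * W ^+ i) -> c = 0.
Proof.
move=> WX fE f1r gE g1r [x [y [Ox Oy E1]]].
pose p : {poly C} := \sum_(i < k) (c 0 i)%:P * 'X^i.
have lhs : arc_lift (\sum_(i < k) const_frac (c 0 i) * W ^+ i) (tofrac p).
  rewrite /p (big_morph _ (@tofracD _) (@tofrac0 _)); apply: arc_lift_sum => i; rewrite tofracM tofracXn.
  apply: arc_liftM; last exact: arc_liftX.
  by rewrite /const_frac -arc_evalC; exact: arc_lift_tofrac.
have [ex [cx [xl xr]]] := arc_lift_exists Ox.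
have [ey [cy [yl yr]]] := arc_lift_exists Oy.
have rhs := arc_liftD (arc_liftM xl (arc_lift_tofrac f)) (arc_liftM yl (arc_lift_tofrac g)).
rewrite -E1 in rhs; have := arc_lift_unique lhs rhs.
rewrite fE gE (_ : _ + _ = tofrac 'X^k * (ex * f1 + ey * g1)); last first.
  by rewrite mulrDr !(mulrCA (tofrac 'X^k)).
have [a [b [b0 _ ->]]] := regular_atD (regular_atM xr f1r) (regular_atM yr g1r).
have bn := tofrac_poly_neq0 b0 => E2.
have := congr1 (fun z => z * tofrac b) E2.
rewrite /= -mulrA (mulfVK bn) -!tofracM => /eqP; rewrite tofrac_eq => /eqP pbE.
(* The denominator [b] does not vanish at 0, so it can be cancelled from the divisibility by
   'X^k. *)
have Xb : coprimep ('X^k : {poly C}) b.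
  by rewrite coprimep_expl// coprimep_sym -[polyX C]subr0 -polyC0 coprimep_XsubC rootE.
have Xp : 'X^k %| p by rewrite -(Gauss_dvdpl _ Xb) pbE dvdp_mulr.
have pE : p = \poly_(i < k) (if insub i is Some j then c 0 j else 0).
  rewrite poly_def; apply: eq_bigr => i _; rewrite valK mul_polyC //.
have p0 : p = 0.
  apply/eqP; apply: contraT => pn0; have := dvdp_leq pn0 Xp.
  by rewrite size_polyXn pE ltnNge size_poly.
apply/rowP => i; rewrite mxE; have := coef0 C i; rewrite -p0 pE coef_poly ltn_ord.
by rewrite valK.
Qed.

End ArcEvaluation.

(** * Affine charts centred at a point *)

Lemma chart_solve (S : comNzRingType) (l li a b c d e f di h X : S) :
  l * li = 1 -> di * (b * f - c * e) = 1 ->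
  let V1 := di * (f * h - e * X) in let V2 := di * (b * X - c * h) in
  let V0 := li * (1 - a * V1 - d * V2) in
  [/\ l * V0 + a * V1 + d * V2 = 1, b * V1 + e * V2 = h & c * V1 + f * V2 = X].
Proof.
move=> lli dd V1 V2 V0; split.
- by rewrite /V0 mulrA lli mul1r; ring.
- by rewrite -[RHS]mul1r -dd /V1 /V2; ring.
- by rewrite -[RHS]mul1r -dd /V1 /V2; ring.
Qed.

(** Inverting the linear forms L1 and L2 expresses the chart coordinates u and w through them;
    dividing by L0 turns these into multiples of L1 / L0 and L2 / L0. *)
Lemma chart_split (F : fieldType) (L0 L1 L2 x n1 n2 s k dl b c e f : F) :
  L0 != 0 ->
  let u := dl * (f * L1 - e * L2) in let w := dl * (b * L2 - c * L1) in
  x = k + (u * n1 + w * n2) * s ->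
  x = k + L1 / L0 * (dl * L0 * (f * n1 - c * n2) * s)
        + L2 / L0 * (dl * L0 * (b * n2 - e * n1) * s).
Proof. by move=> L00 u w ->; rewrite /u /w; field. Qed.

Lemma mul_sqrV (F : fieldType) (t x q : F) : t != 0 ->
  x * t^-1 ^+ 2 * (t ^+ 2 * q) = x * q.
Proof. by move=> t0; field. Qed.

Lemma frac_minus_const (F : fieldType) (a s s0 k : F) : s != 0 -> s0 != 0 ->
  k * s0 = 1 -> forall a0, a / s = a0 * k + (a * s0 - a0 * s) * (s^-1 * k).
Proof.
move=> sn s0n ks a0; have -> : k = s0^-1 by rewrite -[RHS]mul1r -ks mulfK.
by field; rewrite s0n sn.
Qed.

Section Chart.
Variable C : fieldType.
Local Notation A2 := {poly {poly C}}.
Local Notation K := {fraction A2}.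
Local Notation E := {fraction {poly C}}.
Local Notation u := (('X)%:P : A2).
Local Notation w := ('X : A2).
Implicit Types (f g : 'rV[C]_6) (M N : 'M[C]_3).

Definition const_poly : {rmorphism C -> A2} := (polyC \o polyC : C -> A2).
Definition const_fracr : {rmorphism C -> K} := (@tofrac A2 \o const_poly : C -> K).

Lemma const_polyE c : const_poly c = c%:P%:P. Proof. by []. Qed.
Lemma affine_vectorE : affine_vector C = v3 1 u w.
Proof. by rewrite [LHS]v3_eta !mxE -!val_eqE /= !inordK. Qed.

Lemma local_equationE c M :
  local_equation c M = qform_eval (map_mx const_poly c)
                         (v3 1 u w *m map_mx const_poly M).
Proof. by rewrite -affine_vectorE. Qed.

(** A chart centred at [1 : 0 : 0] has first row (l, 0, 0) and is otherwise arbitrary. All of them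
    have to be treated, since the multiplicity is defined by the existence of some chart. *)
Variables (l a b c d e f0 : C).
Let M := m3 (v3 l 0 0) (v3 a b c) (v3 d e f0).
Hypothesis (l0 : l != 0) (dl0 : b * f0 - c * e != 0).
Let dl := (b * f0 - c * e)^-1.

Let L0 : A2 := const_poly l + u * const_poly a + w * const_poly d.
Let L1 : A2 := u * const_poly b + w * const_poly e.
Let L2 : A2 := u * const_poly c + w * const_poly f0.

Lemma chart_coords : v3 1 u w *m map_mx const_poly M = v3 L0 L1 L2.
Proof.
rewrite mulv3 -!map_row !row_m3 !map_v3 !v3Z !v3D rmorph0 !mul1r !add0r.
by [].
Qed.

Lemma chart_L0 : at_origin L0 = l.
Proof. by rewrite !at_originE !mul0r !addr0. Qed.

Let U : K := tofrac L1 / tofrac L0.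
Let W : K := tofrac L2 / tofrac L0.

Lemma chart_L0_neq0 : at_origin L0 != 0. Proof. by rewrite chart_L0. Qed.

Lemma chart_U : local_max U.
Proof.
by exists L1, L0; split; [exact: chart_L0_neq0|rewrite !at_originE !mul0r addr0|].
Qed.

Lemma chart_W : local_max W.
Proof.
by exists L2, L0; split; [exact: chart_L0_neq0|rewrite !at_originE !mul0r addr0|].
Qed.

Lemma local_equation_chart q :
  tofrac (local_equation q M) =
  tofrac L0 ^+ 2 * qform_eval (map_mx const_fracr q) (v3 1 U W).
Proof.
rewrite -qform_eval_scale v3Z local_equationE chart_coords.
have tL0 := tofrac_neq0 chart_L0_neq0.
rewrite mulr1 !(mulrC (tofrac L0)) /U /W !(mulfVK tL0).
have E1 := rmorph_qform_eval (@tofrac A2) (map_mx const_poly q) (v3 L0 L1 L2).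
by rewrite [LHS]E1 map_v3 -map_mx_comp.
Qed.

(** Subtracting the value at the origin leaves an element of (u, w), and (u, w) = (U, W) because the
    lower right block of [M] is invertible and [L0] is a unit. *)
Lemma chart_generators x : local_ring x -> exists k y z,
  [/\ local_ring y, local_ring z & x = const_frac k + U * y + W * z].
Proof.
move=> [n [s [s0 ->]]]; have ts := tofrac_neq0 s0; have tL0 := tofrac_neq0 chart_L0_neq0.
have [n1 [n2 nE]] : exists n1 n2,
    n * const_poly (at_origin s) - const_poly (at_origin n) * s = u * n1 + w * n2.
  by apply: at_origin0_split; rewrite !at_originE; ring.
have cfE z : tofrac (const_poly z) = const_frac z :> K by [].
pose k := const_frac (at_origin s)^-1 : K.
have kE : k * tofrac (const_poly (at_origin s)) = 1.
  have sVs : (at_origin s)^-1 * at_origin s = 1 := mulVf s0.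
  by rewrite (cfE (at_origin s)) /k -(const_fracM (at_origin s)^-1) sVs const_frac1.
exists (at_origin n / at_origin s).
pose y1 := tofrac (const_poly f0 * n1 - const_poly c * n2) : K.
pose y2 := tofrac (const_poly b * n2 - const_poly e * n1) : K.
pose D := const_frac dl : K.
exists (D * tofrac L0 * y1 * ((tofrac s)^-1 * k)), (D * tofrac L0 * y2 * ((tofrac s)^-1 * k)).
have Osk : local_ring ((tofrac s)^-1 * k).
  by apply: local_ringM; [exact: local_ring_inv|exact: local_ring_const].
have OD : local_ring (D * tofrac L0).
  by apply: local_ringM; [exact: local_ring_const|exact: local_ring_tofrac].
split.
- by apply: local_ringM Osk; apply: local_ringM OD _; exact: local_ring_tofrac.
- by apply: local_ringM Osk; apply: local_ringM OD _; exact: local_ring_tofrac.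
have sc0 : tofrac (const_poly (at_origin s)) != 0 :> K.
  by apply: tofrac_neq0; rewrite at_originC.
rewrite (frac_minus_const (tofrac n) ts sc0 kE (const_frac (at_origin n))).
rewrite (const_fracM (at_origin n) (at_origin s)^-1).
have uE : u = const_poly dl * (const_poly f0 * L1 - const_poly e * L2).
  have -> : const_poly f0 * L1 - const_poly e * L2 = const_poly (b * f0 - c * e) * u.
    by rewrite rmorphB !rmorphM /L1 /L2; ring.
  by rewrite mulrA -rmorphM mulVf// rmorph1 mul1r.
have wE : w = const_poly dl * (const_poly b * L2 - const_poly c * L1).
  have -> : const_poly b * L2 - const_poly c * L1 = const_poly (b * f0 - c * e) * w.
    by rewrite rmorphB !rmorphM /L1 /L2; ring.
  by rewrite mulrA -rmorphM mulVf// rmorph1 mul1r.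
have tl x1 x2 p q r : tofrac (const_poly p * (const_poly q * x1 - const_poly r * x2)) =
    const_frac p * (tofrac (const_poly q) * tofrac x1 - tofrac (const_poly r) * tofrac x2) :> K.
  by rewrite tofracM tofracB !tofracM.
rewrite /y1 /y2 !tofracB !tofracM.
apply: (@chart_split K (tofrac L0) (tofrac L1) (tofrac L2) _ (tofrac n1) (tofrac n2)
  ((tofrac s)^-1 * k) _ D (tofrac (const_poly b)) (tofrac (const_poly c))
  (tofrac (const_poly e)) (tofrac (const_poly f0)) tL0).
congr (_ + _ * _); rewrite -(cfE (at_origin n)) -(tofracM n) -(tofracM _ s) -tofracB nE.
by rewrite (tofracD (u * n1)) (tofracM u) (tofracM w) {1}uE {1}wE !tl.
Qed.

Variables (h : {poly C}).
Hypothesis h0 : h.[0] = 0.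

(** Homogeneous chart coordinates of the arc (1, h, 'X): the row (V0, V1, V2) times [M] equals (1,
    h, 'X), by Cramer's rule. *)
Let V1 := dl%:P * (f0%:P * h - e%:P * 'X).
Let V2 := dl%:P * (b%:P * 'X - c%:P * h).
Let V0 := (l^-1)%:P * (1 - a%:P * V1 - d%:P * V2).

Lemma arc_V : [/\ l%:P * V0 + a%:P * V1 + d%:P * V2 = 1,
  b%:P * V1 + e%:P * V2 = h & c%:P * V1 + f0%:P * V2 = 'X].
Proof.
apply: chart_solve; first by rewrite -polyCM mulfV.
by rewrite -!polyCM -polyCB -polyCM mulVf.
Qed.

Lemma arc_V1 : V1.[0] = 0. Proof. by rewrite /V1 !hornerE h0; ring. Qed.
Lemma arc_V2 : V2.[0] = 0. Proof. by rewrite /V2 !hornerE h0; ring. Qed.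
Lemma arc_V0 : V0.[0] != 0.
Proof.
rewrite /V0 hornerM hornerC !(hornerD, hornerN).
rewrite (hornerM a%:P V1) (hornerM d%:P V2) arc_V1 arc_V2 hornerC.
by rewrite !mulr0 !subr0 mulr1 invr_eq0.
Qed.

Let U0 : E := tofrac V1 / tofrac V0.
Let W0 : E := tofrac V2 / tofrac V0.

Lemma arc_U0 : regular_at 0 U0.
Proof. by exists V1, V0; split; [exact: arc_V0|rewrite arc_V1 mul0r|]. Qed.
Lemma arc_W0 : regular_at 0 W0.
Proof. by exists V2, V0; split; [exact: arc_V0|rewrite arc_V2 mul0r|]. Qed.

Let ev := arc_eval U0 W0.

Lemma arc_coords : [/\ ev L0 = (tofrac V0)^-1, ev L1 = tofrac h / tofrac V0 &
  ev L2 = tofrac 'X / tofrac V0].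
Proof.
have [E0 E1 E2] := arc_V; have tV := tofrac_poly_neq0 arc_V0.
have evlin p q r : ev (const_poly p + u * const_poly q + w * const_poly r) =
    tofrac (p%:P * V0 + q%:P * V1 + r%:P * V2) / tofrac V0.
  rewrite !(rmorphD ev) !(rmorphM ev) !const_polyE /ev !arc_evalC arc_eval_u arc_eval_w.
  rewrite !tofracD (tofracM p%:P V0) (tofracM q%:P V1) (tofracM r%:P V2).
  rewrite !mulrDl (mulfK tV) /U0 /W0.
  by rewrite !(mulrC _ (tofrac _%:P)) !mulrA.
split.
- by rewrite /L0 evlin E0 tofrac1 mul1r.
- rewrite -E1; by have := evlin 0 b e; rewrite (rmorph0 const_poly) polyC0 mul0r !add0r.
- rewrite -E2; by have := evlin 0 c f0; rewrite (rmorph0 const_poly) polyC0 mul0r !add0r.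
Qed.

(** In the chart the arc reads (1, h, 'X) divided by [V0], which is a unit at 0; by homogeneity the
    factor 'X^k survives. *)
Lemma arc_equation q k q1 :
  qform_eval (map_mx polyC q) (v3 1 h 'X) = 'X^k * q1 ->
  exists2 r, ev (local_equation q M) = tofrac 'X^k * r & exists s, regular_at s r.
Proof.
move=> qE; have [E0 E1 E2] := arc_coords.
exists (tofrac q1 * (tofrac V0)^-1 ^+ 2); last first.
  eexists; apply: regular_atM (regular_at_tofrac q1) _.
  rewrite expr2; apply: regular_atM; apply: regular_atV (regular_at_tofrac V0);
  exact: arc_V0.
rewrite mulrA -tofracM -qE local_equationE chart_coords.
have H1 := rmorph_qform_eval ev (map_mx const_poly q) (v3 L0 L1 L2).
rewrite [LHS]H1 map_v3 E0 E1 E2 -map_mx_comp.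
have -> : v3 (tofrac V0)^-1 (tofrac h / tofrac V0) (tofrac 'X / tofrac V0) =
    (tofrac V0)^-1 *: v3 1 (tofrac h) (tofrac 'X).
  by rewrite v3Z mulr1 !(mulrC (tofrac V0)^-1).
rewrite qform_eval_scale mulrC; congr (_ * _).
have H2 := rmorph_qform_eval (@tofrac {poly C}) (map_mx polyC q) (v3 1 h 'X).
rewrite [RHS]H2 map_v3 (rmorph1 (@tofrac {poly C})); congr (qform_eval _ _).
by apply/rowP => j; rewrite !mxE; exact: arc_evalC.
Qed.

(** The local equations differ from the values of the forms at (1, U, W) by the unit [L0 ^+ 2], so
    ideal membership passes from the forms to the chart; the arc provides the independence. *)
Lemma chart_multiplicity f g k (f1 g1 : {poly C}) :
  (forall x y : K, local_max x -> local_max y -> exists y0 al be,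
     [/\ local_ring y0, local_ring al, local_ring be & x - y * y0 =
       al * qform_eval (map_mx const_fracr f) (v3 1 x y)
       + be * qform_eval (map_mx const_fracr g) (v3 1 x y)]) ->
  (forall x y : K, local_max x -> local_max y -> exists al be,
     [/\ local_ring al, local_ring be & y ^+ k =
       al * qform_eval (map_mx const_fracr f) (v3 1 x y)
       + be * qform_eval (map_mx const_fracr g) (v3 1 x y)]) ->
  qform_eval (map_mx polyC f) (v3 1 h 'X) = 'X^k * f1 ->
  qform_eval (map_mx polyC g) (v3 1 h 'X) = 'X^k * g1 ->
  local_multiplicity (local_equation f M) (local_equation g M) k.
Proof.
move=> HU HW fE gE; have tL0 := tofrac_neq0 chart_L0_neq0.
have OL0 : local_ring ((tofrac L0)^-1 ^+ 2).
  by rewrite expr2; apply: local_ringM; apply: local_ring_inv chart_L0_neq0.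
have Iin al be : local_ring al -> local_ring be ->
    local_ideal (local_equation f M) (local_equation g M)
     (al * qform_eval (map_mx const_fracr f) (v3 1 U W)
       + be * qform_eval (map_mx const_fracr g) (v3 1 U W)).
  move=> Oal Obe; exists (al * (tofrac L0)^-1 ^+ 2), (be * (tofrac L0)^-1 ^+ 2).
  split; [exact: local_ringM|exact: local_ringM|].
  by rewrite !local_equation_chart !(mul_sqrV _ _ tL0).
have [y0 [al [be [Oy0 Oal Obe UE]]]] := HU _ _ chart_U chart_W.
have [al' [be' [Oal' Obe' WE]]] := HW _ _ chart_U chart_W.
apply: (local_multiplicity_powers chart_generators (local_maxW chart_W) Oy0).
- by rewrite UE; exact: Iin.
- by rewrite WE; exact: Iin.
move=> co; have [r1 E1 [s1 R1]] := arc_equation fE; have [r2 E2 [s2 R2]] := arc_equation gE.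
apply: (arc_independent arc_U0 arc_W0 _ E1 R1 E2 R2).
have [e0 _ e2] := arc_coords.
exists L2, L0; split; [exact: chart_L0_neq0| by []|].
by rewrite -/ev e0 e2 invrK (mulfVK (tofrac_poly_neq0 arc_V0)).
Qed.

End Chart.

Lemma row0_inord n (T : Type) (M : 'M[T]_(n.+1, n.+1)) : row (inord 0) M = row 0 M.
Proof. by congr row; apply/val_inj; rewrite /= inordK. Qed.

(** * Local normal forms of pencils *)

Section Identities.
Variable S : comNzRingType.
Implicit Types a b c x y : S.

Lemma simple_F a b c x y : qform_eval (q6 0 a b c 0 1) (v3 1 x y) =
  x * (1 + (x * a + y * c)) + y * (y * b).
Proof. by rewrite qform_evalE; ring. Qed.

Lemma simple_G a b c x y : qform_eval (q6 0 a b c 1 0) (v3 1 x y) =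
  x * (x * a) + y * (1 + (y * b + x * c)).
Proof. by rewrite qform_evalE; ring. Qed.

Lemma simple_det x y a b : (1 + x) * (1 + y) - a * b = 1 + (x * (1 + y) + y + a * - b).
Proof. by ring. Qed.

Definition form_value a b c (d e f : S) x y (z : S) :=
  a * x ^+ 2 + b * y ^+ 2 + c * z ^+ 2 + d * (y * z) + e * (x * z) + f * (x * y).

(** Membership certificates at the point (1, x, y). In each pair, the first shows that x is a
    multiple of y modulo the two forms, the second that a power of y lies in their ideal. *)
Lemma normal_III_1 b x y : x - y * 0 = 1 * form_value 0 0 0 0 0 1 1 x y
  + 0 * form_value 0 b 1 0 0 0 1 x y.
Proof. by rewrite /form_value; ring. Qed.
Lemma normal_III_2 b x y : y ^+ 2 = (- (x * b)) * form_value 0 0 0 0 0 1 1 x y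
  + 1 * form_value 0 b 1 0 0 0 1 x y.
Proof. by rewrite /form_value; ring. Qed.
Lemma normal_II_1 x y : x - y * 1 = 0 * form_value 0 0 0 1 0 0 1 x y
  + 1 * form_value 0 0 0 0 (-1) 1 1 x y.
Proof. by rewrite /form_value; ring. Qed.
Lemma normal_II_2 x y : y ^+ 2 = 1 * form_value 0 0 0 1 0 0 1 x y
  + (- y) * form_value 0 0 0 0 (-1) 1 1 x y.
Proof. by rewrite /form_value; ring. Qed.
Lemma normal_IV_1 x y : x - y * y = 1 * form_value 0 0 (-1) 0 0 1 1 x y
  + 0 * form_value 0 0 0 1 0 0 1 x y.
Proof. by rewrite /form_value; ring. Qed.
Lemma normal_IV_2 x y : y ^+ 3 = (- y) * form_value 0 0 (-1) 0 0 1 1 x y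
  + 1 * form_value 0 0 0 1 0 0 1 x y.
Proof. by rewrite /form_value; ring. Qed.
Lemma normal_V_1 x y : x - y * y = 1 * form_value 0 0 (-1) 0 0 1 1 x y
  + 0 * form_value 0 1 0 0 0 0 1 x y.
Proof. by rewrite /form_value; ring. Qed.
Lemma normal_V_2 x y : y ^+ 4 = (- (x + y * y)) * form_value 0 0 (-1) 0 0 1 1 x y
  + 1 * form_value 0 1 0 0 0 0 1 x y.
Proof. by rewrite /form_value; ring. Qed.

End Identities.

Lemma simple_solve1 (F : fieldType) (A B D E x y : F) : A * D - B * E != 0 ->
  x - y * 0 = D * (A * D - B * E)^-1 * (x * A + y * B)
            + (- B) * (A * D - B * E)^-1 * (x * E + y * D).
Proof. by move=> d0; field. Qed.

Lemma simple_solve2 (F : fieldType) (A B D E x y : F) : A * D - B * E != 0 ->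
  y ^+ 1 = - E * (A * D - B * E)^-1 * (x * A + y * B)
            + A * (A * D - B * E)^-1 * (x * E + y * D).
Proof. by move=> d0; rewrite expr1; field. Qed.

Section NormalForms.
Variable C : fieldType.
Local Notation A2 := {poly {poly C}}.
Local Notation K := {fraction A2}.
Implicit Types (f g : 'rV[C]_6) (M N : 'M[C]_3).

(* At the origin of the chart x = 1, the ideal of the pencil is (y - h(z), z^k). *)
Definition normal_pencil f g k := exists (h f1 g1 : {poly C}), [/\ h.[0] = 0,
  (forall x y : K, local_max x -> local_max y -> exists y0 al be,
     [/\ local_ring y0, local_ring al, local_ring be & x - y * y0 =
       al * qform_eval (map_mx (const_fracr C) f) (v3 1 x y)
       + be * qform_eval (map_mx (const_fracr C) g) (v3 1 x y)]),
  (forall x y : K, local_max x -> local_max y -> exists al be,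
     [/\ local_ring al, local_ring be & y ^+ k =
       al * qform_eval (map_mx (const_fracr C) f) (v3 1 x y)
       + be * qform_eval (map_mx (const_fracr C) g) (v3 1 x y)]),
  qform_eval (map_mx polyC f) (v3 1 h 'X) = 'X^k * f1 &
  qform_eval (map_mx polyC g) (v3 1 h 'X) = 'X^k * g1].

Lemma local_equation_act c M N :
  local_equation (act N c) M = local_equation c (M *m N).
Proof.
by rewrite !local_equationE map_act qform_eval_act -mulmxA -map_mxM.
Qed.

Lemma row0_neq0 M : M \in unitmx -> row 0 M != 0.
Proof.
move=> Mu; apply/negP => /eqP r0; have : \det M = 0.
  rewrite (expand_det_row _ 0) big1// => j _.
  by have /rowP/(_ j) := r0; rewrite !mxE => ->; rewrite mul0r.
by move=> d0; move: Mu; rewrite unitmxE d0 unitr0.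
Qed.

Lemma normal_pencil_multiplicity f g N k p : N \in unitmx ->
  p = proj_pt (row 0 N) -> normal_pencil (act N f) (act N g) k ->
  forall k', intersection_multiplicity f g p k' <-> k' = k.
Proof.
move=> Nu -> [h [f1 [g1 [h0 HU HW fE gE]]]].
have all M : M \in unitmx -> proj_pt (row 0 M) = proj_pt (row 0 N) ->
    local_multiplicity (local_equation f M) (local_equation g M) k.
  move=> Mu /esym/(proj_ptP (row0_neq0 Nu) (row0_neq0 Mu))[a a0 rE].
  pose T := M *m invmx N.
  have Tu : T \in unitmx by rewrite unitmx_mul Mu unitmx_inv.
  have TN : T *m N = M by rewrite /T -mulmxA mulVmx// mulmx1.
  (* The chart [M] is centred at the same point as [N], so relative to [N] its first row is a
     multiple of the first basis vector. *)
  have T0 : row 0 T = v3 a 0 0.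
    rewrite /T row_mul rE -scalemxAl -row_mul mulmxV// row1.
    apply/rowP => j; rewrite !mxE; case: j => -[|[|[|//]]] ? /=; ring.
  clearbody T; rewrite -TN -!local_equation_act.
  have [b [c [d [e [y [z TE]]]]]] : exists b c d e y z : C,
      T = m3 (v3 a 0 0) (v3 b c d) (v3 e y z).
    do 6!eexists; rewrite {1}(m3_eta T) row0_inord T0.
    by congr m3; exact: v3_eta.
  have detT : c * z - d * y != 0.
    move: Tu; rewrite unitmxE unitfE TE det_m3 /det3 !mul0r subr0 addr0.
    by apply: contraNneq => ->; rewrite mulr0.
  by rewrite TE; exact: (chart_multiplicity _ _ a0 detT h0 HU HW fE gE).
move=> k'; split=> [[M [Mu pM Hk']]|->]; last by exists N; split=> //; exact: all.
exact: local_multiplicity_unique Hk' (all M Mu pM).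
Qed.

(** Transversal intersection: the linear parts of the forms are the two coordinates, so the pair of
    values is (x, y) times a matrix whose determinant is 1 plus an element of the maximal ideal.
    Cramer's rule recovers x and y. *)
Lemma normal_pencil_simple (a1 b1 c1 a2 b2 c2 : C) :
  normal_pencil (q6 0 a1 b1 c1 0 1) (q6 0 a2 b2 c2 1 0) 1.
Proof.
have main (x y : K) : local_max x -> local_max y ->
  exists A B D E, [/\ local_ring A, local_ring B, local_ring D & local_ring E] /\
  [/\ A * D - B * E != 0, local_ring (A * D - B * E)^-1,
    qform_eval (map_mx (const_fracr C) (q6 0 a1 b1 c1 0 1)) (v3 1 x y) = x * A + y * B &
    qform_eval (map_mx (const_fracr C) (q6 0 a2 b2 c2 1 0)) (v3 1 x y) = x * E + y * D].
  move=> mx my.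
  have O1 := local_ring1 C.
  have mxk c : local_max (x * const_fracr C c).
    by apply: local_maxM => //; exact: local_ring_const.
  have myk c : local_max (y * const_fracr C c).
    by apply: local_maxM => //; exact: local_ring_const.
  exists (1 + (x * const_fracr C a1 + y * const_fracr C c1)), (y * const_fracr C b1).
  exists (1 + (y * const_fracr C b2 + x * const_fracr C c2)), (x * const_fracr C a2).
  set m1 := x * const_fracr C a1 + _; set m2 := y * const_fracr C b2 + _.
  have mm1 : local_max m1 by exact: local_maxD.
  have mm2 : local_max m2 by exact: local_maxD.
  have O1m1 : local_ring (1 + m1) by apply: local_ringD => //; exact: local_maxW.
  have O1m2 : local_ring (1 + m2) by apply: local_ringD => //; exact: local_maxW.
  have Oy := local_maxW (myk b1); have Ox := local_maxW (mxk a2).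
  split; first by [].
  have [n0 On] : const_frac 1 + (m1 * (1 + m2) + m2 + y * const_fracr C b1 * - (x * const_fracr C a2)) != 0 /\
     local_ring (const_frac 1 + (m1 * (1 + m2) + m2 + y * const_fracr C b1 * - (x * const_fracr C a2)))^-1.
    apply: local_unit; first exact: oner_neq0.
    apply: local_maxD; last by apply: local_maxM => //; exact: local_ringN.
    by apply: local_maxD => //; exact: local_maxM.
  have detE : (1 + m1) * (1 + m2) - y * const_fracr C b1 * (x * const_fracr C a2) =
    const_frac 1 + (m1 * (1 + m2) + m2 + y * const_fracr C b1 * - (x * const_fracr C a2)).
    by rewrite const_frac1; exact: simple_det.
  split; rewrite ?detE//.
    by rewrite map_q6 (rmorph0 (const_fracr C)) (rmorph1 (const_fracr C)) simple_F.
  by rewrite map_q6 (rmorph0 (const_fracr C)) (rmorph1 (const_fracr C)) simple_G.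
exists 0, (b1%:P * 'X), (1 + b2%:P * 'X); split; first by rewrite horner0.
- move=> x y mx my; have [A [B [D [E [[OA OB OD OE] [d0 Od FE GE]]]]]] := main x y mx my.
  exists 0, (D * (A * D - B * E)^-1), (- B * (A * D - B * E)^-1).
  split; [exact: local_ring0|exact: local_ringM|by apply: local_ringM => //; exact: local_ringN|].
  by rewrite FE GE; exact: simple_solve1.
- move=> x y mx my; have [A [B [D [E [[OA OB OD OE] [d0 Od FE GE]]]]]] := main x y mx my.
  exists (- E * (A * D - B * E)^-1), (A * (A * D - B * E)^-1).
  split; [by apply: local_ringM => //; exact: local_ringN|exact: local_ringM|].
  by rewrite FE GE; exact: simple_solve2.
- by rewrite map_q6 rmorph0 rmorph1 simple_F; ring.
- by rewrite map_q6 rmorph0 rmorph1 simple_G; ring.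
Qed.

Local Notation kf := (const_fracr C).
Let k0 := rmorph0 kf.
Let k1 := rmorph1 kf.
Let kN1 : kf (-1) = -1. Proof. exact: rmorphN1. Qed.
Let kf_form (a b c d e f : C) (x y : K) :
  qform_eval (map_mx kf (q6 a b c d e f)) (v3 1 x y) =
  form_value (kf a) (kf b) (kf c) (kf d) (kf e) (kf f) 1 x y.
Proof. by rewrite map_q6 qform_evalE. Qed.

(** Covers the double base points of three types: [b] is 0 for III and IIIa, and 1 for IIa. *)
Lemma normal_pencil_III b : normal_pencil (q6 0 0 0 0 0 1) (q6 0 b 1 0 0 0) 2.
Proof.
have O0 := local_ring0 C; have O1 := local_ring1 C.
exists 0, 0, 1; split; first by rewrite horner0.
- move=> x y mx my; exists 0, 1, 0; split=> //.
  by rewrite !kf_form k0 k1; exact: normal_III_1.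
- move=> x y mx my; exists (- (x * kf b)), 1; split=> //.
    by apply: local_ringN; apply: local_ringM (local_maxW mx) _; exact: local_ring_const.
  by rewrite !kf_form k0 k1; exact: normal_III_2.
- by rewrite map_q6 rmorph0 rmorph1 qform_evalE; ring.
- by rewrite map_q6 rmorph0 rmorph1 qform_evalE; ring.
Qed.

Lemma normal_pencil_II : normal_pencil (q6 0 0 0 1 0 0) (q6 0 0 0 0 (-1) 1) 2.
Proof.
have O0 := local_ring0 C; have O1 := local_ring1 C.
exists 'X, 1, 0; split; first by rewrite hornerX.
- move=> x y mx my; exists 1, 0, 1; split=> //.
  by rewrite !kf_form k0 k1 kN1; exact: normal_II_1.
- move=> x y mx my; exists 1, (- y); split=> //.
    exact/local_ringN/local_maxW.
  by rewrite !kf_form k0 k1 kN1; exact: normal_II_2.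
- by rewrite map_q6 rmorph0 rmorph1 qform_evalE; ring.
- by rewrite map_q6 rmorphN1 rmorph0 rmorph1 qform_evalE; ring.
Qed.

(** On the conic x = y^2 of the chart the second form restricts to y^3; for type V below it
    restricts to y^4. *)
Lemma normal_pencil_IV : normal_pencil (q6 0 0 (-1) 0 0 1) (q6 0 0 0 1 0 0) 3.
Proof.
have O0 := local_ring0 C; have O1 := local_ring1 C.
exists ('X ^+ 2), 0, 1; split; first by rewrite hornerXn expr0n.
- move=> x y mx my; have Oy := local_maxW my; exists y, 1, 0; split=> //.
  by rewrite !kf_form k0 k1 kN1; exact: normal_IV_1.
- move=> x y mx my; exists (- y), 1; split=> //.
    exact/local_ringN/local_maxW.
  by rewrite !kf_form k0 k1 kN1; exact: normal_IV_2.
- by rewrite map_q6 rmorphN1 rmorph0 rmorph1 qform_evalE; ring.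
- by rewrite map_q6 rmorph0 rmorph1 qform_evalE; ring.
Qed.

Lemma normal_pencil_V : normal_pencil (q6 0 0 (-1) 0 0 1) (q6 0 1 0 0 0 0) 4.
Proof.
have O0 := local_ring0 C; have O1 := local_ring1 C.
exists ('X ^+ 2), 0, 1; split; first by rewrite hornerXn expr0n.
- move=> x y mx my; have Oy := local_maxW my; exists y, 1, 0; split=> //.
  by rewrite !kf_form k0 k1 kN1; exact: normal_V_1.
- move=> x y mx my; have Oy := local_maxW my; have Ox := local_maxW mx.
  exists (- (x + y * y)), 1; split=> //.
    by apply: local_ringN; apply: local_ringD => //; exact: local_ringM.
  by rewrite !kf_form k0 k1 kN1; exact: normal_V_2.
- by rewrite map_q6 rmorphN1 rmorph0 rmorph1 qform_evalE; ring.
- by rewrite map_q6 rmorph0 rmorph1 qform_evalE; ring.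
Qed.

End NormalForms.

(** * Pencils of conics *)

Lemma span_comb (S : comNzRingType) (A B a b c d x y : S) :
  A * (a * x + b * y) + B * (c * x + d * y) = (A * a + B * c) * x + (A * b + B * d) * y.
Proof. by ring. Qed.

Section Pencils.
Variable C : fieldType.
Implicit Types (f g : 'rV[C]_6) (M N : 'M[C]_3) (p : projective C 2).

Definition same_span f g f0 g0 := exists a b c d : C, [/\ a * d - b * c != 0,
  f = a *: f0 + b *: g0 & g = c *: f0 + d *: g0].

Lemma same_span_refl f g : same_span f g f g.
Proof. by exists 1, 0, 0, 1; rewrite !scale1r !scale0r addr0 add0r mulr0 subr0 mulr1 oner_neq0. Qed.

Lemma same_span_sym f g f0 g0 : same_span f g f0 g0 -> same_span f0 g0 f g.
Proof.
move=> [a [b [c [d [D fE gE]]]]]; set D0 := a * d - b * c in D.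
exists (d / D0), (- b / D0), (- c / D0), (a / D0); split.
- have -> : d / D0 * (a / D0) - - b / D0 * (- c / D0) = D0 / D0 ^+ 2.
    by rewrite /D0; field; exact: D.
  by rewrite mulf_neq0// invr_eq0 sqrf_eq0.
- rewrite fE gE !scalerDr !scalerA addrACA -!scalerDl.
  have -> : d / D0 * a + - b / D0 * c = 1 by rewrite /D0; field; exact: D.
  have -> : d / D0 * b + - b / D0 * d = 0 by rewrite /D0; field; exact: D.
  by rewrite scale1r scale0r addr0.
- rewrite fE gE !scalerDr !scalerA addrACA -!scalerDl.
  have -> : - c / D0 * a + a / D0 * c = 0 by rewrite /D0; field; exact: D.
  have -> : - c / D0 * b + a / D0 * d = 1 by rewrite /D0; field; exact: D.
  by rewrite scale1r scale0r add0r.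
Qed.

Lemma same_span_trans f g f0 g0 f1 g1 :
  same_span f g f0 g0 -> same_span f0 g0 f1 g1 -> same_span f g f1 g1.
Proof.
move=> [a [b [c [d [D -> ->]]]]] [a' [b' [c' [d' [D' -> ->]]]]].
exists (a * a' + b * c'), (a * b' + b * d'), (c * a' + d * c'), (c * b' + d * d').
split; first by rewrite (_ : _ - _ = (a * d - b * c) * (a' * d' - b' * c'));
  [rewrite mulf_neq0|ring].
- by rewrite !scalerDr !scalerA addrACA -!scalerDl.
- by rewrite !scalerDr !scalerA addrACA -!scalerDl.
Qed.

Lemma same_span_act M f g f0 g0 :
  same_span f g f0 g0 -> same_span (act M f) (act M g) (act M f0) (act M g0).
Proof.
by move=> [a [b [c [d [D -> ->]]]]]; exists a, b, c, d; split=> //;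
  rewrite actD !actZ.
Qed.

Lemma same_span_scale a b f g : a != 0 -> b != 0 -> same_span (a *: f) (b *: g) f g.
Proof.
move=> a0 b0; exists a, 0, 0, b; rewrite !scale0r addr0 add0r mulr0 subr0.
by rewrite mulf_neq0.
Qed.

Lemma local_ideal_span f g f0 g0 M : same_span f g f0 g0 ->
  local_ideal (local_equation f M) (local_equation g M) `<=`
  local_ideal (local_equation f0 M) (local_equation g0 M).
Proof.
move=> [a [b [c [d [_ fE gE]]]]] x [A [B [OA OB ->]]].
have leE s t : tofrac (local_equation (s *: f0 + t *: g0) M) =
   const_frac s * tofrac (local_equation f0 M) + const_frac t * tofrac (local_equation g0 M).
  rewrite !local_equationE map_mxD !map_mxZ qform_evalD !qform_evalZ tofracD !tofracM.
  by [].
rewrite fE gE (leE a b) (leE c d).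
exists (A * const_frac a + B * const_frac c), (A * const_frac b + B * const_frac d).
have OM x1 s : local_ring x1 -> local_ring (x1 * const_frac s).
  by move=> Ox1; apply: local_ringM Ox1 _; exact: local_ring_const.
split; [by apply: local_ringD; exact: OM | by apply: local_ringD; exact: OM |].
exact: span_comb.
Qed.

(** The multiplicity sees only the local ideal, and any two bases of a pencil generate the same
    one. *)
Lemma local_multiplicity_span f g f0 g0 M k : same_span f g f0 g0 ->
  local_multiplicity (local_equation f M) (local_equation g M) k ->
  local_multiplicity (local_equation f0 M) (local_equation g0 M) k.
Proof.
move=> fg; have IE : local_ideal (local_equation f M) (local_equation g M) =
  local_ideal (local_equation f0 M) (local_equation g0 M).
  apply/seteqP; split; first exact: local_ideal_span.
  exact/local_ideal_span/same_span_sym.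
by rewrite /local_multiplicity IE.
Qed.

Lemma intersection_multiplicity_span f g f0 g0 p k : same_span f g f0 g0 ->
  intersection_multiplicity f g p k -> intersection_multiplicity f0 g0 p k.
Proof.
move=> fg [M [Mu pM H]]; exists M; split=> //.
exact: local_multiplicity_span fg H.
Qed.

Definition base_points f g k : set (projective C 2) :=
  [set p | [/\ qform_eval f (proj_repr p) = 0, qform_eval g (proj_repr p) = 0
             & intersection_multiplicity f g p k]].

Lemma base_points_span f g f0 g0 k : same_span f g f0 g0 ->
  base_points f g k = base_points f0 g0 k.
Proof.
have H f1 g1 f2 g2 : same_span f1 g1 f2 g2 -> base_points f1 g1 k `<=` base_points f2 g2 k.
  move=> fg p [fp gp mp]; split; last exact: intersection_multiplicity_span fg mp.
    have [a [b [c [d [_ -> _]]]]] := same_span_sym fg.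
    by rewrite qform_evalD !qform_evalZ fp gp !mulr0 addr0.
  have [a [b [c [d [_ _ ->]]]]] := same_span_sym fg.
  by rewrite qform_evalD !qform_evalZ fp gp !mulr0 addr0.
by move=> fg; apply/seteqP; split; apply: H => //; exact: same_span_sym.
Qed.

Definition proj_mul N p := proj_pt (proj_repr p *m N).

Lemma mulmx_unit_neq0 N (v : 'rV[C]_3) : N \in unitmx -> v != 0 -> v *m N != 0.
Proof.
move=> Nu; apply: contra_neq => vN0.
by rewrite -[v]mulmx1 -(mulmxV Nu) mulmxA vN0 mul0mx.
Qed.

Lemma proj_mul_pt N v : N \in unitmx -> v != 0 -> proj_mul N (proj_pt v) = proj_pt (v *m N).
Proof.
move=> Nu v0; have [a a0 E] := proj_repr_pt v0.
by rewrite /proj_mul E -scalemxAl proj_ptZ// mulmx_unit_neq0.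
Qed.

Lemma proj_mulK N p : N \in unitmx -> proj_mul (invmx N) (proj_mul N p) = p.
Proof.
move=> Nu; elim/proj_pt_ind: p => v v0.
rewrite (proj_mul_pt Nu v0) proj_mul_pt ?unitmx_inv//; last exact: mulmx_unit_neq0.
by rewrite mulmxK.
Qed.

Lemma proj_mulKV N p : N \in unitmx -> proj_mul N (proj_mul (invmx N) p) = p.
Proof.
by move=> Nu; have := @proj_mulK (invmx N) p; rewrite invmxK unitmx_inv; apply.
Qed.

Lemma qform_eval_repr f v : v != 0 ->
  (qform_eval f (proj_repr (proj_pt v)) = 0) <-> (qform_eval f v = 0).
Proof.
move=> v0; have [a a0 ->] := proj_repr_pt v0; rewrite qform_eval_scale.
by split=> [/eqP|->]; rewrite ?mulr0// mulf_eq0 sqrf_eq0 (negbTE a0) => /eqP.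
Qed.

(** Composing with [N] carries a chart centred at p to a chart centred at its image, with the same
    local equations. *)
Lemma base_points_act f g N p k : N \in unitmx ->
  base_points (act N f) (act N g) k p <-> base_points f g k (proj_mul N p).
Proof.
move=> Nu; have NpE := mulmx_unit_neq0 Nu (proj_repr_neq0 p).
have E h : qform_eval (act N h) (proj_repr p) = 0 <->
    qform_eval h (proj_repr (proj_mul N p)) = 0.
  rewrite qform_eval_act; split=> [|/(qform_eval_repr h NpE)//].
  by move=> ?; apply/(qform_eval_repr h NpE).
split=> -[/E fp /E gp [M [Mu pM H]]]; split=> //.
  exists (M *m N); split; first by rewrite unitmx_mul Mu.
    by rewrite row_mul -pM proj_mul_pt// row0_neq0.
  by rewrite -!local_equation_act.
exists (M *m invmx N); split; first by rewrite unitmx_mul Mu unitmx_inv.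
  rewrite row_mul -proj_mul_pt ?unitmx_inv ?row0_neq0// pM.
  exact: proj_mulK.
by rewrite !local_equation_act mulmxKV.
Qed.

End Pencils.

(** * Real pencils and projective equivalence *)

Section RealPencils.
Variable R : realType.
Implicit Types (f g : 'rV[R]_6) (M N : 'M[R]_3).
Local Notation cx := (@complexify R _).

Definition projectively_equivalent f g f0 g0 :=
  exists2 M, M \in unitmx & same_span (act M f) (act M g) f0 g0.

Lemma complexify_span f g f0 g0 : same_span f g f0 g0 ->
  same_span (cx f) (cx g) (cx f0) (cx g0).
Proof.
move=> [a [b [c [d [D -> ->]]]]].
exists (real_complex R a), (real_complex R b), (real_complex R c), (real_complex R d).
by rewrite /complexify !map_mxD !map_mxZ -!rmorphM -rmorphB fmorph_eq0.
Qed.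

Lemma complexify_neq0 n (v : 'rV[R]_n) : (cx v == 0) = (v == 0).
Proof. exact: map_mx_eq0. Qed.

Lemma complexify_repr_span f g : f != 0 -> g != 0 ->
  same_span (cx (proj_repr (proj_pt f))) (cx (proj_repr (proj_pt g))) (cx f) (cx g).
Proof.
move=> f0 g0; apply: complexify_span.
have [a a0 ->] := proj_repr_pt f0; have [b b0 ->] := proj_repr_pt g0.
exact: same_span_scale.
Qed.

Lemma intersection_points_couple f g k : f != 0 -> g != 0 ->
  intersection_points (couple f g) k = base_points (cx f) (cx g) k.
Proof.
move=> f0 g0.
by rewrite -(base_points_span _ (complexify_repr_span f0 g0)).
Qed.

Lemma real_point_mul N p : N \in unitmx -> real_point p ->
  real_point (proj_mul (map_mx (real_complex R) N) p).
Proof.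
move=> Nu [v v0 ->]; exists (v *m N); first exact: mulmx_unit_neq0.
by rewrite proj_mul_pt ?map_unitmx ?complexify_neq0// /complexify map_mxM.
Qed.

Lemma real_point_mulE N p : N \in unitmx ->
  real_point (proj_mul (map_mx (real_complex R) N) p) <-> real_point p.
Proof.
move=> Nu; split=> [H|]; last exact: real_point_mul.
have := real_point_mul (_ : invmx N \in unitmx) H; rewrite unitmx_inv map_invmx.
by rewrite proj_mulK ?map_unitmx//; apply.
Qed.

Lemma same_intersections_span f g f0 g0 : f != 0 -> g != 0 -> f0 != 0 -> g0 != 0 ->
  same_span f g f0 g0 -> same_intersections (couple f g) (couple f0 g0).
Proof.
move=> fn gn f0n g0n fg k.
rewrite /real_intersections /imaginary_intersections.
rewrite (intersection_points_couple k fn gn) (intersection_points_couple k f0n g0n).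
by rewrite (base_points_span _ (complexify_span fg)).
Qed.

Lemma same_intersections_act f g M : f != 0 -> g != 0 -> M \in unitmx ->
  same_intersections (couple (act M f) (act M g)) (couple f g).
Proof.
move=> fn gn Mu k; have fMn : act M f != 0 by rewrite act_eq0.
have gMn : act M g != 0 by rewrite act_eq0.
rewrite /real_intersections /imaginary_intersections.
rewrite (intersection_points_couple k fn gn) (intersection_points_couple k fMn gMn).
have MCu : map_mx (real_complex R) M \in unitmx by rewrite map_unitmx.
pose phi := proj_mul (map_mx (real_complex R) M).
have phi_inj : injective phi.
  by move=> x y xy; rewrite -(proj_mulK x MCu) -/phi xy /phi (proj_mulK y MCu).
have phi_surj y : exists x, phi x = y.
  exists (proj_mul (invmx (map_mx (real_complex R) M)) y).
  exact: proj_mulKV.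
have bE p : base_points (cx (act M f)) (cx (act M g)) k p <->
    base_points (cx f) (cx g) k (phi p).
  by rewrite /complexify !map_act; exact: base_points_act.
have rE p : real_point (phi p) <-> real_point p by exact: real_point_mulE.
have tr (A B : set (projective R[i] 2)) : (forall p, A p <-> B (phi p)) -> A #= B.
  move=> AB; have -> : B = phi @` A.
    apply/seteqP; split=> [y By|_ [x /AB ? <-]//].
    by have [x xy] := phi_surj y; exists x => //; apply/AB; rewrite xy.
  by rewrite card_eq_sym; apply: inj_card_eq => x y _ _; exact: phi_inj.
split; apply: tr => p /=; split=> -[/bE H1 H2]; split=> //; try exact/rE.
Qed.

(** A real projective map is a bijection on base points that preserves reality and multiplicity, and
    a change of basis of the pencil leaves them in place. *)
Lemma same_intersections_pencil f g f0 g0 : f != 0 -> g != 0 -> f0 != 0 -> g0 != 0 ->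
  projectively_equivalent f g f0 g0 -> same_intersections (couple f g) (couple f0 g0).
Proof.
move=> fn gn f0n g0n [M Mu fg].
have fMn : act M f != 0 by rewrite act_eq0.
have gMn : act M g != 0 by rewrite act_eq0.
exact: (same_intersections_trans (same_intersections_sym (same_intersections_act fn gn Mu))
  (same_intersections_span fMn gMn f0n g0n fg)).
Qed.

Lemma projectively_equivalent_trans f g f0 g0 f1 g1 :
  projectively_equivalent f g f0 g0 -> projectively_equivalent f0 g0 f1 g1 ->
  projectively_equivalent f g f1 g1.
Proof.
move=> [M Mu H1] [N Nu H2]; exists (N *m M); first by rewrite unitmx_mul Nu.
rewrite -!act_comp; exact: same_span_trans (same_span_act N H1) H2.
Qed.

Lemma projectively_equivalent_span f g f0 g0 :
  same_span f g f0 g0 -> projectively_equivalent f g f0 g0.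
Proof. by move=> H; exists 1%:M; rewrite ?unitmx1// !act1. Qed.

Lemma projectively_equivalent_act f g M : M \in unitmx ->
  projectively_equivalent f g (act M f) (act M g).
Proof. by move=> Mu; exists M => //; exact: same_span_refl. Qed.

End RealPencils.

(** * Base points of the normal pencils *)

Variant pencil_type :=
  Type_I | Type_Ia | Type_Ib | Type_II | Type_IIa | Type_III | Type_IIIa | Type_IV | Type_V.

(** The second generator is chosen degenerate in every type, so that each proper member is, up to a
    factor, the first generator plus a real multiple of the second. *)
Definition pencil_fst (S : comNzRingType) (t : pencil_type) : 'rV[S]_6 :=
  match t with
  | Type_I => q6 1 0 (-1) 0 0 0
  | Type_Ia => q6 1 1 1 0 0 0
  | Type_Ib => q6 1 1 (-1) 0 0 0
  | Type_II => q6 0 0 0 1 0 0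
  | Type_IIa => q6 0 1 1 0 0 0
  | Type_III => q6 0 0 0 0 1 0
  | Type_IIIa => q6 1 1 0 0 0 0
  | Type_IV | Type_V => q6 0 (-1) 0 0 1 0
  end.

Definition pencil_snd (S : comNzRingType) (t : pencil_type) : 'rV[S]_6 :=
  match t with
  | Type_I => q6 0 (-1) 1 0 0 0
  | Type_Ia | Type_Ib | Type_IIa => q6 0 0 0 0 1 0
  | Type_II => q6 0 0 0 0 (-1) 1
  | Type_III => q6 0 1 0 0 0 0
  | Type_IIIa => q6 0 0 1 0 0 0
  | Type_IV => q6 0 0 0 0 0 1
  | Type_V => q6 1 0 0 0 0 0
  end.

(** Only which multiplicities occur is recorded, not how often: together with the imaginary ones
    this already separates the nine types. *)
Definition real_multiplicities t : seq nat :=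
  match t with
  | Type_I | Type_Ib => [:: 1]
  | Type_II => [:: 1; 2]
  | Type_IIa | Type_III => [:: 2]
  | Type_IV => [:: 1; 3]
  | Type_V => [:: 4]
  | Type_Ia | Type_IIIa => [::]
  end%N.

Definition imaginary_multiplicities t : seq nat :=
  match t with
  | Type_Ia | Type_Ib | Type_IIa => [:: 1]
  | Type_IIIa => [:: 2]
  | _ => [::]
  end%N.

Lemma pencil_type_inj t t' :
  real_multiplicities t =i real_multiplicities t' ->
  imaginary_multiplicities t =i imaginary_multiplicities t' -> t = t'.
Proof.
move=> r i; have := r 1%N; have := r 2%N; have := r 3%N; have := i 1%N; have := i 2%N.
by case: t {r i} => /=; case: t' => /=; rewrite ?inE.
Qed.

Section Multiplicities.
Variable F : fieldType.
Hypothesis two_neq0 : (2%:R : F) != 0.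
Implicit Types (x y z a b c : F).

Definition has_multiplicity t (v : 'rV[F]_3) k := forall k',
  intersection_multiplicity (pencil_fst F t) (pencil_snd F t) (proj_pt v) k' <-> k' = k.

Lemma v3_neq0 x y z : (v3 x y z != 0) = [|| x != 0, y != 0 | z != 0].
Proof.
rewrite -!negb_and; congr (~~ _); apply/eqP/and3P=> [|[/eqP-> /eqP-> /eqP->]].
  by rewrite v30 => /rowP H; split; apply/eqP;
    [have := H (inord 0)|have := H (inord 1)|have := H (inord 2)]; rewrite !v3E.
by rewrite -v30.
Qed.

(** At a simple point the polar forms of f and g against [v] are independent; [w] and [u] are dual
    to them, so in the frame (v, w, u) the two forms begin with xy and xz. *)
Lemma has_multiplicity1 t x y z w0 w1 w2 u0 u1 u2 :
  det3 x y z w0 w1 w2 u0 u1 u2 != 0 ->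
  let f := pencil_fst F t in let g := pencil_snd F t in
  let v := v3 x y z in let w := v3 w0 w1 w2 in let u := v3 u0 u1 u2 in
  qform_eval f v = 0 -> qform_eval g v = 0 ->
  polar_form f v w = 1 -> polar_form f v u = 0 ->
  polar_form g v w = 0 -> polar_form g v u = 1 ->
  has_multiplicity t v 1.
Proof.
move=> dn f g v w u fv gv fw fu gw gu.
apply: (@normal_pencil_multiplicity _ _ _ (m3 v w u)).
- by rewrite unitmxE unitfE det_m3.
- by rewrite -row0_inord row_m3.
- rewrite !act_m3 fv gv fw fu gw gu; exact: normal_pencil_simple.
Qed.

Definition formsE := (qform_evalE, polar_formE, q6E, v3E).

Lemma has_multiplicity_II : has_multiplicity Type_II (v3 1 0 0) 2.
Proof.
apply: (@normal_pencil_multiplicity _ _ _ 1%:M); rewrite ?unitmx1//.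
  by congr proj_pt; apply/rowP => j; rewrite !mxE; case: j => -[|[|[|//]]].
by rewrite !act1; exact: normal_pencil_II.
Qed.

(** The point is completed to a frame in which the generators, in one order or the other, take a
    known local normal form. *)
Lemma has_multiplicity_m3 t (v w u : 'rV[F]_3) f g k : m3 v w u \in unitmx ->
  act (m3 v w u) (pencil_fst F t) = f -> act (m3 v w u) (pencil_snd F t) = g ->
  normal_pencil f g k \/ normal_pencil g f k -> has_multiplicity t v k.
Proof.
move=> Nu <- <- [] H k'.
  apply: (normal_pencil_multiplicity Nu _ H); by rewrite -row0_inord row_m3.
have swap f1 g1 : same_span f1 g1 g1 f1.
  exists 0, 1, 1, 0; rewrite !scale1r !scale0r add0r addr0 mul0r sub0r mulr1.
  by rewrite oppr_eq0 oner_eq0.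
have pE : proj_pt v = proj_pt (row 0 (m3 v w u)) by rewrite -row0_inord row_m3.
rewrite -(normal_pencil_multiplicity Nu pE H k'); split=> H1;
  exact: intersection_multiplicity_span H1.
Qed.

Lemma has_multiplicity_IIa : has_multiplicity Type_IIa (v3 1 0 0) 2.
Proof.
apply: (@has_multiplicity_m3 _ _ (v3 0 0 1) (v3 0 1 0) (q6 0 1 1 0 0 0) (q6 0 0 0 0 0 1)).
- rewrite unitmxE unitfE det_m3 /det3 (_ : _ + _ = -1); last by ring.
  by rewrite oppr_eq0 oner_eq0.
- by rewrite act_m3 !formsE; congr q6; ring.
- by rewrite act_m3 !formsE; congr q6; ring.
- right; exact: normal_pencil_III.
Qed.

Lemma has_multiplicity_III x z : (x == 0) != (z == 0) ->
  has_multiplicity Type_III (v3 x 0 z) 2.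
Proof.
have [->|x0] := eqVneq x 0; have [->|z0] := eqVneq z 0 => // _.
  apply: (@has_multiplicity_m3 _ _ (v3 z^-1 0 0) (v3 0 1 0) (q6 0 0 0 0 0 1) (q6 0 0 1 0 0 0)).
  - rewrite unitmxE unitfE det_m3 /det3 (_ : _ + _ = z * z^-1); last by ring.
    by rewrite mulfV// oner_eq0.
  - by rewrite act_m3 !formsE; congr q6; field.
  - by rewrite act_m3 !formsE; congr q6; ring.
  - left; exact: normal_pencil_III.
apply: (@has_multiplicity_m3 _ _ (v3 0 0 x^-1) (v3 0 1 0) (q6 0 0 0 0 0 1) (q6 0 0 1 0 0 0)).
- rewrite unitmxE unitfE det_m3 /det3 (_ : _ + _ = - (x * x^-1)); last by ring.
  by rewrite mulfV// oppr_eq0 oner_eq0.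
- by rewrite act_m3 !formsE; congr q6; field.
- by rewrite act_m3 !formsE; congr q6; ring.
- left; exact: normal_pencil_III.
Qed.

Lemma has_multiplicity_IIIa x y : x != 0 -> y ^+ 2 = - x ^+ 2 ->
  has_multiplicity Type_IIIa (v3 x y 0) 2.
Proof.
move=> x0 y2; have y0 : y != 0 by rewrite -sqrf_eq0 y2 oppr_eq0 sqrf_eq0.
have four_neq0 : 4%:R != 0 :> F by rewrite (natrM _ 2 2) mulf_neq0.
(* The second frame vector is the other base point (x, -y, 0), scaled by [c] to have polar product 1
   with the first; that product is 2c(x^2 - y^2) = 4c x^2. *)
pose c := (4%:R * x ^+ 2)^-1.
apply: (@has_multiplicity_m3 _ _ (v3 (c * x) (- c * y) 0) (v3 0 0 1)
  (q6 0 0 0 0 0 1) (q6 0 0 1 0 0 0)).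
- rewrite unitmxE unitfE det_m3 /det3.
  have -> : x * (- c * y * 1 - 0 * 0) - y * (c * x * 1 - 0 * 0) + 0 * (c * x * 0 - - c * y * 0) =
    - (2%:R * x * c * y) by ring.
  by rewrite oppr_eq0 !mulf_neq0// invr_eq0 mulf_neq0// sqrf_eq0.
- rewrite act_m3 !formsE; congr q6; rewrite ?y2; try by ring.
    by rewrite !exprMn sqrrN y2; ring.
  transitivity (2%:R * c * x ^+ 2 - 2%:R * c * y ^+ 2); first by ring.
  by rewrite y2 /c; field; rewrite x0 four_neq0.
- by rewrite act_m3 !formsE; congr q6; ring.
- left; exact: normal_pencil_III.
Qed.

Lemma has_multiplicityZ t a v k : a != 0 -> v != 0 ->
  has_multiplicity t v k -> has_multiplicity t (a *: v) k.
Proof. by move=> a0 v0 H k'; rewrite proj_ptZ. Qed.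

Lemma has_multiplicity_IV : has_multiplicity Type_IV (v3 0 0 1) 3.
Proof.
apply: (@has_multiplicity_m3 _ _ (v3 1 0 0) (v3 0 1 0) (q6 0 0 (-1) 0 0 1) (q6 0 0 0 1 0 0)).
- rewrite unitmxE unitfE det_m3 /det3 (_ : _ + _ = 1); last by ring.
  by rewrite oner_eq0.
- by rewrite act_m3 !formsE; congr q6; ring.
- by rewrite act_m3 !formsE; congr q6; ring.
- left; exact: normal_pencil_IV.
Qed.

Lemma has_multiplicity_V : has_multiplicity Type_V (v3 0 0 1) 4.
Proof.
apply: (@has_multiplicity_m3 _ _ (v3 1 0 0) (v3 0 1 0) (q6 0 0 (-1) 0 0 1) (q6 0 1 0 0 0 0)).
- rewrite unitmxE unitfE det_m3 /det3 (_ : _ + _ = 1); last by ring.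
  by rewrite oner_eq0.
- by rewrite act_m3 !formsE; congr q6; ring.
- by rewrite act_m3 !formsE; congr q6; ring.
- left; exact: normal_pencil_V.
Qed.

(* A linear form takes the prescribed values as soon as they are reached on two
   vectors spanning a complement of the point. *)
Lemma has_multiplicity_I x y z : z != 0 -> x ^+ 2 = z ^+ 2 -> y ^+ 2 = z ^+ 2 ->
  has_multiplicity Type_I (v3 x y z) 1.
Proof.
move=> z0 xz yz; have x0 : x != 0 by rewrite -sqrf_eq0 xz sqrf_eq0.
have y0 : y != 0 by rewrite -sqrf_eq0 yz sqrf_eq0.
apply: (@has_multiplicity1 _ _ _ _ (2%:R * x)^-1 0 0 0 (- (2%:R * y)^-1) 0).
- rewrite /det3 (_ : _ + _ = - (z * ((2%:R * x)^-1 * (2%:R * y)^-1))); last by ring.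
  by rewrite oppr_eq0 !mulf_neq0// invr_eq0 mulf_neq0.
- by rewrite formsE xz; ring.
- by rewrite formsE yz; ring.
- by rewrite !formsE; field; rewrite x0.
- by rewrite !formsE; ring.
- by rewrite !formsE; ring.
- by rewrite !formsE; field; rewrite y0.
Qed.

Lemma has_multiplicity_Ix0 (t : pencil_type) y z : y != 0 -> z != 0 ->
  (t = Type_Ia /\ y ^+ 2 = - z ^+ 2) \/ (t = Type_Ib /\ y ^+ 2 = z ^+ 2) \/
  (t = Type_IIa /\ y ^+ 2 = - z ^+ 2) ->
  has_multiplicity t (v3 0 y z) 1.
Proof.
move=> y0 z0 H; case: H => [[-> yE]|[[-> yE]|[-> yE]]];
  apply: (@has_multiplicity1 _ _ _ _ 0 (2%:R * y)^-1 0 z^-1 0 0); rewrite ?formsE ?yE; try (by ring);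
  try (by field; rewrite ?y0 ?z0);
  rewrite /det3 (_ : _ + _ = z * (- ((2%:R * y)^-1 * z^-1))); try (by ring);
  by rewrite mulf_neq0// oppr_eq0 mulf_neq0// invr_eq0// mulf_neq0.
Qed.

Lemma has_multiplicity_Iz0 (t : pencil_type) x y : x != 0 -> y ^+ 2 = - x ^+ 2 ->
  t = Type_Ia \/ t = Type_Ib -> has_multiplicity t (v3 x y 0) 1.
Proof.
move=> x0 yE H; have y0 : y != 0 by rewrite -sqrf_eq0 yE oppr_eq0 sqrf_eq0.
case: H => ->; apply: (@has_multiplicity1 _ _ _ _ 0 (2%:R * y)^-1 0 0 0 x^-1); rewrite ?formsE ?yE; try (by ring);
  try (by field; rewrite ?y0 ?x0);
  rewrite /det3 (_ : _ + _ = x * ((2%:R * y)^-1 * x^-1)); try (by ring);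
  by rewrite mulf_neq0// mulf_neq0// invr_eq0// mulf_neq0.
Qed.

Lemma has_multiplicity_II_z z : z != 0 -> has_multiplicity Type_II (v3 0 0 z) 1.
Proof.
move=> z0; apply: (@has_multiplicity1 _ _ _ _ 0 z^-1 0 (- z^-1) 0 0).
- rewrite /det3 (_ : _ + _ = z * (z^-1 * z^-1)); last by ring.
  by rewrite !mulf_neq0// invr_eq0.
all: rewrite !formsE; try (by ring); by field.
Qed.

Lemma has_multiplicity_II_y y : y != 0 -> has_multiplicity Type_II (v3 0 y 0) 1.
Proof.
move=> y0; apply: (@has_multiplicity1 _ _ _ _ 0 0 y^-1 y^-1 0 0).
- rewrite /det3 (_ : _ + _ = y * (y^-1 * y^-1)); last by ring.
  by rewrite !mulf_neq0// invr_eq0.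
all: rewrite !formsE; try (by ring); by field.
Qed.

Lemma has_multiplicity_IV_x x : x != 0 -> has_multiplicity Type_IV (v3 x 0 0) 1.
Proof.
move=> x0; apply: (@has_multiplicity1 _ _ _ _ 0 0 x^-1 0 x^-1 0).
- rewrite /det3 (_ : _ + _ = - (x * (x^-1 * x^-1))); last by ring.
  by rewrite oppr_eq0 !mulf_neq0// invr_eq0.
all: rewrite !formsE; try (by ring); by field.
Qed.

End Multiplicities.

(** * Real and imaginary base points of the normal pencils *)

Section Signature.
Variable R : realType.
Local Notation C := R[i].
Local Notation cx := (@complexify R _).
Implicit Types (x y z : C) (t : pencil_type).

Lemma complex_two_neq0 : (2%:R : C) != 0.
Proof. by rewrite pnatr_eq0. Qed.
Let two := complex_two_neq0.

Lemma complexify_q6 (a b c d e f : R) :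
  cx (q6 a b c d e f) = q6 (a%:C)%C (b%:C)%C (c%:C)%C (d%:C)%C (e%:C)%C (f%:C)%C.
Proof. exact: map_q6. Qed.

Lemma complexify_v3 (a b c : R) : cx (v3 a b c) = v3 (a%:C)%C (b%:C)%C (c%:C)%C.
Proof. exact: map_v3. Qed.

Lemma complexify_pencil t :
  (cx (pencil_fst R t) = pencil_fst C t) * (cx (pencil_snd R t) = pencil_snd C t).
Proof.
by split; case: t; rewrite /= complexify_q6 /= ?rmorphN1 ?rmorph0 ?rmorph1.
Qed.

Lemma qform_eval_complexify (f : 'rV[R]_6) (v : 'rV[R]_3) :
  qform_eval (cx f) (cx v) = ((qform_eval f v)%:C)%C.
Proof. exact: (esym (rmorph_qform_eval (real_complex R) f v)). Qed.

Lemma real_pointP (v : 'rV[C]_3) : v != 0 ->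
  real_point (proj_pt v) <-> exists2 r, r != 0 & exists2 a, a != 0 & v = a *: cx r.
Proof.
move=> v0; split=> [[r r0 rE]|[r r0 [a a0 ->]]]; exists r => //.
  by apply/proj_ptP; rewrite ?complexify_neq0.
by rewrite proj_ptZ// complexify_neq0.
Qed.

(** A real point has a real representative, on which real equations satisfied by [v] must vanish as
    well; so two real forms without common real zero exclude reality. *)
Lemma not_real_point (E1 E2 : 'rV[R]_6) (v : 'rV[C]_3) : v != 0 ->
  qform_eval (cx E1) v = 0 -> qform_eval (cx E2) v = 0 ->
  (forall r, qform_eval E1 r = 0 -> qform_eval E2 r = 0 -> r = 0) ->
  ~ real_point (proj_pt v).
Proof.
move=> v0 E1v E2v H /(real_pointP v0)[r r0 [a a0 vE]]; move: E1v E2v.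
rewrite vE !qform_eval_scale !qform_eval_complexify => /eqP + /eqP.
rewrite !mulf_eq0 ?sqrf_eq0 !(negbTE a0) /= !fmorph_eq0 => /eqP h1 /eqP h2.
by move: r0; rewrite (H r h1 h2) eqxx.
Qed.

Lemma eq0_ring (S : comNzRingType) (a b : S) : a - b = 0 -> a = b.
Proof. by move=> /eqP; rewrite subr_eq0 => /eqP. Qed.

Definition base_case t (v : 'rV[C]_3) k := has_multiplicity t v k /\
  (real_point (proj_pt v) /\ k \in real_multiplicities t \/
   ~ real_point (proj_pt v) /\ k \in imaginary_multiplicities t).

Lemma sum_sq0 (a b : R) : a ^+ 2 + b ^+ 2 = 0 -> a = 0 /\ b = 0.
Proof.
by move=> /eqP; rewrite paddr_eq0 ?sqr_ge0// !sqrf_eq0 => /andP[/eqP-> /eqP->].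
Qed.

Lemma real_v3 x y z (a b c : R) : v3 x y z != 0 -> forall k, k != 0 ->
  v3 x y z = k *: cx (v3 a b c) -> real_point (proj_pt (v3 x y z)).
Proof.
move=> v0 k k0 vE; apply/real_pointP => //; exists (v3 a b c); last by exists k.
by apply: contra_neq v0 => r0; rewrite vE r0 /complexify map_mx0 scaler0.
Qed.

Ltac coeffs := rewrite complexify_v3 v3Z /= ?(rmorph0, rmorph1, rmorphN1);
  congr v3; ring.

(** The two equations are solved over the complex numbers, type by type. Each solution is either a
    multiple of an explicit real vector, or kept away from the real points by two real forms. *)
Lemma base_cover t (v : 'rV[C]_3) : v != 0 ->
  qform_eval (pencil_fst C t) v = 0 -> qform_eval (pencil_snd C t) v = 0 ->
  exists k, base_case t v k.
Proof.
rewrite (v3_eta v); move: (v 0 (inord 0)) (v 0 (inord 1)) (v 0 (inord 2)) => x y z v0.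
have := v0; rewrite v3_neq0 => xyz0.
case: t; rewrite /= !qform_evalE => EA EB.
- have xz : x ^+ 2 = z ^+ 2 by apply: eq0_ring; rewrite -EA; ring.
  have yz : y ^+ 2 = z ^+ 2 by apply/esym/eq0_ring; rewrite -EB; ring.
  have z0 : z != 0.
    move: xyz0; apply: contraTneq => z0; move: xz yz; rewrite z0 expr0n /=.
    by move=> /eqP + /eqP; rewrite !sqrf_eq0 => /eqP-> /eqP->; rewrite eqxx.
  exists 1%N; split; first exact: has_multiplicity_I.
  left; split=> //; move: xz yz => /eqP + /eqP; rewrite !eqf_sqr.
  move=> /orP[/eqP xE|/eqP xE] /orP[/eqP yE|/eqP yE]; subst x y.
  + by apply: (@real_v3 _ _ _ 1 1 1 v0 z z0); coeffs.
  + by apply: (@real_v3 _ _ _ 1 (-1) 1 v0 z z0); coeffs.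
  + by apply: (@real_v3 _ _ _ (-1) 1 1 v0 z z0); coeffs.
  + by apply: (@real_v3 _ _ _ (-1) (-1) 1 v0 z z0); coeffs.
- exists 1%N; split; last first.
    right; split=> //; apply: (not_real_point (E1 := pencil_fst R Type_Ia)
      (E2 := pencil_snd R Type_Ia)) => //.
    + by rewrite complexify_pencil /= qform_evalE.
    + by rewrite complexify_pencil /= qform_evalE.
    move=> r; rewrite (v3_eta r) /= !qform_evalE v30.
    move: (r 0 (inord 0)) (r 0 (inord 1)) (r 0 (inord 2)) => a b c E _.
    have ab0 : a = 0 /\ b = 0 /\ c = 0.
      have := sqr_ge0 a; have := sqr_ge0 b; have := sqr_ge0 c => c2 b2 a2.
      have /eqP : a ^+ 2 = 0 by lra.
      have /eqP : b ^+ 2 = 0 by lra.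
      have /eqP : c ^+ 2 = 0 by lra.
      by rewrite !sqrf_eq0 => /eqP-> /eqP-> /eqP->.
    by have [-> [-> ->]] := ab0.
  have /eqP : x * z = 0 by rewrite -EB; ring.
  rewrite mulf_eq0 => /orP[] /eqP E; subst.
    have yz : y ^+ 2 = - z ^+ 2 by apply: eq0_ring; rewrite -EA; ring.
    have z0 : z != 0.
      move: xyz0; rewrite eqxx /=; apply: contraTneq => z0; move: yz.
      by rewrite z0 expr0n oppr0 => /eqP; rewrite sqrf_eq0 => /eqP->; rewrite eqxx.
    have y0 : y != 0 by rewrite -sqrf_eq0 yz oppr_eq0 sqrf_eq0.
    by apply: has_multiplicity_Ix0 => //; left.
  have yx : y ^+ 2 = - x ^+ 2 by apply: eq0_ring; rewrite -EA; ring.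
  apply: has_multiplicity_Iz0 => //; last by left.
  move: xyz0; apply: contraTneq => x0; move: yx.
  by rewrite x0 expr0n oppr0 => /eqP; rewrite sqrf_eq0 => /eqP->; rewrite eqxx.
- exists 1%N; have /eqP : x * z = 0 by rewrite -EB; ring.
  rewrite mulf_eq0 => /orP[] /eqP E; subst.
    have yz : y ^+ 2 = z ^+ 2 by apply: eq0_ring; rewrite -EA; ring.
    have z0 : z != 0.
      move: xyz0; rewrite eqxx /=; apply: contraTneq => z0; move: yz.
      by rewrite z0 expr0n => /eqP; rewrite sqrf_eq0 => /eqP->; rewrite eqxx.
    have y0 : y != 0 by rewrite -sqrf_eq0 yz sqrf_eq0.
    split; first by apply: has_multiplicity_Ix0 => //; right; left.
    left; split=> //; move: yz => /eqP; rewrite eqf_sqr => /orP[] /eqP yE; subst y.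
      by apply: (@real_v3 _ _ _ 0 1 1 v0 z z0); coeffs.
    by apply: (@real_v3 _ _ _ 0 (-1) 1 v0 z z0); coeffs.
  have yx : y ^+ 2 = - x ^+ 2 by apply: eq0_ring; rewrite -EA; ring.
  split.
    apply: has_multiplicity_Iz0 => //; last by right.
    move: xyz0; apply: contraTneq => x0; move: yx.
    by rewrite x0 expr0n oppr0 => /eqP; rewrite sqrf_eq0 => /eqP->; rewrite eqxx.
  (* Type Ib also has real base points, so the pencil itself cannot exclude reality. The points at
     hand satisfy x^2 + y^2 = 0 and z^2 = 0, which have no common real zero. *)
  right; split=> //; apply: (not_real_point (E1 := q6 1 1 0 0 0 0)
      (E2 := q6 0 0 1 0 0 0)) => //.
  + by rewrite complexify_q6 qform_evalE yx /= rmorph0 rmorph1; ring.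
  + by rewrite complexify_q6 qform_evalE /= rmorph0 rmorph1; ring.
  move=> r; rewrite (v3_eta r) /= !qform_evalE v30.
  move: (r 0 (inord 0)) (r 0 (inord 1)) (r 0 (inord 2)) => a b c E1 E2.
  have [-> ->] : a = 0 /\ b = 0 by apply: sum_sq0; lra.
  by have /eqP : c ^+ 2 = 0; [lra|rewrite sqrf_eq0 => /eqP->].
- have /eqP : y * z = 0 by rewrite -EA; ring.
  have /eqP : x * (y - z) = 0 by rewrite -EB; ring.
  rewrite !mulf_eq0 subr_eq0 => /orP[] /eqP E1 /orP[] /eqP E2; subst.
  + exists 1%N; have z0 : z != 0 by move: xyz0; rewrite !eqxx.
    split; first exact: has_multiplicity_II_z.
    by left; split=> //; apply: (@real_v3 _ _ _ 0 0 1 v0 z z0); coeffs.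
  + exists 1%N; have y0 : y != 0 by move: xyz0; rewrite !eqxx orbF.
    split; first exact: has_multiplicity_II_y.
    by left; split=> //; apply: (@real_v3 _ _ _ 0 1 0 v0 y y0); coeffs.
  + exists 2%N; have x0 : x != 0 by move: xyz0; rewrite !eqxx !orbF.
    have vE : v3 x 0 0 = x *: v3 1 0 0 by rewrite v3Z !mulr0 mulr1.
    split; first by rewrite vE; apply: has_multiplicityZ x0 _ (has_multiplicity_II _);
      rewrite v3_neq0 oner_eq0.
    by left; split=> //; apply: (@real_v3 _ _ _ 1 0 0 v0 x x0); coeffs.
  + exists 2%N; have x0 : x != 0 by move: xyz0; rewrite !eqxx !orbF.
    have vE : v3 x 0 0 = x *: v3 1 0 0 by rewrite v3Z !mulr0 mulr1.
    split; first by rewrite vE; apply: has_multiplicityZ x0 _ (has_multiplicity_II _);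
      rewrite v3_neq0 oner_eq0.
    by left; split=> //; apply: (@real_v3 _ _ _ 1 0 0 v0 x x0); coeffs.
- have /eqP : x * z = 0 by rewrite -EB; ring.
  have yz : y ^+ 2 = - z ^+ 2 by apply: eq0_ring; rewrite -EA; ring.
  rewrite mulf_eq0; have [z0 _|z0] := eqVneq z 0.
    have y0 : y = 0 by move: yz; rewrite z0 expr0n oppr0 => /eqP; rewrite sqrf_eq0 => /eqP.
    subst; exists 2%N; have x0 : x != 0 by move: xyz0; rewrite !eqxx !orbF.
    have vE : v3 x 0 0 = x *: v3 1 0 0 by rewrite v3Z !mulr0 mulr1.
    split; first by rewrite vE; apply: has_multiplicityZ x0 _ (has_multiplicity_IIa _);
      rewrite v3_neq0 oner_eq0.
    by left; split=> //; apply: (@real_v3 _ _ _ 1 0 0 v0 x x0); coeffs.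
  rewrite orbF => /eqP x0; subst; exists 1%N.
  have y0 : y != 0 by rewrite -sqrf_eq0 yz oppr_eq0 sqrf_eq0.
  split; first by apply: has_multiplicity_Ix0 => //; right; right.
  right; split=> //; apply: (not_real_point (E1 := q6 0 1 1 0 0 0)
      (E2 := q6 1 0 0 0 0 0)) => //.
  + by rewrite complexify_q6 qform_evalE yz /= rmorph0 rmorph1; ring.
  + by rewrite complexify_q6 qform_evalE /= rmorph0 rmorph1; ring.
  move=> r; rewrite (v3_eta r) /= !qform_evalE v30.
  move: (r 0 (inord 0)) (r 0 (inord 1)) (r 0 (inord 2)) => a b c E1 E2.
  have [-> ->] : b = 0 /\ c = 0 by apply: sum_sq0; lra.
  by have /eqP : a ^+ 2 = 0; [lra|rewrite sqrf_eq0 => /eqP->].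
- have /eqP : x * z = 0 by rewrite -EA; ring.
  have /eqP : y ^+ 2 = 0 by rewrite -EB; ring.
  rewrite sqrf_eq0 mulf_eq0 => /eqP y0 xz; subst y; exists 2%N.
  have xz' : (x == 0) != (z == 0).
    by move: xyz0 xz; rewrite eqxx /=; case: (x == 0); case: (z == 0).
  split; first exact: has_multiplicity_III.
  left; split=> //; move: xz xz' => /orP[] /eqP E; subst; rewrite eqxx => n0.
    have z0 : z != 0 by move: n0; case: (z == 0).
    by apply: (@real_v3 _ _ _ 0 0 1 v0 z z0); coeffs.
  have x0 : x != 0 by move: n0; case: (x == 0).
  by apply: (@real_v3 _ _ _ 1 0 0 v0 x x0); coeffs.
- have yx : y ^+ 2 = - x ^+ 2 by apply: eq0_ring; rewrite -EA; ring.
  have /eqP : z ^+ 2 = 0 by rewrite -EB; ring.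
  rewrite sqrf_eq0 => /eqP z0; subst z; exists 2%N; split.
    apply: has_multiplicity_IIIa => //.
    move: xyz0; apply: contraTneq => x0; move: yx.
    by rewrite x0 expr0n oppr0 => /eqP; rewrite sqrf_eq0 => /eqP->; rewrite eqxx.
  right; split=> //; apply: (not_real_point (E1 := pencil_fst R Type_IIIa)
      (E2 := pencil_snd R Type_IIIa)) => //.
  + by rewrite complexify_pencil /= qform_evalE.
  + by rewrite complexify_pencil /= qform_evalE.
  move=> r; rewrite (v3_eta r) /= !qform_evalE v30.
  move: (r 0 (inord 0)) (r 0 (inord 1)) (r 0 (inord 2)) => a b c E1 E2.
  have [-> ->] : a = 0 /\ b = 0 by apply: sum_sq0; lra.
  by have /eqP : c ^+ 2 = 0; [lra|rewrite sqrf_eq0 => /eqP->].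
- have xz : x * z = y ^+ 2 by apply: eq0_ring; rewrite -EA; ring.
  have /eqP : x * y = 0 by rewrite -EB; ring.
  rewrite mulf_eq0; have [x0 _|x0 /= /eqP y0] := eqVneq x 0.
    have y0 : y = 0 by move: xz; rewrite x0 mul0r => /esym/eqP; rewrite sqrf_eq0 => /eqP.
    subst; have z0 : z != 0 by move: xyz0; rewrite !eqxx.
    have vE : v3 0 0 z = z *: v3 0 0 1 by rewrite v3Z !mulr0 mulr1.
    exists 3%N; split; first by rewrite vE; apply: has_multiplicityZ z0 _ (has_multiplicity_IV _);
      rewrite v3_neq0 oner_eq0 !orbT.
    by left; split=> //; apply: (@real_v3 _ _ _ 0 0 1 v0 z z0); coeffs.
  subst y; move: xz => /eqP; rewrite expr0n mulf_eq0 (negbTE x0) => /eqP z0; subst z.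
  exists 1%N; split; first exact: has_multiplicity_IV_x.
  by left; split=> //; apply: (@real_v3 _ _ _ 1 0 0 v0 x x0); coeffs.
- have xz : x * z = y ^+ 2 by apply: eq0_ring; rewrite -EA; ring.
  have /eqP : x ^+ 2 = 0 by rewrite -EB; ring.
  rewrite sqrf_eq0 => /eqP x0.
  have y0 : y = 0 by move: xz; rewrite x0 mul0r => /esym/eqP; rewrite sqrf_eq0 => /eqP.
  subst; have z0 : z != 0 by move: xyz0; rewrite !eqxx.
  have vE : v3 0 0 z = z *: v3 0 0 1 by rewrite v3Z !mulr0 mulr1.
  exists 4%N; split; first by rewrite vE; apply: has_multiplicityZ z0 _ (has_multiplicity_V _);
    rewrite v3_neq0 oner_eq0 !orbT.
  by left; split=> //; apply: (@real_v3 _ _ _ 0 0 1 v0 z z0); coeffs.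
Qed.

Lemma has_multiplicity_unique t (v : 'rV[C]_3) k k' :
  has_multiplicity t v k -> has_multiplicity t v k' -> k = k'.
Proof. by move=> H H'; apply/(H' k)/(H k). Qed.

Lemma real_witness t k : k \in real_multiplicities t -> exists r : 'rV[R]_3,
  [/\ r != 0, qform_eval (pencil_fst R t) r = 0, qform_eval (pencil_snd R t) r = 0 &
      has_multiplicity t (cx r) k].
Proof.
have n0 := oner_neq0 C; have n0R := oner_neq0 R.
have W (t0 : pencil_type) k0 (a b c : R) : v3 a b c != 0 ->
    qform_eval (pencil_fst R t0) (v3 a b c) = 0 ->
    qform_eval (pencil_snd R t0) (v3 a b c) = 0 ->
    has_multiplicity t0 (v3 (a%:C)%C (b%:C)%C (c%:C)%C) k0 ->
    exists r : 'rV[R]_3, [/\ r != 0, qform_eval (pencil_fst R t0) r = 0,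
      qform_eval (pencil_snd R t0) r = 0 & has_multiplicity t0 (cx r) k0].
  by move=> v0 Av Bv hk; exists (v3 a b c); split; rewrite ?complexify_v3.
case: t => //=; rewrite ?inE.
- move=> /eqP->; apply: (W Type_I _ 1 1 1); rewrite ?v3_neq0 ?n0R// ?qform_evalE; try by ring.
  by rewrite rmorph1; exact: has_multiplicity_I.
- move=> /eqP->; apply: (W Type_Ib _ 0 1 1); rewrite ?v3_neq0 ?n0R ?orbT// ?qform_evalE; try by ring.
  by rewrite rmorph1 rmorph0; apply: has_multiplicity_Ix0 => //; right; left.
- move=> /orP[] /eqP->.
    apply: (W Type_II _ 0 0 1); rewrite ?v3_neq0 ?n0R ?orbT// ?qform_evalE; try by ring.
    by rewrite rmorph1 rmorph0; exact: has_multiplicity_II_z.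
  apply: (W Type_II _ 1 0 0); rewrite ?v3_neq0 ?n0R ?orbT// ?qform_evalE; try by ring.
  by rewrite rmorph1 rmorph0; exact: has_multiplicity_II.
- move=> /eqP->; apply: (W Type_IIa _ 1 0 0); rewrite ?v3_neq0 ?n0R ?orbT// ?qform_evalE; try by ring.
  by rewrite rmorph1 rmorph0; exact: has_multiplicity_IIa.
- move=> /eqP->; apply: (W Type_III _ 1 0 0); rewrite ?v3_neq0 ?n0R ?orbT// ?qform_evalE; try by ring.
  by rewrite rmorph1 rmorph0; apply: has_multiplicity_III; rewrite eqxx (negbTE n0).
- move=> /orP[] /eqP->.
    apply: (W Type_IV _ 1 0 0); rewrite ?v3_neq0 ?n0R ?orbT// ?qform_evalE; try by ring.
    by rewrite rmorph1 rmorph0; exact: has_multiplicity_IV_x.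
  apply: (W Type_IV _ 0 0 1); rewrite ?v3_neq0 ?n0R ?orbT// ?qform_evalE; try by ring.
  by rewrite rmorph1 rmorph0; exact: has_multiplicity_IV.
- move=> /eqP->; apply: (W Type_V _ 0 0 1); rewrite ?v3_neq0 ?n0R ?orbT// ?qform_evalE; try by ring.
  by rewrite rmorph1 rmorph0; exact: has_multiplicity_V.
Qed.

Lemma imaginary_witness t k : k \in imaginary_multiplicities t -> exists v : 'rV[C]_3,
  [/\ v != 0, qform_eval (pencil_fst C t) v = 0, qform_eval (pencil_snd C t) v = 0,
      has_multiplicity t v k & ~ real_point (proj_pt v)].
Proof.
have n0 := oner_neq0 C; pose i : C := 'i%C.
have i2 : i ^+ 2 = -1 by exact: sqr_i.
have i0 : i != 0 by rewrite -sqrf_eq0 i2 oppr_eq0.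
(* A base point whose multiplicity does not occur among the real ones is imaginary. This fails for
   type Ib, where simple points of both kinds occur and a direct argument is given. *)
have nr k0 (v : 'rV[C]_3) (t0 : pencil_type) : v != 0 ->
    qform_eval (pencil_fst C t0) v = 0 -> qform_eval (pencil_snd C t0) v = 0 ->
    has_multiplicity t0 v k0 -> k0 \notin real_multiplicities t0 -> ~ real_point (proj_pt v).
  move=> v0 Av Bv hk nk rv; have [k1 [hk1 [[_]|[nrv _]]]] := base_cover v0 Av Bv; last exact: nrv.
  by rewrite -(has_multiplicity_unique hk hk1) (negbTE nk).
have W (t0 : pencil_type) (v : 'rV[C]_3) k0 : v != 0 -> qform_eval (pencil_fst C t0) v = 0 ->
  qform_eval (pencil_snd C t0) v = 0 -> has_multiplicity t0 v k0 ->
  k0 \notin real_multiplicities t0 -> exists v : 'rV[C]_3,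
  [/\ v != 0, qform_eval (pencil_fst C t0) v = 0, qform_eval (pencil_snd C t0) v = 0,
      has_multiplicity t0 v k0 & ~ real_point (proj_pt v)].
  move=> v0 Av Bv hk nk; exists v; split; [exact: v0|exact: Av|exact: Bv|exact: hk|].
  exact: nr v0 Av Bv hk nk.
case: t => //=; rewrite inE => /eqP->.
- apply: (W Type_Ia (v3 0 i 1)) => //; rewrite ?v3_neq0 ?n0 ?orbT// /= ?qform_evalE ?i2; try by ring.
  by apply: has_multiplicity_Ix0 => //; left; rewrite expr1n.
- have v0 : v3 1 i 0 != 0 by rewrite v3_neq0 n0.
  exists (v3 1 i 0); split; rewrite ?qform_evalE ?i2; try by [|ring].
    by apply: has_multiplicity_Iz0 => //; [rewrite expr1n|right].
  apply: (not_real_point (E1 := q6 1 1 0 0 0 0) (E2 := q6 0 0 1 0 0 0)) => //.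
  + by rewrite complexify_q6 qform_evalE i2 /= rmorph0 rmorph1; ring.
  + by rewrite complexify_q6 qform_evalE /= rmorph0 rmorph1; ring.
  move=> r; rewrite (v3_eta r) /= !qform_evalE v30.
  move: (r 0 (inord 0)) (r 0 (inord 1)) (r 0 (inord 2)) => a b c E1 E2.
  have [-> ->] : a = 0 /\ b = 0 by apply: sum_sq0; lra.
  by have /eqP : c ^+ 2 = 0; [lra|rewrite sqrf_eq0 => /eqP->].
- apply: (W Type_IIa (v3 0 i 1)) => //; rewrite ?v3_neq0 ?n0 ?orbT// /= ?qform_evalE ?i2; try by ring.
  by apply: has_multiplicity_Ix0 => //; right; right; rewrite expr1n.
- apply: (W Type_IIIa (v3 1 i 0)) => //; rewrite ?v3_neq0 ?n0// /= ?qform_evalE ?i2; try by ring.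
  by apply: has_multiplicity_IIIa => //; rewrite expr1n.
Qed.

Lemma pencil_neq0 t : (pencil_fst R t != 0) /\ (pencil_snd R t != 0).
Proof.
split; apply/eqP; rewrite q60 => /rowP H;
  have := H (inord 0); have := H (inord 1); have := H (inord 2);
  have := H (inord 3); have := H (inord 4); have := H (inord 5);
  by case: t {H}; rewrite /= !q6E => *; lra.
Qed.

Lemma intersections_pencil t k :
  intersection_points (couple (pencil_fst R t) (pencil_snd R t)) k =
  base_points (pencil_fst C t) (pencil_snd C t) k.
Proof.
have [A0 B0] := pencil_neq0 t.
by rewrite (intersection_points_couple k A0 B0) !complexify_pencil.
Qed.

Lemma real_intersections_pencil t k :
  real_intersections (couple (pencil_fst R t) (pencil_snd R t)) k !=set0 <->
  k \in real_multiplicities t.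
Proof.
rewrite /real_intersections intersections_pencil; split.
  move=> [p [[Ap Bp mp] /= rp]].
  have [k1 [hk1 H]] := base_cover (proj_repr_neq0 p) Ap Bp.
  move: H; rewrite proj_reprK => -[[_]|[//]].
  by have /hk1-> : intersection_multiplicity (pencil_fst C t) (pencil_snd C t)
     (proj_pt (proj_repr p)) k by rewrite proj_reprK.
move=> /real_witness[r [r0 Ar Br hk]].
have cr0 : cx r != 0 by rewrite complexify_neq0.
exists (proj_pt (cx r)); split; last by exists r.
split; last exact/hk.
  apply/(qform_eval_repr _ cr0).
  by have := qform_eval_complexify (pencil_fst R t) r; rewrite complexify_pencil Ar => ->.
apply/(qform_eval_repr _ cr0).
by have := qform_eval_complexify (pencil_snd R t) r; rewrite complexify_pencil Br => ->.
Qed.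

Lemma imaginary_intersections_pencil t k :
  imaginary_intersections (couple (pencil_fst R t) (pencil_snd R t)) k !=set0 <->
  k \in imaginary_multiplicities t.
Proof.
rewrite /imaginary_intersections intersections_pencil; split.
  move=> [p [[Ap Bp mp] /= rp]].
  have [k1 [hk1 H]] := base_cover (proj_repr_neq0 p) Ap Bp.
  move: H; rewrite proj_reprK => -[[//]|[_]].
  by have /hk1-> : intersection_multiplicity (pencil_fst C t) (pencil_snd C t)
     (proj_pt (proj_repr p)) k by rewrite proj_reprK.
move=> /imaginary_witness[v [v0 Av Bv hk nr]].
exists (proj_pt v); split; last exact: nr.
split; last exact/hk.
  exact: (qform_eval_repr (pencil_fst C t) v0).2 Av.
exact: (qform_eval_repr (pencil_snd C t) v0).2 Bv.
Qed.

Lemma card_eq_nonempty (T U : Type) (A : set T) (B : set U) :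
  A #= B -> A !=set0 -> B !=set0.
Proof.
move=> AB /set0P A0; apply/set0P; apply: contra_neq A0 => B0; move: AB.
by rewrite B0 card_eq0 => /eqP.
Qed.

Lemma same_intersections_type t t' :
  same_intersections (couple (pencil_fst R t) (pencil_snd R t))
    (couple (pencil_fst R t') (pencil_snd R t')) -> t = t'.
Proof.
move=> H; apply: pencil_type_inj => k; apply/idP/idP; have [r i] := H k.
- by move=> /real_intersections_pencil/(card_eq_nonempty r)/real_intersections_pencil.
- rewrite card_eq_sym in r.
  by move=> /real_intersections_pencil/(card_eq_nonempty r)/real_intersections_pencil.
- by move=> /imaginary_intersections_pencil/(card_eq_nonempty i)/imaginary_intersections_pencil.
- rewrite card_eq_sym in i.
  by move=> /imaginary_intersections_pencil/(card_eq_nonempty i)/imaginary_intersections_pencil.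
Qed.

End Signature.

(** * Classification of real pencils *)

(* The derivative at f of the cubic form disc, in the direction g. *)
Definition disc_diff (S : comNzRingType) (f g : 'rV[S]_6) : S :=
  let c i := f 0 (inord i) in let k i := g 0 (inord i) in
  k 0 * (4%:R * c 1 * c 2 - c 3 ^+ 2) + k 1 * (4%:R * c 0 * c 2 - c 4 ^+ 2)
  + k 2 * (4%:R * c 0 * c 1 - c 5 ^+ 2) + k 3 * (c 4 * c 5 - 2%:R * c 0 * c 3)
  + k 4 * (c 3 * c 5 - 2%:R * c 1 * c 4) + k 5 * (c 3 * c 4 - 2%:R * c 2 * c 5).

Lemma disc_pencil (S : comNzRingType) (f g : 'rV[S]_6) s t :
  disc (s *: f + t *: g) = s ^+ 3 * disc f + s ^+ 2 * t * disc_diff f g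
    + s * t ^+ 2 * disc_diff g f + t ^+ 3 * disc g.
Proof. by rewrite /disc /disc_diff !mxE; ring. Qed.

Section Classification.
Variable R : realType.
Implicit Types (f g : 'rV[R]_6) (M : 'M[R]_3) (a b c d e h x y z : R).

Let two : (2%:R : R) != 0. Proof. by rewrite pnatr_eq0. Qed.
Let four : (4%:R : R) != 0. Proof. by rewrite pnatr_eq0. Qed.

Definition classified f g := exists t,
  projectively_equivalent f g (pencil_fst R t) (pencil_snd R t).

Lemma classified_equiv f g f' g' : projectively_equivalent f g f' g' ->
  classified f' g' -> classified f g.
Proof. by move=> H [t Ht]; exists t; exact: projectively_equivalent_trans H Ht. Qed.

Definition regular_pencil f g := exists s t, disc (s *: f + t *: g) != 0.

Lemma regular_pencil_span f g f' g' : same_span f g f' g' ->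
  regular_pencil f g -> regular_pencil f' g'.
Proof.
move=> [a [b [c [d [_ -> ->]]]]] [s [t H]]; exists (s * a + t * c), (s * b + t * d).
by move: H; rewrite !scalerDr !scalerA addrACA -!scalerDl.
Qed.

Lemma regular_pencil_equiv f g f' g' : projectively_equivalent f g f' g' ->
  regular_pencil f g -> regular_pencil f' g'.
Proof.
move=> [M Mu H] [s [t D]]; apply: (regular_pencil_span H); exists s, t.
rewrite -!actZ -actD disc_act// mulf_neq0// sqrf_eq0 -unitfE.
by rewrite -unitmxE.
Qed.

Lemma pencil_step (u v w : 'rV[R]_3) f g f' g' a b c d :
  \det (m3 u v w) != 0 -> a * d - b * c != 0 ->
  act (m3 u v w) f = a *: f' + b *: g' ->
  act (m3 u v w) g = c *: f' + d *: g' ->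
  projectively_equivalent f g f' g'.
Proof.
move=> dn D fE gE; exists (m3 u v w); first by rewrite unitmxE unitfE.
by exists a, b, c, d.
Qed.

Lemma classified_step (t : pencil_type) (u v w : 'rV[R]_3) f g a b c d :
  \det (m3 u v w) != 0 -> a * d - b * c != 0 ->
  act (m3 u v w) f = a *: pencil_fst R t + b *: pencil_snd R t ->
  act (m3 u v w) g = c *: pencil_fst R t + d *: pencil_snd R t ->
  classified f g.
Proof. by move=> dn D fE gE; exists t; exact: pencil_step dn D fE gE. Qed.

Local Notation XY := (q6 0 0 0 0 0 1 : 'rV[R]_6).
Local Notation XX_YY := (q6 1 1 0 0 0 0 : 'rV[R]_6).
Local Notation XX := (q6 1 0 0 0 0 0 : 'rV[R]_6).

Ltac forms := rewrite ?act_m3 ?formsE ?q6Z ?q6D; congr q6.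
Ltac ddet := rewrite det_m3 /det3.

Lemma normalize_sign a : exists2 k, k != 0 &
  [\/ a * k ^+ 2 = 1, a * k ^+ 2 = -1 | a = 0].
Proof.
have [a0|a0|->] := ltgtP a 0; last by exists 1; rewrite ?oner_neq0//; constructor 3.
- exists (Num.sqrt (- a))^-1.
    by rewrite invr_eq0 sqrtr_eq0 -ltNge oppr_gt0.
  constructor 2; rewrite exprVn sqr_sqrtr ?oppr_ge0 ?ltW//.
  by rewrite invrN mulrN mulfV// lt_eqF.
- exists (Num.sqrt a)^-1; first by rewrite invr_eq0 sqrtr_eq0 -ltNge.
  by constructor 1; rewrite exprVn sqr_sqrtr ?ltW// mulfV// gt_eqF.
Qed.

Lemma complete_square_z f a b c d e h : c != 0 ->
  act (m3 (v3 1 0 (- e / (2%:R * c))) (v3 0 1 (- d / (2%:R * c))) (v3 0 0 1))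
    (q6 a b c d e h) =
  q6 (a - e ^+ 2 / (4%:R * c)) (b - d ^+ 2 / (4%:R * c)) c 0 0 (h - d * e / (2%:R * c)).
Proof.
by move=> c0; forms; try ring; field; rewrite ?c0 ?two ?four.
Qed.

(** The base points lie on the lines x = 0 and y = 0, where the second form is b y^2 + z^2 and a x^2
    + z^2. The sign of each coefficient tells whether the line carries two imaginary points, two
    real points or a double one, and the nine cases give the types Ia, Ib, IIa, I, II and III. *)
Lemma classified_xy_diag a b : classified XY (q6 a b 1 0 0 0).
Proof.
have [k k0 ak] := normalize_sign a; have [l l0 bl] := normalize_sign b.
have H : projectively_equivalent XY (q6 a b 1 0 0 0) XY (q6 (a * k ^+ 2) (b * l ^+ 2) 1 0 0 0).
  apply: (pencil_step (u := v3 k 0 0) (v := v3 0 l 0) (w := v3 0 0 1)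
    (a := k * l) (b := 0) (c := 0) (d := 1)).
  - ddet; rewrite (_ : _ + _ = k * l); last by ring.
    by rewrite mulf_neq0.
  - by rewrite mulr0 subr0 mulr1 mulf_neq0.
  - by forms; ring.
  - by forms; ring.
apply: classified_equiv H _.
have n2 : (2%:R : R) != 0 by [].
have nn2 : - (2%:R : R) != 0 by rewrite oppr_eq0.
case: ak => ->; case: bl => ->; rewrite ?mul0r.
- apply: (@classified_step Type_Ia (v3 1 0 0) (v3 0 0 1) (v3 0 1 0) _ _ 0 1 1 0).
  + by ddet; apply/eqP => E; lra.
  + by apply/eqP => E; lra.
  + by forms; ring.
  + by forms; ring.
- apply: (@classified_step Type_Ib (v3 1 0 0) (v3 0 0 1) (v3 0 1 0) _ _ 0 1 1 0).
  + by ddet; apply/eqP => E; lra.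
  + by apply/eqP => E; lra.
  + by forms; ring.
  + by forms; ring.
- apply: (@classified_step Type_IIa (v3 0 1 0) (v3 0 0 1) (v3 1 0 0) _ _ 0 1 1 0).
  + by ddet; apply/eqP => E; lra.
  + by apply/eqP => E; lra.
  + by forms; ring.
  + by forms; ring.
- apply: (@classified_step Type_Ib (v3 0 1 0) (v3 0 0 1) (v3 1 0 0) _ _ 0 1 1 0).
  + by ddet; apply/eqP => E; lra.
  + by apply/eqP => E; lra.
  + by forms; ring.
  + by forms; ring.
- apply: (@classified_step Type_I (v3 1 1 0) (v3 1 (-1) 0) (v3 0 0 2%:R) _ _ 1 1 (- 2%:R) 2%:R).
  + by ddet; apply/eqP => E; lra.
  + by apply/eqP => E; lra.
  + by forms; ring.
  + by forms; ring.
- apply: (@classified_step Type_II (v3 0 1 0) (v3 1 0 1) (v3 (-1) 0 1) _ _ 0 1 4%:R 0).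
  + by ddet; apply/eqP => E; lra.
  + by apply/eqP => E; lra.
  + by forms; ring.
  + by forms; ring.
- apply: (@classified_step Type_IIa (v3 1 0 0) (v3 0 0 1) (v3 0 1 0) _ _ 0 1 1 0).
  + by ddet; apply/eqP => E; lra.
  + by apply/eqP => E; lra.
  + by forms; ring.
  + by forms; ring.
- apply: (@classified_step Type_II (v3 1 0 0) (v3 0 1 1) (v3 0 (-1) 1) _ _ 0 1 4%:R 0).
  + by ddet; apply/eqP => E; lra.
  + by apply/eqP => E; lra.
  + by forms; ring.
  + by forms; ring.
- apply: (@classified_step Type_III (v3 1 0 0) (v3 0 0 1) (v3 0 1 0) _ _ 1 0 0 1).
  + by ddet; apply/eqP => E; lra.
  + by apply/eqP => E; lra.
  + by forms; ring.
  + by forms; ring.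
Qed.

Lemma classified_xy g : regular_pencil XY g -> classified XY g.
Proof.
rewrite (q6_eta g); move: (g 0 (inord 0)) (g 0 (inord 1)) (g 0 (inord 2))
  (g 0 (inord 3)) (g 0 (inord 4)) (g 0 (inord 5)) => a b c d e h [s [t D]].
move: D; rewrite !q6Z q6D discE => D.
(* [c] is the value of the second form at the vertex (0, 0, 1) of the line pair. If it is nonzero,
   completing the square in z removes yz and xz, and the xy term is absorbed by the first form. *)
have [c0|c0] := eqVneq c 0; last first.
  pose a' := a - e ^+ 2 / (4%:R * c); pose b' := b - d ^+ 2 / (4%:R * c).
  apply: (classified_equiv _ (classified_xy_diag (a' / c) (b' / c))).
  apply: (pencil_step (u := v3 1 0 (- e / (2%:R * c))) (v := v3 0 1 (- d / (2%:R * c)))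
    (w := v3 0 0 1) (a := 1) (b := 0) (c := h - d * e / (2%:R * c)) (d := c)).
  - by ddet; rewrite (_ : _ + _ = 1) ?oner_neq0//; ring.
  - by rewrite mul0r subr0 mul1r.
  - by forms; ring.
  - by rewrite complete_square_z// !q6Z q6D; congr q6; rewrite /a' /b';
      field; rewrite ?c0 ?two ?four.
(* The vertex is now a base point, with tangent e x + d y = 0. Two zero coefficients would make all
   members singular there; a single one makes the tangent a line of the pair, which is type IV;
   otherwise the type is II. *)
subst c; have [d0|d0] := eqVneq d 0; have [e0|e0] := eqVneq e 0.
- by exfalso; move: D; rewrite d0 e0 => /eqP[]; ring.
- subst d; have b0 : b != 0.
    by apply: contraNneq D => ->; apply/eqP; ring.
  apply: (@classified_step Type_IV (v3 1 0 (- a / e)) (v3 0 1 0) (v3 0 0 (- b / e))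
    _ _ 0 1 (- b) h).
  + ddet; rewrite (_ : _ + _ = - b / e); last by ring.
    by rewrite mulf_neq0 ?oppr_eq0 ?invr_eq0.
  + by rewrite mul0r sub0r mul1r opprK.
  + by forms; ring.
  + by forms; field.
- subst e; have a0 : a != 0.
    by apply: contraNneq D => ->; apply/eqP; ring.
  apply: (@classified_step Type_IV (v3 0 1 (- b / d)) (v3 1 0 0) (v3 0 0 (- a / d))
    _ _ 0 1 (- a) h).
  + ddet; rewrite (_ : _ + _ = a / d); last by ring.
    by rewrite mulf_neq0 ?oppr_eq0 ?invr_eq0.
  + by rewrite mul0r sub0r mul1r opprK.
  + by forms; ring.
  + by forms; field.
(* The new frame consists of the vertex and of the second base points on the lines y = 0 and x =
   0. *)
- apply: (@classified_step Type_II (v3 0 0 1) (v3 e^-1 0 (- a / e ^+ 2))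
    (v3 0 (- d^-1) (b / d ^+ 2)) _ _ (- (d * e)^-1) 0
    (- h / (d * e) + a / (e ^+ 2) + b / d ^+ 2) 1).
  + ddet; rewrite (_ : _ + _ = - (e^-1 / d)); last by ring.
    by rewrite oppr_eq0 mulf_neq0 ?invr_eq0.
  + by rewrite mulr1 mul0r subr0 oppr_eq0 invr_eq0 mulf_neq0.
  + by forms; try ring; field; rewrite ?d0 ?e0.
  + by forms; try ring; field; rewrite ?d0 ?e0.
Qed.

Definition reducible_to f f' := exists2 M, M \in unitmx & exists2 k, k != 0 & act M f = k *: f'.

Lemma reducible_to_trans f f' f'' : reducible_to f f' -> reducible_to f' f'' -> reducible_to f f''.
Proof.
move=> [M Mu [k k0 E]] [N Nu [l l0 E']]; exists (N *m M); first by rewrite unitmx_mul Nu.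
exists (k * l); first by rewrite mulf_neq0.
by rewrite -act_comp E actZ E' scalerA.
Qed.

Lemma reducible_to_m3 (u v w : 'rV[R]_3) k f f' : \det (m3 u v w) != 0 -> k != 0 ->
  act (m3 u v w) f = k *: f' -> reducible_to f f'.
Proof.
by move=> dn k0 E; exists (m3 u v w); [rewrite unitmxE unitfE|exists k].
Qed.

Definition normal_degenerate f := [\/ reducible_to f XY, reducible_to f XX_YY | reducible_to f XX].

Lemma normal_degenerate_trans f f' : reducible_to f f' -> normal_degenerate f' -> normal_degenerate f.
Proof.
by move=> H []; [constructor 1|constructor 2|constructor 3]; exact: reducible_to_trans H _.
Qed.

Lemma binary_form_normal a b h : a != 0 -> normal_degenerate (q6 a b 0 0 0 h).
Proof.
move=> a0; pose b' := b / a - h ^+ 2 / (4%:R * a ^+ 2).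
have H : reducible_to (q6 a b 0 0 0 h) (q6 1 b' 0 0 0 0).
  apply: (reducible_to_m3 (u := v3 1 0 0) (v := v3 (- h / (2%:R * a)) 1 0) (w := v3 0 0 1) (k := a)) => //.
    by ddet; rewrite (_ : _ + _ = 1) ?oner_neq0//; ring.
  by forms; try ring; rewrite /b'; field; rewrite ?a0 ?two ?four.
apply: (normal_degenerate_trans H).
have [k k0 bk] := normalize_sign b'.
have H2 : reducible_to (q6 1 b' 0 0 0 0) (q6 1 (b' * k ^+ 2) 0 0 0 0).
  apply: (reducible_to_m3 (u := v3 1 0 0) (v := v3 0 k 0) (w := v3 0 0 1) (k := 1)); rewrite ?oner_neq0//.
    by ddet; rewrite (_ : _ + _ = k)//; ring.
  by forms; ring.
apply: (normal_degenerate_trans H2); case: bk => ->.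
- constructor 2; exists 1%:M; rewrite ?unitmx1//; exists 1; rewrite ?oner_neq0//.
  by rewrite act1 scale1r.
- constructor 1.
  apply: (reducible_to_m3 (u := v3 1 1 0) (v := v3 1 (-1) 0) (w := v3 0 0 1) (k := 4%:R)) => //.
    by ddet; apply/eqP => E; lra.
  by forms; ring.
- rewrite mul0r; constructor 3; exists 1%:M; rewrite ?unitmx1//; exists 1; rewrite ?oner_neq0//.
  by rewrite act1 scale1r.
Qed.

(** A kernel vector of the Gram matrix, taken as third frame vector, leaves a binary form in x and
    y, which is then diagonalised or is already a multiple of xy. *)
Lemma degenerate_normal f : f != 0 -> disc f = 0 -> normal_degenerate f.
Proof.
move=> f0 D0; have /det0P[v v0 vG] : \det (gram f) == 0 by rewrite det_gram D0 mulr0.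
have Pv w : polar_form f v w = 0.
  by have := gramE f v w; rewrite vG mul0mx => /matrixP/(_ 0 0); rewrite !mxE eqxx mulr1n.
have Pv' w : polar_form f w v = 0 by rewrite -[RHS](Pv w) !polar_formE; ring.
have fv : qform_eval f v = 0.
  have := Pv v; rewrite polar_formE /qform_eval => E; apply: (mulfI two).
  by rewrite mulr0 -[RHS]E; ring.
have [u [w uw]] : exists u w, \det (m3 u w v) != 0.
  move: v0; rewrite (v3_eta v) v3_neq0 => /or3P[] h.
  - by exists (v3 0 1 0), (v3 0 0 1); ddet; move: h; apply: contra_neq => <-; ring.
  - by exists (v3 0 0 1), (v3 1 0 0); ddet; move: h; apply: contra_neq => <-; ring.
  - by exists (v3 1 0 0), (v3 0 1 0); ddet; move: h; apply: contra_neq => <-; ring.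
have H : reducible_to f (q6 (qform_eval f u) (qform_eval f w) 0 0 0 (polar_form f u w)).
  apply: (reducible_to_m3 (k := 1) uw); rewrite ?oner_neq0// scale1r.
  by rewrite act_m3 fv !Pv'.
have Mu : m3 u w v \in unitmx by rewrite unitmxE unitfE.
move: f0; rewrite -(act_eq0 _ Mu) act_m3 fv !Pv' => qn0.
apply: (normal_degenerate_trans H); move: qn0 => {H}.
move: (qform_eval f u) (qform_eval f w) (polar_form f u w) => a b h qn0.
have [a0|a0] := eqVneq a 0; last exact: binary_form_normal.
have [b0|b0] := eqVneq b 0; last first.
  apply: (@normal_degenerate_trans _ (q6 b a 0 0 0 h)); last exact: binary_form_normal.
  apply: (reducible_to_m3 (u := v3 0 1 0) (v := v3 1 0 0) (w := v3 0 0 1) (k := 1)); rewrite ?oner_neq0//.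
    by ddet; apply/eqP => E; lra.
  by forms; ring.
constructor 1; exists 1%:M; rewrite ?unitmx1//; exists h.
  by apply: contra_neq qn0 => ->; rewrite a0 b0 -q60.
by rewrite act1 a0 b0; forms; ring.
Qed.

Lemma classified_reducible f g f' : reducible_to f f' -> regular_pencil f g ->
  (forall g', regular_pencil f' g' -> classified f' g') -> classified f g.
Proof.
move=> [M Mu [k k0 fE]] fg H; have E : projectively_equivalent f g f' (act M g).
  exists M => //; rewrite fE; exists k, 0, 0, 1; rewrite !scale0r addr0 add0r scale1r.
  by rewrite mulr1 mul0r subr0.
apply: (classified_equiv E); apply: H; exact: regular_pencil_equiv E fg.
Qed.

(* A degenerate form taking both signs is a product of two real lines. *)
Lemma classified_indefinite f g v w : disc f = 0 -> qform_eval f v > 0 -> qform_eval f w < 0 ->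
  regular_pencil f g -> classified f g.
Proof.
move=> D0 fv fw reg; have f0 : f != 0.
  by apply: contraTneq fv => ->; rewrite /qform_eval !mxE !mul0r !addr0 ltxx.
have semi f' : reducible_to f f' -> (forall v, 0 <= qform_eval f' v) -> False.
  move=> [M Mu [k k0 fE]] pos.
  have E (x : 'rV_3) : qform_eval f x = k * qform_eval f' (x *m invmx M).
    by rewrite -qform_evalZ -fE qform_eval_act mulmxKV.
  move: fv fw; rewrite !E; have := pos (v *m invmx M); have := pos (w *m invmx M).
  move: (qform_eval _ _) (qform_eval _ _) => p q p0 q0.
  by have [k1|k1|k1] := ltgtP k 0; nra.
have [H|H|H] := degenerate_normal f0 D0.
- exact: classified_reducible H reg classified_xy.
- exfalso; apply: (semi _ H) => x; rewrite (v3_eta x) qform_evalE.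
  have := sqr_ge0 (x 0 (inord 0)); have := sqr_ge0 (x 0 (inord 1)); lra.
- exfalso; apply: (semi _ H) => x; rewrite (v3_eta x) qform_evalE.
  have := sqr_ge0 (x 0 (inord 0)); lra.
Qed.

Lemma classified_xx_yy_diag a b h : regular_pencil XX_YY (q6 a b 1 0 0 h) ->
  classified XX_YY (q6 a b 1 0 0 h).
Proof.
move=> reg; pose s := Num.sqrt ((a - b) ^+ 2 + h ^+ 2).
have s2 : s ^+ 2 = (a - b) ^+ 2 + h ^+ 2.
  by rewrite sqr_sqrtr// addr_ge0// sqr_ge0.
have s0 : 0 <= s by exact: sqrtr_ge0.
have sab : `|a - b| <= s.
  by rewrite -(@ler_pXn2r _ 2)// ?nnegrE// s2 -normrX ger0_norm ?sqr_ge0// lerDl sqr_ge0.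
move: sab; rewrite ler_norml => /andP[sab1 sab2].
(* The larger eigenvalue of a x^2 + h xy + b y^2 relative to x^2 + y^2. Subtracting it makes the
   binary part degenerate and negative semidefinite; with z^2 added, the result is a pair of real
   lines, or z^2 alone and then the type is IIIa. *)
pose l := (a + b + s) / 2%:R.
pose f1 := q6 (a - l) (b - l) 1 0 0 h.
have sp : same_span XX_YY (q6 a b 1 0 0 h) f1 XX_YY.
  exists 0, 1, 1, l; rewrite mul0r sub0r mulr1 oppr_eq0 oner_eq0; split=> //.
    by rewrite scale0r scale1r add0r.
  by rewrite /f1; forms; ring.
have D1 : disc f1 = 0.
  by rewrite discE /l; apply: (mulfI two); rewrite mulr0; move: s2 => E;
    transitivity (2%:R * (s ^+ 2 - ((a - b) ^+ 2 + h ^+ 2))); [field|rewrite E; ring].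
have al : a - l <= 0 by rewrite /l; lra.
have bl : b - l <= 0 by rewrite /l; lra.
have f1z : 0 < qform_eval f1 (v3 0 0 1) by rewrite qform_evalE; lra.
have reg1 := regular_pencil_span sp reg.
apply: (classified_equiv (projectively_equivalent_span sp)).
have [al0|al0] := eqVneq (a - l) 0; last first.
  apply: (classified_indefinite D1 f1z (w := v3 1 0 0)) => //.
  by rewrite qform_evalE; move: al0; rewrite neq_lt => /orP[]; lra.
have [bl0|bl0] := eqVneq (b - l) 0; last first.
  apply: (classified_indefinite D1 f1z (w := v3 0 1 0)) => //.
  by rewrite qform_evalE; move: bl0; rewrite neq_lt => /orP[]; lra.
have h0 : h = 0.
  by move: D1; rewrite discE al0 bl0 => E; apply/eqP; rewrite -sqrf_eq0; apply/eqP; lra.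
apply: (@classified_step Type_IIIa (v3 1 0 0) (v3 0 1 0) (v3 0 0 1) _ _ 0 1 1 0).
+ by ddet; apply/eqP => E; lra.
+ by apply/eqP => E; lra.
+ by rewrite /f1 al0 bl0 h0; forms; ring.
+ by forms; ring.
Qed.

Lemma classified_xx_yy g : regular_pencil XX_YY g -> classified XX_YY g.
Proof.
rewrite (q6_eta g); move: (g 0 (inord 0)) (g 0 (inord 1)) (g 0 (inord 2))
  (g 0 (inord 3)) (g 0 (inord 4)) (g 0 (inord 5)) => a b c d e h reg.
have [c0|c0] := eqVneq c 0; last first.
  pose a' := a - e ^+ 2 / (4%:R * c); pose b' := b - d ^+ 2 / (4%:R * c).
  pose h' := h - d * e / (2%:R * c).
  have H : projectively_equivalent XX_YY (q6 a b c d e h) XX_YY (q6 (a' / c) (b' / c) 1 0 0 (h' / c)).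
    apply: (pencil_step (u := v3 1 0 (- e / (2%:R * c))) (v := v3 0 1 (- d / (2%:R * c)))
      (w := v3 0 0 1) (a := 1) (b := 0) (c := 0) (d := c)).
    - by ddet; rewrite (_ : _ + _ = 1) ?oner_neq0//; ring.
    - by rewrite mul0r subr0 mul1r.
    - by forms; ring.
    - by rewrite complete_square_z// !q6Z q6D; congr q6; rewrite /a' /b' /h';
        field; rewrite ?c0 ?two ?four.
  apply: (classified_equiv H); apply: classified_xx_yy_diag.
  exact: regular_pencil_equiv H reg.
subst c; have k0 : e ^+ 2 + d ^+ 2 != 0.
  apply/eqP => /sum_sq0[e0 d0]; move: reg => [s [t]]; rewrite e0 d0 !q6Z q6D discE => /eqP[].
  by ring.
(* The terms in z are z (e x + d y). The plane frame (-d, e), (e, d) of squared length [k] turns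
   this factor into one coordinate; [p], [r] are the values and [q] the polar product of the binary
   part on it. The shifts in z kill the cross term and equalise the two values to [p]. *)
pose k := e ^+ 2 + d ^+ 2.
pose p := a * d ^+ 2 + b * e ^+ 2 - h * d * e.
pose r := a * e ^+ 2 + b * d ^+ 2 + h * e * d.
pose q := 2%:R * (b * d * e - a * e * d) + h * (e ^+ 2 - d ^+ 2).
apply: (@classified_step Type_IIa (v3 0 0 1) (v3 (- d) e (- q / k)) (v3 e d ((p - r) / k))
  _ _ k 0 p k).
+ ddet; rewrite (_ : _ + _ = - k); last by rewrite /k; ring.
  by rewrite oppr_eq0.
+ by rewrite mul0r subr0 mulf_neq0.
+ by forms; rewrite /k; ring.
+ by forms; try (by rewrite /k; ring); rewrite /p /q /r /k; field; rewrite ?k0.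
Qed.

(** After arranging a nonzero term in y^2, squares are completed modulo x^2. What remains is y^2 + c
    z^2 + e xz up to a factor: type V for c = 0, IIIa for c > 0, III for c < 0. *)
Lemma classified_xx g : regular_pencil XX g -> classified XX g.
Proof.
rewrite (q6_eta g); move: (g 0 (inord 0)) (g 0 (inord 1)) (g 0 (inord 2))
  (g 0 (inord 3)) (g 0 (inord 4)) (g 0 (inord 5)) => a b c d e h.
have main a1 b1 c1 d1 e1 h1 : b1 != 0 ->
    regular_pencil XX (q6 a1 b1 c1 d1 e1 h1) -> classified XX (q6 a1 b1 c1 d1 e1 h1).
  move: a1 b1 c1 d1 e1 h1 => {}a {}b {}c {}d {}e {}h b0 reg.
  pose c' := c / b - d ^+ 2 / (4%:R * b ^+ 2).
  pose e' := e / b - d * h / (2%:R * b ^+ 2).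
  have H : projectively_equivalent XX (q6 a b c d e h) XX (q6 0 1 c' 0 e' 0).
    apply: (pencil_step (u := v3 1 (- h / (2%:R * b)) 0) (v := v3 0 1 0)
      (w := v3 0 (- d / (2%:R * b)) 1) (a := 1) (b := 0) (c := a - h ^+ 2 / (4%:R * b)) (d := b)).
    - by ddet; rewrite (_ : _ + _ = 1) ?oner_neq0//; ring.
    - by rewrite mul0r subr0 mul1r.
    - by forms; ring.
    - by forms; rewrite /c' /e'; try ring; field; rewrite ?b0 ?two ?four.
  have reg1 := regular_pencil_equiv H reg; apply: (classified_equiv H); move: reg1 => {reg H}.
  move: c' e' => {}c {}e reg.
  have [c0|c0] := eqVneq c 0.
    have e0 : e != 0.
      apply/eqP => e0; move: reg => [s [t]]; rewrite e0 c0 !q6Z q6D discE => /eqP[].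
      by ring.
    apply: (@classified_step Type_V (v3 1 0 0) (v3 0 1 0) (v3 0 0 (- e^-1)) _ _ 0 1 (-1) 0).
    + by ddet; rewrite (_ : _ + _ = - e^-1) ?oppr_eq0 ?invr_eq0//; ring.
    + by apply/eqP => E; lra.
    + by forms; ring.
    + by rewrite c0; forms; try ring; field.
  have [k k0 ck] := normalize_sign c.
  have H : projectively_equivalent XX (q6 0 1 c 0 e 0) XX (q6 0 1 (c * k ^+ 2) 0 0 0).
    apply: (pencil_step (u := v3 1 0 (- e / (2%:R * c))) (v := v3 0 1 0) (w := v3 0 0 k)
      (a := 1) (b := 0) (c := - e ^+ 2 / (4%:R * c)) (d := 1)).
    - by ddet; rewrite (_ : _ + _ = k)//; ring.
    - by apply/eqP => E; lra.
    - by forms; ring.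
    - by forms; try ring; field; rewrite ?c0 ?two ?four.
  apply: (classified_equiv H); case: ck => [->|->|/eqP]; last by rewrite (negbTE c0).
  - apply: (@classified_step Type_IIIa (v3 0 1 0) (v3 0 0 1) (v3 1 0 0) _ _ 0 1 1 0).
    + by ddet; apply/eqP => E; lra.
    + by apply/eqP => E; lra.
    + by forms; ring.
    + by forms; ring.
  - apply: (@classified_step Type_III (v3 0 1 1) (v3 1 0 0) (v3 0 1 (-1)) _ _ 0 1 4%:R 0).
    + by ddet; apply/eqP => E; lra.
    + by apply/eqP => E; lra.
    + by forms; ring.
    + by forms; ring.
move=> reg; have [b0|b0] := eqVneq b 0; last exact: main.
have [c0|c0] := eqVneq c 0.
  have d0 : d != 0.
    apply/eqP => d0; move: reg => [s [t]]; rewrite d0 c0 b0 !q6Z q6D discE => /eqP[].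
    by ring.
  (* When yz is the only term available, substituting (y + z)(y - z) for it creates a square. *)
  have H : projectively_equivalent XX (q6 a b c d e h) XX (q6 a d (- d) 0 (h - e) (h + e)).
    apply: (pencil_step (u := v3 1 0 0) (v := v3 0 1 1) (w := v3 0 1 (-1))
      (a := 1) (b := 0) (c := 0) (d := 1)).
    - by ddet; apply/eqP => E; lra.
    - by apply/eqP => E; lra.
    - by forms; ring.
    - by rewrite b0 c0; forms; ring.
  by apply: (classified_equiv H); apply: main => //; exact: regular_pencil_equiv H reg.
have H : projectively_equivalent XX (q6 a b c d e h) XX (q6 a c b d h e).
  apply: (pencil_step (u := v3 1 0 0) (v := v3 0 0 1) (w := v3 0 1 0)
    (a := 1) (b := 0) (c := 0) (d := 1)).
  - by ddet; apply/eqP => E; lra.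
  - by apply/eqP => E; lra.
  - by forms; ring.
  - by forms; ring.
by apply: (classified_equiv H); apply: main => //; exact: regular_pencil_equiv H reg.
Qed.

Lemma cubic_root a b c d : a != 0 -> exists x, a * x ^+ 3 + b * x ^+ 2 + c * x + d = 0.
Proof.
(* Cauchy's bound: after division by [a], the leading term dominates at -T and at T, where it has
   opposite signs. *)
move=> a0; pose S := `|b / a| + `|c / a| + `|d / a|; pose T := 1 + S.
have S0 : 0 <= S by rewrite !addr_ge0.
have T1 : 1 <= T by rewrite lerDl.
have T0 : 0 <= T by exact: le_trans T1.
pose p : {poly R} := 'X^3 + (b / a) *: 'X^2 + (c / a) *: 'X + (d / a)%:P.
have pE x : p.[x] = x ^+ 3 + (b / a * x ^+ 2 + c / a * x + d / a).
  by rewrite /p !(hornerD, hornerZ, hornerXn, hornerX, hornerC); ring.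
have bd x : `|x| = T -> `|b / a * x ^+ 2 + c / a * x + d / a| <= S * T ^+ 2.
  move=> xT; apply: (le_trans (ler_normD _ _)); rewrite /S mulrDl lerD//.
    apply: (le_trans (ler_normD _ _)); rewrite mulrDl lerD//.
      by rewrite normrM normrX xT.
    by rewrite normrM xT ler_wpM2l// expr2 ler_peMl.
  by rewrite ler_peMr// exprn_ege1.
have ST : S * T ^+ 2 <= T ^+ 3.
  by rewrite [T ^+ 3]exprS ler_wpM2r ?exprn_ge0// lerDr.
have [x _ px] : exists2 x, - T <= x <= T & root p x.
  apply: poly_ivt; first by lra.
  apply/andP; split; rewrite pE.
    have := bd (- T); rewrite normrN ger0_norm// => /(_ erefl).
    rewrite ler_norml => /andP[_]; rewrite (_ : (- T) ^+ 3 = - T ^+ 3); last by ring.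
    by lra.
  have := bd T; rewrite ger0_norm// => /(_ erefl).
  by rewrite ler_norml => /andP[]; lra.
exists x; move/rootP: px; rewrite pE => E.
by rewrite -(mulr0 a) -E; field.
Qed.

(** The discriminant restricted to the pencil is a real cubic, so some [t *: f + g] is degenerate.
    It is nonzero by independence, and its normal form selects one of the three preceding
    reductions. *)
Lemma classify f g : disc f != 0 -> (forall k, g != k *: f) -> classified f g.
Proof.
move=> Df gf; have [t tE] := cubic_root (disc_diff f g) (disc_diff g f) (disc g) Df.
pose D := t *: f + g.
have D0 : D != 0.
  apply/eqP => D0; have /eqP := gf (- t); apply.
  by rewrite scaleNr; apply/eqP; rewrite -addr_eq0 addrC -/D D0.
have disc_D : disc D = 0.
  rewrite /D -[g]scale1r disc_pencil -[RHS]tE !expr1n; ring.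
have reg : regular_pencil D f by exists 0, 1; rewrite scale0r add0r scale1r.
have sp : same_span f g D f.
  exists 0, 1, 1, (- t); rewrite mul0r sub0r mulr1 oppr_eq0 oner_neq0; split=> //.
    by rewrite scale0r add0r scale1r.
  by rewrite scale1r scaleNr /D addrAC subrr add0r.
apply: (classified_equiv (projectively_equivalent_span sp)).
have [H|H|H] := degenerate_normal D0 disc_D.
- exact: classified_reducible H reg classified_xy.
- exact: classified_reducible H reg classified_xx_yy.
- exact: classified_reducible H reg classified_xx.
Qed.

End Classification.

(** * Triviality of the action of GL_3(R) *)

Section Couples.
Variable R : realType.
Implicit Types (f g : 'rV[R]_6) (M N : 'M[R]_3).

Let two : (2%:R : R) != 0. Proof. by rewrite pnatr_eq0. Qed.

Definition independent f g := forall a b : R, a *: f + b *: g = 0 -> a = 0 /\ b = 0.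

Lemma independentP f g : f != 0 -> (forall k, g != k *: f) -> independent f g.
Proof.
move=> f0 gf a b E; have [b0|b0] := eqVneq b 0.
  split=> //; move: E; rewrite b0 scale0r addr0 => /eqP.
  by rewrite scaler_eq0 (negbTE f0) orbF => /eqP.
exfalso; have /eqP := gf (- a / b); apply.
apply: (scalerI b0); rewrite scalerA mulrCA mulfV// mulr1 scaleNr.
by apply/eqP; rewrite -addr_eq0 addrC E.
Qed.

Lemma independent_neq0 f g : independent f g -> f != 0 /\ g != 0.
Proof.
move=> H; split; apply/eqP => E.
  have /H[/eqP] : 1 *: f + 0 *: g = 0 by rewrite E scaler0 scale0r addr0.
  by rewrite oner_eq0.
have /H[_ /eqP] : 0 *: f + 1 *: g = 0 by rewrite E scaler0 scale0r addr0.
by rewrite oner_eq0.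
Qed.

Lemma independent_span f g f0 g0 : same_span f g f0 g0 -> independent f0 g0 -> independent f g.
Proof.
move=> /same_span_sym[a [b [c [d [D -> ->]]]]] H x y E.
have /= := H (x * d - y * c) (y * a - x * b).
have -> : (x * d - y * c) *: (a *: f + b *: g) + (y * a - x * b) *: (c *: f + d *: g) =
   (a * d - b * c) *: (x *: f + y *: g).
  rewrite !scalerDr !scalerA addrACA -!scalerDl.
  by congr (_ *: _ + _ *: _); ring.
rewrite E scaler0 => /(_ erefl)[E1 E2].
have Ex : (a * d - b * c) * x = 0.
  transitivity (a * (x * d - y * c) + c * (y * a - x * b)); first by ring.
  by rewrite E1 E2 !mulr0 addr0.
have Ey : (a * d - b * c) * y = 0.
  transitivity (b * (x * d - y * c) + d * (y * a - x * b)); first by ring.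
  by rewrite E1 E2 !mulr0 addr0.
by move: Ex Ey => /eqP + /eqP; rewrite !mulf_eq0 (negbTE D) => /eqP-> /eqP->.
Qed.

Lemma independent_act f g M : M \in unitmx -> independent f g -> independent (act M f) (act M g).
Proof.
by move=> Mu H a b /eqP; rewrite -!actZ -actD act_eq0// => /eqP/H.
Qed.

Lemma independent_equiv f g f0 g0 : projectively_equivalent f g f0 g0 ->
  independent f0 g0 -> independent f g.
Proof.
move=> [M Mu H] /(independent_span H) H1 a b E.
by apply: H1; rewrite -!actZ -actD E act0.
Qed.

Lemma nondegenerateP f : Defs.nondegenerate f <-> disc f != 0.
Proof.
split=> [nf|Df v vf].
  apply/eqP => D0; have /det0P[v v0 vG] : \det (gram f) == 0 by rewrite det_gram D0 mulr0.
  move/eqP: v0; apply; apply: nf => w.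
  by have := gramE f v w; rewrite vG mul0mx => /matrixP/(_ 0 0); rewrite !mxE eqxx mulr1n.
have Gu : gram f \in unitmx by rewrite unitmxE unitfE det_gram mulf_neq0.
have vG : v *m gram f = 0.
  apply/rowP => j; have := gramE f v (delta_mx 0 j); rewrite vf trmx_delta -colE.
  by move=> /matrixP/(_ 0 0); rewrite !mxE mul0rn.
by rewrite -[v]mulmx1 -(mulmxV Gu) mulmxA vG mul0mx.
Qed.

Lemma proper_pt f : f != 0 -> Defs.proper (proj_pt f) <-> disc f != 0.
Proof.
move=> f0; have [a a0 E] := proj_repr_pt f0.
rewrite /Defs.proper nondegenerateP E discZ mulf_eq0 negb_or.
by rewrite expf_eq0 /= a0.
Qed.

Lemma proper_coupleP f g : independent f g ->
  proper_couple (couple f g) <-> disc f != 0 /\ disc g != 0.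
Proof.
move=> H; have [f0 g0] := independent_neq0 H.
split=> [[/(proper_pt f0) Df /(proper_pt g0) Dg _]|[Df Dg]]; first by [].
split; [exact/(proper_pt f0)|exact/(proper_pt g0)|].
move/(proj_ptP f0 g0) => [a a0 gE].
have : (- a) *: f + 1 *: g = 0 by rewrite gE scale1r scaleNr addNr.
by move=> /H[_ /eqP]; rewrite oner_eq0.
Qed.

Definition good_forms f g := [/\ disc f != 0, disc g != 0 & independent f g].

Lemma good_forms_couple f g : good_forms f g -> proper_couple (couple f g).
Proof. by move=> [Df Dg H]; apply/proper_coupleP. Qed.

Lemma couple_repr (c : conic R * conic R) : c = couple (proj_repr c.1) (proj_repr c.2).
Proof. by rewrite /couple !proj_reprK; case: c. Qed.

Lemma proper_couple_good c : proper_couple c ->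
  good_forms (proj_repr c.1) (proj_repr c.2).
Proof.
move=> [p1 p2 /eqP ne]; have f0 := proj_repr_neq0 c.1; have g0 := proj_repr_neq0 c.2.
split; [exact/nondegenerateP|exact/nondegenerateP|].
apply: independentP => // k; apply: contra_neqN ne => /eqP gE.
rewrite -(proj_reprK c.1) -(proj_reprK c.2) gE proj_ptZ//.
by apply: contraNneq g0 => k0; rewrite gE k0 scale0r.
Qed.

Lemma good_forms_act f g M : M \in unitmx -> good_forms f g -> good_forms (act M f) (act M g).
Proof.
move=> Mu [Df Dg H]; have dM : (\det M) ^+ 2 != 0 by rewrite sqrf_eq0 -unitfE -unitmxE.
split; [rewrite disc_act//; exact: mulf_neq0|rewrite disc_act//; exact: mulf_neq0|].
exact: independent_act.
Qed.

(** Retraction of the line onto [0, 1]. It turns a path of forms controlled only on [0, 1] into one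
    that is nonzero everywhere, as continuity into projective space requires here. *)
Definition clamp (t : R) := (1 + `|t| - `|t - 1|) / 2.

Lemma clamp_continuous : continuous clamp.
Proof.
move=> t; apply: cvgM; last exact: cvg_cst.
apply: cvgB; first apply: cvgD; first exact: cvg_cst.
  exact: norm_continuous.
apply: (@continuous_comp _ _ _ (fun t : R => t - 1) (fun t => `|t|)); last exact: norm_continuous.
by apply: cvgB; [exact: cvg_id|exact: cvg_cst].
Qed.

Lemma clamp_in t : 0 <= clamp t <= 1.
Proof.
rewrite /clamp; have /orP[t0|t0] := le_total 0 t; have /orP[t1|t1] := le_total 1 t.
- by rewrite (ger0_norm t0) ger0_norm ?subr_ge0//; lra.
- by rewrite (ger0_norm t0) ler0_norm ?subr_le0//; lra.
- by lra.
- by rewrite (ler0_norm t0) ler0_norm ?subr_le0//; lra.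
Qed.

Lemma clampE t : 0 <= t <= 1 -> clamp t = t.
Proof.
move=> /andP[t0 t1]; rewrite /clamp ger0_norm// ler0_norm ?subr_le0//; lra.
Qed.

Lemma continuous_couple (T : topologicalType) (u v : T -> conic R) :
  continuous u -> continuous v -> continuous (fun t => (u t, v t)).
Proof. 
move=> uc vc t P [[A B] /= [nA nB] ABP].
have nUV : nbhs t ((u @^-1` A) `&` (v @^-1` B)) by apply: filterI; [exact: uc|exact: vc].
by apply: (@filterS _ (nbhs t) _ _ _ _ nUV) => s [As Bs]; exact: (ABP (u s, v s)).
 Qed.

(** As long as the pencil stays in one equivalence class, the base points keep their numbers and
    multiplicities; only continuity of the forms and nonvanishing discriminants remain to be
    checked. *)
Lemma rigid_path (F G : R -> 'rV[R]_6) f g : continuous F -> continuous G ->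
  independent f g ->
  (forall t, 0 <= t <= 1 -> [/\ disc (F t) != 0, disc (G t) != 0 &
     projectively_equivalent (F t) (G t) f g]) ->
  rigidly_isotopic (couple (F 0) (G 0)) (couple (F 1) (G 1)).
Proof.
move=> Fc Gc fg H.
have good t : 0 <= t <= 1 -> good_forms (F t) (G t).
  by move=> /H[Df Dg E]; split=> //; exact: independent_equiv E fg.
have [f0 g0] := independent_neq0 fg.
apply/rigidly_isotopicP; exists (fun t => couple (F (clamp t)) (G (clamp t))).
have c0 : clamp 0 = 0 by apply: clampE; rewrite lexx ler01.
have c1 : clamp 1 = 1 by apply: clampE; rewrite lexx ler01.
have nz (t : R) : F (clamp t) != 0 /\ G (clamp t) != 0.
  have [_ _ I] := good _ (clamp_in t); exact: independent_neq0 I.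
split.
- apply: continuous_subspaceT; apply: continuous_couple.
    apply: (@continuous_proj_pt _ _ _ (F \o clamp)) => [s|s]; last exact: (nz s).1.
    by apply: continuous_comp; [exact: clamp_continuous|exact: Fc].
  apply: (@continuous_proj_pt _ _ _ (G \o clamp)) => [s|s]; last exact: (nz s).2.
  by apply: continuous_comp; [exact: clamp_continuous|exact: Gc].
- by rewrite c0.
- by rewrite c1.
- have eqv t : 0 <= t <= 1 -> same_intersections (couple (F t) (G t)) (couple f g).
    move=> t01; have [_ _ I] := good _ t01; have [F0 G0] := independent_neq0 I.
    by have [_ _ E] := H t t01; exact: same_intersections_pencil F0 G0 f0 g0 E.
  move=> t t01; rewrite (clampE t01); split; first exact: good_forms_couple (good t t01).
  have z01 : 0 <= (0 : R) <= 1 by rewrite lexx ler01.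
  exact: (same_intersections_trans (eqv 0 z01) (same_intersections_sym (eqv t t01))).
Qed.

End Couples.

Section GeneralLinear.
Variable R : realType.
Implicit Types (f g : 'rV[R]_6) (M N : 'M[R]_3).

Let two : (2%:R : R) != 0. Proof. by rewrite pnatr_eq0. Qed.

(** These matrices form a group, closed under segments that avoid singular matrices and under
    negation. Generators of GL_3(R) are therefore enough. *)
Definition isotopy_trivial M := M \in unitmx /\ forall f g, good_forms f g ->
  rigidly_isotopic (couple f g) (couple (act M f) (act M g)).

Lemma isotopy_trivial1 : isotopy_trivial 1%:M.
Proof.
split=> [|f g fg]; first exact: unitmx1.
by rewrite !act1; apply: rigidly_isotopic_refl; exact: good_forms_couple.
Qed.

Lemma isotopy_trivialM M N : isotopy_trivial M -> isotopy_trivial N -> isotopy_trivial (M *m N).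
Proof.
move=> [Mu HM] [Nu HN]; split=> [|f g fg]; first by rewrite unitmx_mul Mu.
rewrite -!act_comp; apply: rigidly_isotopic_trans (HN f g fg) _.
by apply: HM; exact: good_forms_act.
Qed.

Lemma isotopy_trivialV M : isotopy_trivial M -> isotopy_trivial (invmx M).
Proof.
move=> [Mu HM]; split=> [|f g fg]; first by rewrite unitmx_inv.
apply: rigidly_isotopic_sym.
have Vu : invmx M \in unitmx by rewrite unitmx_inv.
have := HM _ _ (good_forms_act Vu fg); rewrite !act_comp mulmxV//.
by rewrite !act1.
Qed.

(** [act] is quadratic in the matrix, so along a segment the coefficients are polynomials in t; the
    coefficient of t(1 - t) is the polarisation. *)
Lemma act_segment M N f (t : R) : act ((1 - t) *: M + t *: N) f =
  (1 - t) ^+ 2 *: act M f + t ^+ 2 *: act N f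
  + (t * (1 - t)) *: (act (M + N) f - act M f - act N f).
Proof.
have NE c (v : 'rV[R]_3) : qform_eval (- c) v = - qform_eval c v.
  by rewrite -scaleN1r qform_evalZ mulN1r.
apply: qform_eval_inj => v; rewrite !(qform_evalD, qform_evalZ, NE).
rewrite !qform_eval_act !mulmxDr -!scalemxAr.
move: (v *m M) (v *m N) => x y; rewrite /qform_eval !mxE; ring.
Qed.

Lemma isotopy_trivial_segment M N : (forall t, 0 <= t <= 1 -> (1 - t) *: M + t *: N \in unitmx) ->
  isotopy_trivial M -> isotopy_trivial N.
Proof.
move=> MNu [Mu HM].
have Nu : N \in unitmx.
  have := MNu 1; rewrite subrr scale0r add0r scale1r; apply.
  by rewrite lexx ler01.
split=> // f g fg; apply: (rigidly_isotopic_trans (HM f g fg)).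
pose P h (t : R) := act ((1 - t) *: M + t *: N) h.
have Pc h : continuous (P h).
  rewrite /P; under eq_fun do rewrite act_segment.
  have cZ (k : R -> R) (v : 'rV[R]_6) : continuous k -> continuous (fun t => k t *: v).
    move=> kc; apply: continuous_rV => j; under eq_fun do rewrite mxE.
    by move=> t; apply: cvgM; [exact: kc|exact: cvg_cst].
  have c1 : continuous (fun t : R => 1 - t).
    by move=> t; apply: cvgB; [exact: cvg_cst|exact: cvg_id].
  have c2 : continuous (fun t : R => t) by move=> t; exact: cvg_id.
  have c11 : continuous (fun t : R => (1 - t) ^+ 2) by move=> t; exact: (cvgM (c1 t) (c1 t)).
  have c22 : continuous (fun t : R => t ^+ 2) by move=> t; exact: (cvgM (c2 t) (c2 t)).
  have c12 : continuous (fun t : R => t * (1 - t)) by move=> t; exact: (cvgM (c2 t) (c1 t)).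
  move=> t; apply: cvgD; first apply: cvgD.
  - exact: (cZ _ _ c11 t).
  - exact: (cZ _ _ c22 t).
  - exact: (cZ _ _ c12 t).
have [_ _ I] := fg.
have := @rigid_path R (P f) (P g) f g (Pc f) (Pc g) I.
rewrite /P !subr0 !subrr !scale1r !scale0r !addr0 !add0r; apply=> t t01.
have Ku := MNu t t01; have [Df Dg _] := good_forms_act Ku fg.
split=> //; exists (invmx ((1 - t) *: M + t *: N)); first by rewrite unitmx_inv.
by rewrite !act_comp mulVmx// !act1; exact: same_span_refl.
Qed.

(** In odd dimension negation reverses the sign of the determinant, so this is what links the two
    components of GL_3(R). *)
Lemma isotopy_trivialN M : isotopy_trivial M -> isotopy_trivial (- M).
Proof.
move=> [Mu HM]; have E f : act (- M) f = act M f.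
  by rewrite -scaleN1r act_scalar sqrrN expr1n scale1r.
split=> [|f g fg]; last by rewrite !E; exact: HM.
by rewrite -scaleN1r unitmxZ// unitfE oppr_eq0 oner_eq0.
Qed.

Lemma sum_sq_gt0 (t : R) : (1 - t) ^+ 2 + t ^+ 2 != 0.
Proof. by apply/eqP => /sum_sq0[]; lra. Qed.

Definition diag3 (a b c : R) := m3 (v3 a 0 0) (v3 0 b 0) (v3 0 0 c).

Lemma m3Z k (u v w : 'rV[R]_3) : k *: m3 u v w = m3 (k *: u) (k *: v) (k *: w).
Proof. by apply/matrixP => i j; rewrite !mxE; case: i => -[|[|[|//]]] ?; rewrite mxE. Qed.

Lemma m3D (u v w u' v' w' : 'rV[R]_3) :
  m3 u v w + m3 u' v' w' = m3 (u + u') (v + v') (w + w').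
Proof. by apply/matrixP => i j; rewrite !mxE; case: i => -[|[|[|//]]] ?; rewrite mxE. Qed.

Lemma diag3_1 : diag3 1 1 1 = 1%:M.
Proof.
by apply/matrixP => i j; rewrite !mxE; case: i => -[|[|[|//]]] ?;
  rewrite !mxE; case: j => -[|[|[|//]]] ?.
Qed.

Lemma isotopy_trivial_m3_segment x y z x' y' z' x'' y'' z'' a b c a' b' c' a'' b'' c'' :
  (forall t, 0 <= t <= 1 ->
     det3 ((1 - t) * x + t * a) ((1 - t) * y + t * b) ((1 - t) * z + t * c)
     ((1 - t) * x' + t * a') ((1 - t) * y' + t * b') ((1 - t) * z' + t * c')
     ((1 - t) * x'' + t * a'') ((1 - t) * y'' + t * b'') ((1 - t) * z'' + t * c'') != 0) ->
  isotopy_trivial (m3 (v3 x y z) (v3 x' y' z') (v3 x'' y'' z'')) ->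
  isotopy_trivial (m3 (v3 a b c) (v3 a' b' c') (v3 a'' b'' c'')).
Proof.
move=> H; apply: isotopy_trivial_segment => t t01.
by rewrite !m3Z !v3Z m3D !v3D unitmxE unitfE det_m3; exact: H.
Qed.

Lemma isotopy_trivial_diag_sign a b c : a ^+ 2 = 1 -> b ^+ 2 = 1 -> c ^+ 2 = 1 ->
  isotopy_trivial (diag3 a b c).
Proof.
have I1 : isotopy_trivial (diag3 1 1 1) by rewrite diag3_1; exact: isotopy_trivial1.
(* A half-turn is reached in two segments through a quarter-turn; on both the determinant is (1 -
   t)^2 + t^2. *)
have Ixy : isotopy_trivial (diag3 (-1) (-1) 1).
  apply: (@isotopy_trivial_m3_segment 0 1 0 (-1) 0 0 0 0 1).
    move=> t _; rewrite (_ : det3 _ _ _ _ _ _ _ _ _ = (1 - t) ^+ 2 + t ^+ 2); last by rewrite /det3; ring.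
    exact: sum_sq_gt0.
  apply: (isotopy_trivial_m3_segment _ I1).
  move=> t _; rewrite (_ : det3 _ _ _ _ _ _ _ _ _ = (1 - t) ^+ 2 + t ^+ 2); last by rewrite /det3; ring.
    exact: sum_sq_gt0.
have Iyz : isotopy_trivial (diag3 1 (-1) (-1)).
  apply: (@isotopy_trivial_m3_segment 1 0 0 0 0 1 0 (-1) 0).
    move=> t _; rewrite (_ : det3 _ _ _ _ _ _ _ _ _ = (1 - t) ^+ 2 + t ^+ 2); last by rewrite /det3; ring.
    exact: sum_sq_gt0.
  apply: (isotopy_trivial_m3_segment _ I1).
  move=> t _; rewrite (_ : det3 _ _ _ _ _ _ _ _ _ = (1 - t) ^+ 2 + t ^+ 2); last by rewrite /det3; ring.
    exact: sum_sq_gt0.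
have dM x y z x' y' z' : diag3 x y z *m diag3 x' y' z' = diag3 (x * x') (y * y') (z * z').
  rewrite /diag3 [LHS]m3_eta !row_mul !row_m3 !mulv3 !row_m3 !v3Z !v3D.
  by congr m3; congr v3; ring.
have Ixz : isotopy_trivial (diag3 (-1) 1 (-1)).
  have := isotopy_trivialM Ixy Iyz; rewrite dM !(mulN1r, mul1r, opprK, mulr1) //.
have dN x y z : isotopy_trivial (diag3 x y z) -> isotopy_trivial (diag3 (- x) (- y) (- z)).
  move=> /isotopy_trivialN; by rewrite -scaleN1r m3Z !v3Z !mulN1r oppr0.
move=> /eqP a1 /eqP b1 /eqP c1.
move: a1 b1 c1; rewrite !sqrf_eq1 => /orP[]/eqP-> /orP[]/eqP-> /orP[]/eqP-> //.
- by have := dN _ _ _ Ixy; rewrite opprK.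
- by have := dN _ _ _ Ixz; rewrite opprK.
- by have := dN _ _ _ Iyz; rewrite opprK.
- by have := dN _ _ _ I1.
Qed.

Lemma isotopy_trivial_tperm (i j : 'I_3) : isotopy_trivial (tperm_mx i j).
Proof.
(* A transposition of coordinates has determinant -1 and is joined by a segment to a diagonal
   reflection, which negation has already provided. *)
have swap01 : isotopy_trivial (m3 (v3 0 1 0) (v3 1 0 0) (v3 0 0 1)).
  apply: (isotopy_trivial_m3_segment (x := 1) (y' := -1) (z'' := 1) (y := 0) (z := 0) (x' := 0)
    (z' := 0) (x'' := 0) (y'' := 0)); last by apply: isotopy_trivial_diag_sign; rewrite ?sqrrN ?expr1n.
  move=> t _; rewrite (_ : det3 _ _ _ _ _ _ _ _ _ = - ((1 - t) ^+ 2 + t ^+ 2)); last by rewrite /det3; ring.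
  by rewrite oppr_eq0 sum_sq_gt0.
have swap12 : isotopy_trivial (m3 (v3 1 0 0) (v3 0 0 1) (v3 0 1 0)).
  apply: (isotopy_trivial_m3_segment (x := 1) (y' := 1) (z'' := -1) (y := 0) (z := 0) (x' := 0)
    (z' := 0) (x'' := 0) (y'' := 0)); last by apply: isotopy_trivial_diag_sign; rewrite ?sqrrN ?expr1n.
  move=> t _; rewrite (_ : det3 _ _ _ _ _ _ _ _ _ = - ((1 - t) ^+ 2 + t ^+ 2)); last by rewrite /det3; ring.
  by rewrite oppr_eq0 sum_sq_gt0.
have swap02 : isotopy_trivial (m3 (v3 0 0 1) (v3 0 1 0) (v3 1 0 0)).
  apply: (isotopy_trivial_m3_segment (x := 1) (y' := 1) (z'' := -1) (y := 0) (z := 0) (x' := 0)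
    (z' := 0) (x'' := 0) (y'' := 0)); last by apply: isotopy_trivial_diag_sign; rewrite ?sqrrN ?expr1n.
  move=> t _; rewrite (_ : det3 _ _ _ _ _ _ _ _ _ = - ((1 - t) ^+ 2 + t ^+ 2)); last by rewrite /det3; ring.
  by rewrite oppr_eq0 sum_sq_gt0.
have [->|ij] := eqVneq i j; first by rewrite /tperm_mx tperm1 perm_mx1; exact: isotopy_trivial1.
have E (M : 'M[R]_3) : isotopy_trivial M -> (forall a b, (tperm i j a == b)%:R = M a b) ->
    isotopy_trivial (tperm_mx i j).
  by move=> IM H; congr isotopy_trivial: IM; apply/matrixP => a b; rewrite !mxE H.
move: ij; case: i {E} (E) => -[|[|[|//]]] hi E; case: j E => -[|[|[|//]]] hj E // _;
  [apply: E swap01 _|apply: E swap02 _|apply: E swap01 _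
  |apply: E swap12 _|apply: E swap02 _|apply: E swap12 _];
  move=> a b; rewrite !mxE; case: a => -[|[|[|//]]] ha; case: b => -[|[|[|//]]] hb;
  by rewrite /= ?mxE ?permE /= -?val_eqE /=.
Qed.

Lemma isotopy_trivial_perm (s : {perm 'I_3}) : isotopy_trivial (perm_mx s).
Proof.
have [ts -> _] := prod_tpermP s; elim: ts => [|t ts IH].
  by rewrite big_nil perm_mx1; exact: isotopy_trivial1.
by rewrite big_cons perm_mxM; apply: isotopy_trivialM IH; exact: isotopy_trivial_tperm.
Qed.

(** On the segment from the diagonal matrix of signs, each diagonal entry keeps its sign. *)
Lemma isotopy_trivial_upper a b c d e h : a != 0 -> b != 0 -> c != 0 ->
  isotopy_trivial (m3 (v3 a d e) (v3 0 b h) (v3 0 0 c)).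
Proof.
move=> a0 b0 c0.
have sg (x : R) : x != 0 -> Num.sg x ^+ 2 = 1 by move=> x0; rewrite sqr_sg x0.
have seg (x t : R) : x != 0 -> 0 <= t <= 1 -> (1 - t) * Num.sg x + t * x != 0.
  move=> x0 /andP[t0 t1]; apply/eqP => E; move: E; have [x1|x1|x1] := ltgtP x 0.
  - by rewrite ltr0_sg//; nra.
  - by rewrite gtr0_sg//; nra.
  - by rewrite x1 eqxx in x0.
apply: (isotopy_trivial_m3_segment _ (isotopy_trivial_diag_sign (sg _ a0) (sg _ b0) (sg _ c0))) => t t01.
rewrite (_ : det3 _ _ _ _ _ _ _ _ _ = ((1 - t) * Num.sg a + t * a) * ((1 - t) * Num.sg b + t * b)
  * ((1 - t) * Num.sg c + t * c)); last by rewrite /det3; ring.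
by rewrite !mulf_neq0// seg.
Qed.

Lemma isotopy_trivial_lower a b c :
  isotopy_trivial (m3 (v3 1 0 0) (v3 a 1 0) (v3 b c 1)).
Proof.
have I1 : isotopy_trivial (diag3 1 1 1) by rewrite diag3_1; exact: isotopy_trivial1.
apply: (isotopy_trivial_m3_segment _ I1) => t _.
by rewrite (_ : det3 _ _ _ _ _ _ _ _ _ = 1) ?oner_neq0//; rewrite /det3; ring.
Qed.

Lemma m3_entries M : M = m3
  (v3 (M (inord 0) (inord 0)) (M (inord 0) (inord 1)) (M (inord 0) (inord 2)))
  (v3 (M (inord 1) (inord 0)) (M (inord 1) (inord 1)) (M (inord 1) (inord 2)))
  (v3 (M (inord 2) (inord 0)) (M (inord 2) (inord 1)) (M (inord 2) (inord 2))).
Proof.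
have E i : v3 (M i (inord 0)) (M i (inord 1)) (M i (inord 2)) = row i M.
  by rewrite [RHS]v3_eta !mxE.
by rewrite !E -m3_eta.
Qed.

(** The LUP decomposition writes any invertible matrix as a product of the factors already
    treated. *)
Lemma isotopy_trivial_unit M : M \in unitmx -> isotopy_trivial M.
Proof.
move=> Mu; move: (@cormen_lup_correct R 2 M) (@cormen_lup_perm R 2 M)
  (@cormen_lup_lower R 2 M) (@cormen_lup_upper R 2 M).
case: (@cormen_lup R 2 M) => -[P L] U E /existsP[s /eqP PE] LO UP.
rewrite /fst /snd in PE LO UP; subst P.
have LE : L = m3 (v3 1 0 0) (v3 (L (inord 1) (inord 0)) 1 0)
    (v3 (L (inord 2) (inord 0)) (L (inord 2) (inord 1)) 1).
  rewrite {1}(m3_entries L).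
  by congr m3; congr v3; rewrite LO ?inordK// -val_eqE /= !inordK.
have UE : U = m3 (v3 (U (inord 0) (inord 0)) (U (inord 0) (inord 1)) (U (inord 0) (inord 2)))
    (v3 0 (U (inord 1) (inord 1)) (U (inord 1) (inord 2))) (v3 0 0 (U (inord 2) (inord 2))).
  rewrite {1}(m3_entries U).
  by congr m3; congr v3; rewrite UP ?inordK.
have E' : perm_mx s *m M = L *m U := E.
have IL : isotopy_trivial L by rewrite LE; exact: isotopy_trivial_lower.
have Pu : (perm_mx s : 'M[R]_3) \in unitmx by exact: unitmx_perm.
have Uu : U \in unitmx.
  have : perm_mx s *m M \in unitmx by rewrite unitmx_mul Pu.
  by rewrite E' unitmx_mul => /andP[].
have IU : isotopy_trivial U.
  move: Uu; rewrite unitmxE unitfE UE det_m3.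
  rewrite (_ : det3 _ _ _ _ _ _ _ _ _ = U (inord 0) (inord 0) * U (inord 1) (inord 1) * U (inord 2) (inord 2)); last by rewrite /det3; ring.
  by rewrite !mulf_eq0 !negb_or => /andP[/andP[u0 u1] u2]; exact: isotopy_trivial_upper.
have -> : M = invmx (perm_mx s) *m (L *m U) by rewrite -E' mulKmx.
by apply: isotopy_trivialM; [exact/isotopy_trivialV/isotopy_trivial_perm|exact: isotopy_trivialM].
Qed.

End GeneralLinear.

(** * Reduction to the representatives *)

Section NormalCouples.
Variable R : realType.
Implicit Types (f g : 'rV[R]_6) (M N : 'M[R]_3) (t : pencil_type) (m n : R).

Let two : (2%:R : R) != 0. Proof. by rewrite pnatr_eq0. Qed.

Definition member t m : 'rV[R]_6 := pencil_fst R t + m *: pencil_snd R t.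

Definition normal_couple t m n : conic R * conic R := couple (member t m) (member t n).

Definition member_disc t m : R :=
  match t with
  | Type_I => 4%:R * m * (1 - m)
  | Type_Ia => 4%:R - m ^+ 2
  | Type_Ib => - (4%:R + m ^+ 2)
  | Type_II | Type_IIa => - m ^+ 2
  | Type_III => - m
  | Type_IIIa => 4%:R * m
  | Type_IV | Type_V => 1
  end.

Lemma disc_member t m : disc (member t m) = member_disc t m.
Proof. by rewrite /member; case: t; rewrite /= q6Z q6D discE; ring. Qed.

Lemma disc_pencil_snd t : disc (pencil_snd R t) = 0.
Proof. by case: t; rewrite /= discE; ring. Qed.

Lemma pencil_independent t : independent (pencil_fst R t) (pencil_snd R t).
Proof.
move=> a b /rowP H; have := H (inord 0); have := H (inord 1); have := H (inord 2).
have := H (inord 4); have := H (inord 3); have := H (inord 5) => {H}.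
by case: t; rewrite !mxE ?q6E /= !inordK//= => *; split; lra.
Qed.

Definition distinct_members t m n := [/\ m != n, member_disc t m != 0 & member_disc t n != 0].

Lemma same_span_members t m n : m != n ->
  same_span (member t m) (member t n) (pencil_fst R t) (pencil_snd R t).
Proof.
move=> mn; exists 1, m, 1, n; rewrite !scale1r mul1r mulr1 subr_eq0 eq_sym.
by split.
Qed.

Lemma good_members t m n : distinct_members t m n -> good_forms (member t m) (member t n).
Proof.
move=> [mn dm dn]; split; [by rewrite disc_member|by rewrite disc_member|].
exact: (independent_span (same_span_members t mn) (@pencil_independent t)).
Qed.

Definition has_zero f := exists2 v, v != 0 & qform_eval f v = 0.

Lemma nonempty_zero (q : conic R) : Defs.nonempty q <-> has_zero (proj_repr q).
Proof.
split=> [[p /= H]|[v v0 H]]; first by exists (proj_repr p) => //; exact: proj_repr_neq0.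
by exists (proj_pt v); apply/(qform_eval_repr _ v0).
Qed.

Lemma has_zeroZ k f : k != 0 -> has_zero (k *: f) <-> has_zero f.
Proof.
move=> k0; split=> -[v v0 H]; exists v => //; last by rewrite qform_evalZ H mulr0.
by move: H => /eqP; rewrite qform_evalZ mulf_eq0 (negbTE k0) => /eqP.
Qed.

Lemma has_zero_act f M : M \in unitmx -> has_zero (act M f) <-> has_zero f.
Proof.
move=> Mu; split=> -[v v0 H].
  by exists (v *m M); [exact: mulmx_unit_neq0|rewrite -qform_eval_act].
exists (v *m invmx M); first by rewrite mulmx_unit_neq0// unitmx_inv.
by rewrite qform_eval_act mulmxKV.
Qed.

Lemma nonempty_pt f : f != 0 -> Defs.nonempty (proj_pt f) <-> has_zero f.
Proof.
move=> f0; rewrite nonempty_zero; have [a a0 ->] := proj_repr_pt f0; exact: has_zeroZ.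
Qed.

Lemma normal_form c : proper_couple c -> exists t M m n k l, [/\ M \in unitmx,
  k != 0, l != 0, distinct_members t m n &
  proj_repr c.1 = k *: act M (member t m) /\ proj_repr c.2 = l *: act M (member t n)].
Proof.
move=> /proper_couple_good; move: (proj_repr c.1) (proj_repr c.2) => f g [Df Dg I].
have gf k : g != k *: f.
  apply/eqP => gE; have : (- k) *: f + 1 *: g = 0 by rewrite gE scale1r scaleNr addNr.
  by move=> /I[_ /eqP]; rewrite oner_eq0.
have [t [M Mu [a [b [c' [d [D fE gE]]]]]]] := classify Df gf.
have Vu : invmx M \in unitmx by rewrite unitmx_inv.
have sc h x y : act M h = x *: pencil_fst R t + y *: pencil_snd R t -> disc h != 0 ->
    [/\ x != 0, h = x *: act (invmx M) (member t (y / x)) & member_disc t (y / x) != 0].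
  move=> hE Dh; have dM : \det M != 0 by rewrite -unitfE -unitmxE.
  have Dh' : disc (act M h) != 0 by rewrite disc_act// mulf_neq0// sqrf_eq0.
  (* A proper member cannot be a multiple of the degenerate [pencil_snd], so its coefficient on
     [pencil_fst] can be divided out. *)
  have x0 : x != 0.
    apply/eqP => x0; move/eqP: Dh'; apply.
    by rewrite hE x0 scale0r add0r discZ disc_pencil_snd mulr0.
  have hE' : act M h = x *: member t (y / x).
    by rewrite hE /member scalerDr scalerA mulrCA mulfV// mulr1.
  split=> //; first by rewrite -actZ -hE' act_comp mulVmx// act1.
  by move: Dh'; rewrite hE' discZ disc_member mulf_eq0 negb_or => /andP[].
have [a0 fE' da] := sc f a b fE Df; have [c0 gE' dc] := sc g c' d gE Dg.
exists t, (invmx M), (b / a), (d / c'), a, c'; split=> //; split=> //.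
apply: contra_neq D => /(congr1 (fun z => z * a * c')).
by rewrite /= mulfVK// mulrAC mulfVK// => E; rewrite mulrC -E; ring.
Qed.

Lemma couple_scale k l f g : k != 0 -> l != 0 -> f != 0 -> g != 0 ->
  couple (k *: f) (l *: g) = couple f g.
Proof. by move=> k0 l0 f0 g0; rewrite /couple !proj_ptZ. Qed.

Lemma normal_couple_isotopic c : proper_couple c -> exists t m n,
  [/\ distinct_members t m n, rigidly_isotopic c (normal_couple t m n),
   Defs.nonempty c.1 -> has_zero (member t m) & Defs.nonempty c.2 -> has_zero (member t n)].
Proof.
move=> pc; have [t [M [m [n [k [l [Mu k0 l0 mn [E1 E2]]]]]]]] := normal_form pc.
exists t, m, n; have gm := good_members mn.
have [_ _ I] := good_forms_act Mu gm; have [f0 g0] := independent_neq0 I.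
split=> //.
- rewrite (couple_repr c) E1 E2 couple_scale//; apply: rigidly_isotopic_sym.
  by have [_ H] := isotopy_trivial_unit Mu; exact: H.
- by rewrite nonempty_zero E1 => /(has_zeroZ _ k0)/(has_zero_act _ Mu).
- by rewrite nonempty_zero E2 => /(has_zeroZ _ l0)/(has_zero_act _ Mu).
Qed.

Lemma normal_couple_act t m n M k l m' n' : M \in unitmx -> distinct_members t m n ->
  k != 0 -> l != 0 ->
  act M (member t m) = k *: member t m' -> act M (member t n) = l *: member t n' ->
  rigidly_isotopic (normal_couple t m n) (normal_couple t m' n').
Proof.
move=> Mu mn k0 l0 E1 E2; have gm := good_members mn.
have [_ _ I] := good_forms_act Mu gm; have [f0 g0] := independent_neq0 I.
have [_ /(_ _ _ gm)] := isotopy_trivial_unit Mu; rewrite E1 E2 couple_scale//.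
- by move: f0; rewrite E1 scaler_eq0 negb_or => /andP[].
- by move: g0; rewrite E2 scaler_eq0 negb_or => /andP[].
Qed.

Definition mix (s x y : R) := (1 - s) * x + s * y.

(** The pencil is fixed and only the two parameters move, so it suffices that the members remain
    distinct and proper. *)
Lemma normal_couple_move t m n m' n' :
  (forall s, 0 <= s <= 1 -> distinct_members t (mix s m m') (mix s n n')) ->
  rigidly_isotopic (normal_couple t m n) (normal_couple t m' n').
Proof.
move=> H; pose F (x y s : R) := member t (mix s x y).
have Fc x y : continuous (F x y).
  have c1 : continuous (fun s : R => 1 - s).
    by move=> s; apply: cvgB; [exact: cvg_cst|exact: cvg_id].
  have mc : continuous (fun s => mix s x y).
    move=> s; apply: cvgD; apply: cvgM; [exact: c1|exact: cvg_cst|exact: cvg_id|exact: cvg_cst].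
  apply: continuous_rV => j; rewrite /F /member; under eq_fun do rewrite !mxE.
  move=> s; apply: cvgD; first exact: cvg_cst.
  by apply: cvgM; [exact: mc|exact: cvg_cst].
have E x y : (F x y 0 = member t x) * (F x y 1 = member t y).
  by rewrite /F /mix subr0 subrr !mul0r !mul1r addr0 add0r.
have := rigid_path (Fc m m') (Fc n n') (@pencil_independent t).
rewrite !E; apply=> s /H[mn dm dn]; rewrite /F !disc_member; split=> //.
exact/projectively_equivalent_span/same_span_members.
Qed.

Definition flip_type t := match t with Type_I | Type_IIIa | Type_V => false | _ => true end.

Lemma normal_couple_flip t m n : flip_type t -> distinct_members t m n ->
  rigidly_isotopic (normal_couple t m n) (normal_couple t (- m) (- n)).
Proof.
(* Negating x changes the signs of xz and xy. In type III this negates [pencil_fst], whence the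
   factor -1; in type IV z is negated too, so that only xy changes sign. *)
move=> ft mn; pose k : R := if t is Type_III then -1 else 1.
pose M := if t is Type_IV then diag3 (-1 : R) 1 (-1) else diag3 (-1 : R) 1 1.
have k0 : k != 0 by rewrite /k; case: (t); rewrite ?oppr_eq0 oner_neq0.
apply: (@normal_couple_act _ _ _ M k k) => //.
- by rewrite unitmxE unitfE /M; case: (t); rewrite det_m3 /det3; apply/eqP => E; lra.
- by rewrite /k /M /member; move: ft; case: t {mn k M k0} => //= _;
    rewrite !q6Z !q6D q6Z act_m3 !formsE; congr q6; ring.
- by rewrite /k /M /member; move: ft; case: t {mn k M k0} => //= _;
    rewrite !q6Z !q6D q6Z act_m3 !formsE; congr q6; ring.
Qed.

End NormalCouples.

(** * Moving two members of a normal pencil to a representative *)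

Section Reduction.
Variable R : realType.
Implicit Types (f g : 'rV[R]_6) (M N : 'M[R]_3) (t : pencil_type) (m n : R).

(** Positions of the representatives in their normal pencils, in the order of the given list. In
    type I the given forms equal these members only up to a factor, such as 3x^2 - 2y^2 - z^2, which
    is 3 times the member of parameter 2/3. *)
Definition unstarred_params : seq (pencil_type * R * R) :=
  [:: (Type_I, 2 / 3, 1 / 3); (Type_I, 2 / 3, 2); (Type_Ia, 3, - 3);
      (Type_Ib, 1, -1); (Type_II, 1, -1); (Type_IIa, 1, -1); (Type_III, 1, -1);
      (Type_IV, 1, - 2)].

Definition starred_params : seq (pencil_type * R * R) :=
  [:: (Type_Ia, 3, 4); (Type_II, 1, 2); (Type_IIa, 1, 2); (Type_III, 1, 2);
      (Type_IIIa, -1, - 2); (Type_V, -1, 1)].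

Definition params := unstarred_params ++ starred_params ++
  [seq (p.1.1, p.2, p.1.2) | p <- starred_params].

Definition param_couple (p : pencil_type * R * R) := normal_couple p.1.1 p.1.2 p.2.

Lemma member_neq0 t m : member t m != 0.
Proof.
apply/eqP => E; have : 1 *: pencil_fst R t + m *: pencil_snd R t = 0 by rewrite scale1r.
by move=> /pencil_independent[/eqP]; rewrite oner_eq0.
Qed.

Lemma couple_members t m n k l f g : k != 0 -> l != 0 ->
  f = k *: member t m -> g = l *: member t n -> couple f g = normal_couple t m n.
Proof. by move=> k0 l0 -> ->; apply: couple_scale => //; exact: member_neq0. Qed.

Lemma couple_members1 t m n f g :
  f = member t m -> g = member t n -> couple f g = normal_couple t m n.
Proof. by move=> -> ->. Qed.

Ltac members := rewrite /member /= !q6_monomials ?(q6Z, q6N, q6D); congr q6; try lra.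

Lemma representatives_params : representatives R = [seq param_couple p | p <- params].
Proof.
have three : (3%:R : R) != 0 by rewrite pnatr_eq0.
have U : unstarred_couples R = [seq param_couple p | p <- unstarred_params].
  rewrite /unstarred_couples /unstarred_params /= /param_couple /=.
  congr [:: _; _; _; _; _; _; _; _].
  - by apply: (couple_members three three); members.
  - by apply: (couple_members three (oner_neq0 _)); members.
  - by apply: couple_members1; members.
  - by apply: couple_members1; members.
  - by apply: couple_members1; members.
  - by apply: couple_members1; members.
  - by apply: couple_members1; members.
  - by apply: couple_members1; members.
have S : starred_couples R = [seq param_couple p | p <- starred_params].
  rewrite /starred_couples /starred_params /= /param_couple /=.
  congr [:: _; _; _; _; _; _]; by apply: couple_members1; members.
by rewrite /representatives U S /params !map_cat -!map_comp.
Qed.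

Lemma param_mem i : (i < 20)%N ->
  nth (param_couple (Type_I, 0, 0)) [seq param_couple p | p <- params] i \in representatives R.
Proof. by move=> i20; rewrite representatives_params mem_nth. Qed.

Definition represented c := exists2 r, r \in representatives R & rigidly_isotopic c r.

Lemma represented_trans c c' : rigidly_isotopic c c' -> represented c' -> represented c.
Proof. by move=> H [r rR cr]; exists r => //; exact: rigidly_isotopic_trans H cr. Qed.

Lemma mix_lt (s x y x' y' : R) : 0 <= s <= 1 -> x < x' -> y < y' -> mix s x y < mix s x' y'.
Proof.
rewrite /mix => /andP[s0 s1] xx' yy'; have [->|sn] := eqVneq s 0; first by lra.
have sp : 0 < s by rewrite lt_neqAle eq_sym sn.
have h1 : 0 < s * (y' - y) by rewrite mulr_gt0// subr_gt0.
have h2 : 0 <= (1 - s) * (x' - x) by rewrite mulr_ge0// subr_ge0// ltW.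
by lra.
Qed.

Lemma mix_cst (s x : R) : mix s x x = x.
Proof. by rewrite /mix; ring. Qed.

Lemma mix_ltc (s x y c : R) : 0 <= s <= 1 -> x < c -> y < c -> mix s x y < c.
Proof. by move=> s01 xc yc; rewrite -(mix_cst s c); exact: mix_lt. Qed.

Lemma mix_gtc (s x y c : R) : 0 <= s <= 1 -> c < x -> c < y -> c < mix s x y.
Proof. by move=> s01 xc yc; rewrite -(mix_cst s c); exact: mix_lt. Qed.

Definition signed_type t := match t with Type_II | Type_IIa | Type_III => true | _ => false end.

Lemma member_disc_signed t m : signed_type t -> (member_disc t m != 0) = (m != 0).
Proof. by case: t => //= _; rewrite ?oppr_eq0 ?sqrf_eq0. Qed.

Lemma move_signed t m n (m' n' : R) : signed_type t -> (0 < m) -> (0 < m') ->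
  ((0 < m < n) && (0 < m' < n')) || ((0 < n < m) && (0 < n' < m')) || ((n < 0) && (n' < 0)) ->
  rigidly_isotopic (normal_couple t m n) (normal_couple t m' n').
Proof.
move=> st m0 m'0 H; apply: normal_couple_move => s s01.
have M0 : 0 < mix s m m' by exact: mix_gtc.
case/orP: H => [/orP[] /andP[/andP[a b] /andP[c d]]|/andP[n0 n'0]].
- have MN : mix s m m' < mix s n n' by exact: mix_lt.
  by split; rewrite ?member_disc_signed// ?(lt_eqF MN)// gt_eqF// (lt_trans M0).
- have MN : mix s n n' < mix s m m' by exact: mix_lt.
  by split; rewrite ?member_disc_signed// ?(gt_eqF MN)// gt_eqF//; exact: mix_gtc.
- have N0 : mix s n n' < 0 by exact: mix_ltc.
  by split; rewrite ?member_disc_signed// ?(gt_eqF M0)// ?(lt_eqF N0)// gt_eqF// (lt_trans N0).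
Qed.

(** A flip makes m positive. Then n is greater than m, between 0 and m, or negative, and each of
    these three regions is convex. *)
Lemma reduce_signed t m n : signed_type t -> distinct_members t m n ->
  [\/ rigidly_isotopic (normal_couple t m n) (normal_couple t 1 2),
      rigidly_isotopic (normal_couple t m n) (normal_couple t 2 1) |
      rigidly_isotopic (normal_couple t m n) (normal_couple t 1 (-1))].
Proof.
move=> st; have pos m' n' : 0 < m' -> distinct_members t m' n' ->
  [\/ rigidly_isotopic (normal_couple t m' n') (normal_couple t 1 2),
      rigidly_isotopic (normal_couple t m' n') (normal_couple t 2 1) |
      rigidly_isotopic (normal_couple t m' n') (normal_couple t 1 (-1))].
  move=> m0 [mn _]; rewrite member_disc_signed// neq_lt => /orP[n0|n0].
    by constructor 3; apply: move_signed => //; rewrite n0 ltrN10 !orbT.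
  move: mn; rewrite neq_lt => /orP[mn|nm].
    by constructor 1; apply: move_signed => //; rewrite m0 mn ltr01 ltr1n.
  by constructor 2; apply: move_signed => //; rewrite n0 nm ltr01 ltr1n !orbT.
move=> mn; have [_ dm _] := mn; move: dm; rewrite member_disc_signed// neq_lt => /orP[m0|m0]; last exact: pos.
have ft : flip_type t by move: st; case: (t).
have F := normal_couple_flip ft mn.
have mn' : distinct_members t (- m) (- n).
  move: mn => [mn dm dn]; split; rewrite ?member_disc_signed// in dm dn *.
  - by rewrite eqr_opp.
  - by rewrite oppr_eq0.
  - by rewrite oppr_eq0.
have m0' : 0 < - m by rewrite oppr_gt0.
by case: (pos _ _ m0' mn') => H; [constructor 1|constructor 2|constructor 3];
  exact: rigidly_isotopic_trans F H.
Qed.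

(** Types IIIa and Ia have no real base point, and only there does non-emptiness restrict the
    parameters. *)
Lemma has_zero_IIIa m : m != 0 -> has_zero (member Type_IIIa m) -> m < 0.
Proof.
move=> m0 [v v0]; rewrite (v3_eta v) /member q6Z q6D qform_evalE.
move: v0; rewrite {1}(v3_eta v) v3_neq0.
move: (v 0 (inord 0)) (v 0 (inord 1)) (v 0 (inord 2)) => x y z v0 E.
rewrite lt_neqAle m0 leNgt; apply/negP => mp.
have x2 := sqr_ge0 x; have y2 := sqr_ge0 y; have z2 := sqr_ge0 z.
have mz : 0 <= m * z ^+ 2 by rewrite mulr_ge0// ltW.
have /eqP : x ^+ 2 = 0 by lra.
have /eqP : y ^+ 2 = 0 by lra.
have /eqP : m * z ^+ 2 = 0 by lra.
rewrite (mulf_eq0 m) !sqrf_eq0 (negbTE m0) /= => /eqP z0 /eqP y0 /eqP x0.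
by move: v0; rewrite x0 y0 z0 eqxx.
Qed.

Lemma has_zero_Ia m : 4%:R - m ^+ 2 != 0 -> has_zero (member Type_Ia m) -> 2 < m \/ m < -2.
Proof.
move=> m0 [v v0]; rewrite (v3_eta v) /member q6Z q6D qform_evalE.
move: v0; rewrite {1}(v3_eta v) v3_neq0.
move: (v 0 (inord 0)) (v 0 (inord 1)) (v 0 (inord 2)) => x y z v0 E.
have [mp|mp] := ltP (m ^+ 2) 4%:R; last first.
  have mp' : 4%:R < m ^+ 2 by rewrite lt_neqAle mp eq_sym -subr_eq0 -oppr_eq0 opprB m0.
  by have [m1|m1] := ltP 0 m; [left|right]; nra.
exfalso; have z2 := sqr_ge0 z.
(* Completing the square in x shows that the member is definite when m^2 < 4. *)
have E' : (x + m / 2%:R * z) ^+ 2 + y ^+ 2 + (1 - m ^+ 2 / 4%:R) * z ^+ 2 = 0.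
  by rewrite -[RHS]E; field.
have x2 := sqr_ge0 (x + m / 2%:R * z); have y2 := sqr_ge0 y.
have c0 : 0 < 1 - m ^+ 2 / 4%:R by lra.
have mz : 0 <= (1 - m ^+ 2 / 4%:R) * z ^+ 2 by rewrite mulr_ge0// ltW.
have /eqP : (1 - m ^+ 2 / 4%:R) * z ^+ 2 = 0 by lra.
have /eqP : y ^+ 2 = 0 by lra.
have /eqP : (x + m / 2%:R * z) ^+ 2 = 0 by lra.
rewrite (mulf_eq0 (1 - _)) !sqrf_eq0 (gt_eqF c0) /= => /eqP x0 /eqP y0 /eqP z0.
move: x0; rewrite z0 mulr0 addr0 => x0.
by move: v0; rewrite x0 y0 z0 eqxx.
Qed.

Lemma move_Ia m n (m' n' : R) : 2 < m -> 2 < m' ->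
  ((2 < n) && (2 < n') && ((m < n) && (m' < n') || (n < m) && (n' < m'))) || ((n < -2) && (n' < -2)) ->
  rigidly_isotopic (normal_couple Type_Ia m n) (normal_couple Type_Ia m' n').
Proof.
move=> m2 m'2 H; apply: normal_couple_move => s s01.
have big (x : R) : 2 < x \/ x < -2 -> 4%:R - x ^+ 2 != 0.
  by move=> [] h; apply/eqP => E; nra.
have M2 : 2 < mix s m m' by exact: mix_gtc.
case/orP: H => [/andP[/andP[a b] /orP[] /andP[c d]]|/andP[n2 n'2]].
- have MN : mix s m m' < mix s n n' by exact: mix_lt.
  split; [by rewrite lt_eqF|by apply: big; left|by apply: big; left; exact: mix_gtc].
- have MN : mix s n n' < mix s m m' by exact: mix_lt.
  split; [by rewrite gt_eqF|by apply: big; left|by apply: big; left; exact: mix_gtc].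
- have N2 : mix s n n' < -2 by exact: mix_ltc.
  split; [by rewrite gt_eqF//; lra|by apply: big; left|by apply: big; right].
Qed.

Lemma reduce_Ia m n : distinct_members Type_Ia m n -> (2 < m \/ m < -2) -> (2 < n \/ n < -2) ->
  represented (normal_couple Type_Ia m n).
Proof.
have pos m' n' : 2 < m' -> m' != n' -> (2 < n' \/ n' < -2) ->
    represented (normal_couple Type_Ia m' n').
  move=> m2 mn [n2|n2].
    move: mn; rewrite neq_lt => /orP[mn|nm].
      exists (normal_couple Type_Ia 3 4); first exact: (@param_mem 8 isT).
      by apply: move_Ia; rewrite ?m2 ?n2 ?mn//=; lra.
    exists (normal_couple Type_Ia 4 3); first exact: (@param_mem 14 isT).
    apply: move_Ia => //; first by lra.
    by apply/orP; left; rewrite n2 nm /=; apply/andP; split; [lra|apply/orP; right; lra].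
  exists (normal_couple Type_Ia 3 (- 3)); first exact: (@param_mem 2 isT).
  apply: move_Ia => //; first by lra.
  by apply/orP; right; rewrite n2 /=; lra.
move=> mn [m2|m2] hn; first by apply: pos => //; have [] := mn.
apply: (represented_trans (@normal_couple_flip _ Type_Ia m n isT mn)).
apply: pos; first by lra.
  by rewrite eqr_opp; have [] := mn.
by case: hn => hn; [right|left]; lra.
Qed.

Lemma move_free t m n (m' n' : R) : (forall x : R, member_disc t x != 0) ->
  ((m < n) && (m' < n')) || ((n < m) && (n' < m')) ->
  rigidly_isotopic (normal_couple t m n) (normal_couple t m' n').
Proof.
move=> free H; apply: normal_couple_move => s s01; split=> //.
case/orP: H => /andP[a b]; first by rewrite lt_eqF// mix_lt.
by rewrite gt_eqF// mix_lt.
Qed.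

Lemma reduce_IIIa m n : distinct_members Type_IIIa m n -> m < 0 -> n < 0 ->
  represented (normal_couple Type_IIIa m n).
Proof.
move=> [mn _ _] m0 n0.
have mv m' n' : m' < 0 -> n' < 0 -> (m < n) && (m' < n') || (n < m) && (n' < m') ->
    rigidly_isotopic (normal_couple Type_IIIa m n) (normal_couple Type_IIIa m' n').
  move=> m'0 n'0 H; apply: normal_couple_move => s s01.
  have M0 : mix s m m' < 0 by exact: mix_ltc.
  have N0 : mix s n n' < 0 by exact: mix_ltc.
  split; first case/orP: H => /andP[a b].
  - by rewrite lt_eqF// mix_lt.
  - by rewrite gt_eqF// mix_lt.
  - by rewrite /= mulf_neq0 ?pnatr_eq0// lt_eqF.
  - by rewrite /= mulf_neq0 ?pnatr_eq0// lt_eqF.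
move: mn; rewrite neq_lt => /orP[mn|nm].
  exists (normal_couple Type_IIIa (- 2) (-1)); first exact: (@param_mem 18 isT).
  apply: mv; [lra|lra|apply/orP; left; rewrite mn /=; lra].
exists (normal_couple Type_IIIa (-1) (- 2)); first exact: (@param_mem 12 isT).
apply: mv; [lra|lra|apply/orP; right; rewrite nm /=; lra].
Qed.

Lemma move_I m n (m' n' : R) : 0 < m < 1 -> 0 < m' < 1 ->
  ((0 < n < m) && (0 < n' < m')) || ((1 < n) && (1 < n')) ->
  rigidly_isotopic (normal_couple Type_I m n) (normal_couple Type_I m' n').
Proof.
move=> /andP[m0 m1] /andP[m'0 m'1] H; apply: normal_couple_move => s s01.
have M0 : 0 < mix s m m' by exact: mix_gtc.
have M1 : mix s m m' < 1 by exact: mix_ltc.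
have d (x : R) : 0 < x -> x != 1 -> 4%:R * x * (1 - x) != 0.
  move=> x0 x1; apply: mulf_neq0; last by rewrite subr_eq0 eq_sym.
  by apply: mulf_neq0; [rewrite pnatr_eq0|rewrite gt_eqF].
case/orP: H => /andP[].
  move=> /andP[a b] /andP[a' b'].
  have N0 : 0 < mix s n n' by exact: mix_gtc.
  have NM : mix s n n' < mix s m m' by exact: mix_lt.
  split; [by rewrite gt_eqF|by apply: d => //; rewrite lt_eqF|].
  by apply: d => //; rewrite lt_eqF//; lra.
move=> n1 n'1; have N1 : 1 < mix s n n' by exact: mix_gtc.
split; [by rewrite lt_eqF//; lra|by apply: d => //; rewrite lt_eqF|].
by apply: d; [lra|rewrite gt_eqF].
Qed.

(** Exchanging y and z swaps the degenerate members m = 0 and m = 1 and fixes m = infinity. *)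
Lemma flip_I m n : distinct_members Type_I m n ->
  rigidly_isotopic (normal_couple Type_I m n) (normal_couple Type_I (1 - m) (1 - n)).
Proof.
move=> mn; apply: (@normal_couple_act _ _ _ _ (m3 (v3 1 0 0) (v3 0 0 1) (v3 0 1 0)) 1 1) => //.
- by rewrite unitmxE unitfE det_m3 /det3; apply/eqP => E; lra.
- by rewrite /member !q6Z !q6D q6Z act_m3 !formsE; congr q6; ring.
- by rewrite /member !q6Z !q6D q6Z act_m3 !formsE; congr q6; ring.
Qed.

(** Exchanging x and y swaps m = 0 and m = infinity and fixes m = 1; with [flip_I] this generates
    all permutations of the three degenerate members. *)
Lemma inv_I m n : distinct_members Type_I m n -> m != 0 -> n != 0 ->
  rigidly_isotopic (normal_couple Type_I m n) (normal_couple Type_I m^-1 n^-1).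
Proof.
move=> mn m0 n0.
apply: (@normal_couple_act _ _ _ _ (m3 (v3 0 1 0) (v3 1 0 0) (v3 0 0 1)) (- m) (- n)); rewrite ?oppr_eq0//.
- by rewrite unitmxE unitfE det_m3 /det3; apply/eqP => E; lra.
- by rewrite /member !q6Z !q6D q6Z act_m3 !formsE; congr q6; try ring; field.
- by rewrite /member !q6Z !q6D q6Z act_m3 !formsE; congr q6; try ring; field.
Qed.

Lemma distinct_I m n : distinct_members Type_I m n <-> [/\ m != n, m != 0, m != 1, n != 0 & n != 1].
Proof.
have E (x : R) : (4%:R * x * (1 - x) != 0) = (x != 0) && (x != 1).
  by rewrite !mulf_eq0 pnatr_eq0 /= negb_or subr_eq0 [1 == x]eq_sym.
rewrite /distinct_members /= !E; split=> [[mn /andP[? ?] /andP[? ?]]|[? ? ? ? ?]]; first by split.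
by split=> //; apply/andP.
Qed.

(** The degenerate members cut the pencil into three arcs, and m can be brought into (0, 1).
    [flip_I] reverses that arc and exchanges the two others, so all that matters is whether n lies
    in the same arc as m. *)
Lemma reduce_I m n : distinct_members Type_I m n -> represented (normal_couple Type_I m n).
Proof.
have IN m' n' : 0 < n' -> n' < m' -> m' < 1 -> represented (normal_couple Type_I m' n').
  move=> n0 nm m1; exists (normal_couple Type_I (2 / 3) (1 / 3)); first exact: (@param_mem 0 isT).
  by apply: move_I; [|lra|apply/orP; left]; apply/andP; split; lra.
have IS m' n' : 0 < m' -> m' < 1 -> 1 < n' -> represented (normal_couple Type_I m' n').
  move=> m0 m1 n1; exists (normal_couple Type_I (2 / 3) 2); first exact: (@param_mem 1 isT).
  by apply: move_I; [|lra|apply/orP; right]; apply/andP; split; lra.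
have unit m' n' : 0 < m' -> m' < 1 -> distinct_members Type_I m' n' ->
    represented (normal_couple Type_I m' n').
  move=> m0 m1 mn; have [neq _ _ n0 n1] := (distinct_I m' n').1 mn.
  have [n1'|n1'] := ltP 1 n'; first exact: IS.
  have {}n1 : n' < 1 by rewrite lt_neqAle n1.
  have [n0'|n0'] := ltP n' 0.
    by apply: (represented_trans (flip_I mn)); apply: IS; lra.
  have {n0'}n0 : 0 < n' by rewrite lt_neqAle eq_sym n0.
  move: neq; rewrite neq_lt => /orP[lt|lt]; last exact: IN.
  by apply: (represented_trans (flip_I mn)); apply: IN; lra.
have gt1 m' n' : 1 < m' -> distinct_members Type_I m' n' -> represented (normal_couple Type_I m' n').
  move=> m1 mn; have [neq m0 m1' n0 n1] := (distinct_I m' n').1 mn.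
  apply: (represented_trans (inv_I mn m0 n0)).
  have mp : 0 < m' by lra.
  apply: unit; [by rewrite invr_gt0|by rewrite invf_lt1|].
  apply/distinct_I; split; rewrite ?invr_eq0 ?invr_eq1//.
  by apply: contra_neq neq => /invr_inj.
move=> mn; have [neq m0 m1 n0 n1] := (distinct_I m n).1 mn.
have [m1'|m1'] := ltP 1 m; first exact: gt1.
have {}m1 : m < 1 by rewrite lt_neqAle m1.
have [m0'|m0'] := ltP m 0; last by apply: unit => //; rewrite lt_neqAle eq_sym m0.
apply: (represented_trans (flip_I mn)); apply: gt1; first by lra.
apply/distinct_I; split; apply/eqP => E.
- by move/eqP: neq; apply; lra.
- by lra.
- by lra.
- by move/eqP: n1; apply; lra.
- by move/eqP: n0; apply; lra.
Qed.

Lemma normal_couple_represented t m n : distinct_members t m n ->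
  has_zero (member t m) -> has_zero (member t n) -> represented (normal_couple t m n).
Proof.
have free_Ib (x : R) : member_disc Type_Ib x != 0.
  by rewrite /= oppr_eq0 gt_eqF//; have := sqr_ge0 x; lra.
have free_IV (x : R) : member_disc Type_IV x != 0 by rewrite /= oner_neq0.
have free_V (x : R) : member_disc Type_V x != 0 by rewrite /= oner_neq0.
case: t => mn zm zn.
- exact: reduce_I.
- have [_ dm dn] := mn.
  by apply: reduce_Ia => //; exact: has_zero_Ia.
- have [neq _ _] := mn; have mv (m' n' : R) : m' > n' -> represented (normal_couple Type_Ib m' n').
    move=> lt; exists (normal_couple Type_Ib 1 (-1)); first exact: (@param_mem 3 isT).
    by apply: move_free => //; apply/orP; right; rewrite lt /=; lra.
  move: neq; rewrite neq_lt => /orP[lt|]; last exact: mv.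
  by apply: (represented_trans (@normal_couple_flip _ Type_Ib m n isT mn)); apply: mv; rewrite ltrN2.
- have [H|H|H] := @reduce_signed Type_II m n isT mn.
  + by exists (normal_couple Type_II 1 2) => //; exact: (@param_mem 9 isT).
  + by exists (normal_couple Type_II 2 1) => //; exact: (@param_mem 15 isT).
  + by exists (normal_couple Type_II 1 (-1)) => //; exact: (@param_mem 4 isT).
- have [H|H|H] := @reduce_signed Type_IIa m n isT mn.
  + by exists (normal_couple Type_IIa 1 2) => //; exact: (@param_mem 10 isT).
  + by exists (normal_couple Type_IIa 2 1) => //; exact: (@param_mem 16 isT).
  + by exists (normal_couple Type_IIa 1 (-1)) => //; exact: (@param_mem 5 isT).
- have [H|H|H] := @reduce_signed Type_III m n isT mn.
  + by exists (normal_couple Type_III 1 2) => //; exact: (@param_mem 11 isT).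
  + by exists (normal_couple Type_III 2 1) => //; exact: (@param_mem 17 isT).
  + by exists (normal_couple Type_III 1 (-1)) => //; exact: (@param_mem 6 isT).
- have [_ dm dn] := mn; have four : (4%:R : R) != 0 by rewrite pnatr_eq0.
  apply: reduce_IIIa => //; apply: has_zero_IIIa => //.
    by move: dm; rewrite /= mulf_eq0 negb_or => /andP[].
  by move: dn; rewrite /= mulf_eq0 negb_or => /andP[].
- have [neq _ _] := mn; have mv (m' n' : R) : m' > n' -> represented (normal_couple Type_IV m' n').
    move=> lt; exists (normal_couple Type_IV 1 (- 2)); first exact: (@param_mem 7 isT).
    by apply: move_free => //; apply/orP; right; rewrite lt /=; lra.
  move: neq; rewrite neq_lt => /orP[lt|]; last exact: mv.
  by apply: (represented_trans (@normal_couple_flip _ Type_IV m n isT mn)); apply: mv; rewrite ltrN2.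
- have [neq _ _] := mn; move: neq; rewrite neq_lt => /orP[lt|lt].
    exists (normal_couple Type_V (-1) 1); first exact: (@param_mem 13 isT).
    by apply: move_free => //; apply/orP; left; rewrite lt /=; lra.
  exists (normal_couple Type_V 1 (-1)); first exact: (@param_mem 19 isT).
  by apply: move_free => //; apply/orP; right; rewrite lt /=; lra.
Qed.

Lemma proper_nonempty_represented c : proper_nonempty_couple c -> represented c.
Proof.
move=> [pc n1 n2]; have [t [m [n [mn H z1 z2]]]] := normal_couple_isotopic pc.
apply: (represented_trans H); apply: normal_couple_represented => //; [exact: z1|exact: z2].
Qed.

End Reduction.

(** * Position of a couple in its pencil *)

Section Continuity.
Variables (R : realType) (T : topologicalType).
Implicit Types u v : T -> R.

Definition cont u := continuous u.

Lemma contD u v : cont u -> cont v -> cont (fun p => u p + v p).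
Proof. by move=> uc vc p; exact: (continuousD (uc p) (vc p)). Qed.
Lemma contN u : cont u -> cont (fun p => - u p).
Proof. by move=> uc p; exact: (continuousN (uc p)). Qed.
Lemma contM u v : cont u -> cont v -> cont (fun p => u p * v p).
Proof. by move=> uc vc p; exact: (continuousM (uc p) (vc p)). Qed.
Lemma contC (c : R) : cont (fun _ : T => c).
Proof. exact: cst_continuous. Qed.
Lemma contX u k : cont u -> cont (fun p => u p ^+ k).
Proof.
move=> uc; elim: k => [|k IH].
  by under eq_fun do rewrite expr0; exact: contC.
by under eq_fun do rewrite exprS; exact: contM.
Qed.

Lemma open_pos u : cont u -> open [set p | 0 < u p].
Proof. by move=> /continuousP uc; exact: uc (@open_gt R 0). Qed.

Lemma open_neg u : cont u -> open [set p | u p < 0].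
Proof. by move=> /continuousP uc; exact: uc (@open_lt R 0). Qed.

Definition contF (h : T -> 'rV[R]_6) := forall i, cont (fun p => h p 0 i).
End Continuity.

Ltac split_cont := repeat lazymatch goal with
  | |- cont (fun p => @?a p + @?b p) => apply: (contD (u := a) (v := b))
  | |- cont (fun p => - @?a p) => apply: (contN (u := a))
  | |- cont (fun p => @?a p * @?b p) => apply: (contM (u := a) (v := b))
  | |- cont (fun p => @?a p ^+ ?k) => apply: (@contX _ _ a k)
  end.
Ltac prove_cont := split_cont;
  first [exact: contC | match goal with H : contF _ |- _ => exact (H _) end].

(** * Continuity of the invariants, definite and indefinite forms *)

Section FormsContinuity.
Variable R : realType.
Implicit Types (f g q : 'rV[R]_6) (M N : 'M[R]_3) (t : pencil_type) (m n : R).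
Local Notation forms2 := ('rV[R]_6 * 'rV[R]_6)%type.

Let two : (2%:R : R) != 0. Proof. by rewrite pnatr_eq0. Qed.

(** Polarisation: continuity and the transformation rule of [disc_diff] are inherited from
    [disc]. *)
Lemma disc_diffE f g : disc_diff f g =
  2^-1 * (disc (1 *: f + 1 *: g) + disc (-1 *: f + 1 *: g)) - disc g.
Proof. by rewrite !disc_pencil; field. Qed.

Section ContinuousForms.
Variable T : topologicalType.
Implicit Types (h k : T -> 'rV[R]_6).

Lemma cont_disc h : contF h -> cont (fun p => disc (h p)).
Proof. by move=> hc; rewrite /disc; prove_cont. Qed.

Lemma contF_comb h k (a b : R) : contF h -> contF k -> contF (fun p => a *: h p + b *: k p).
Proof. by move=> hc kc i; rewrite (_ : (fun p => _) = (fun p => a * h p 0 i + b * k p 0 i));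
  [prove_cont|by apply/funext => p; rewrite !mxE]. Qed.

Lemma contFZ h (a : R) : contF h -> contF (fun p => a *: h p).
Proof. by move=> hc i; rewrite (_ : (fun p => _) = (fun p => a * h p 0 i));
  [prove_cont|by apply/funext => p; rewrite !mxE]. Qed.
Lemma cont_disc_diff h k : contF h -> contF k -> cont (fun p => disc_diff (h p) (k p)).
Proof.
move=> hc kc; rewrite (_ : (fun p => _) = (fun p => 2^-1 * (disc (1 *: h p + 1 *: k p)
    + disc (-1 *: h p + 1 *: k p)) + - disc (k p))).
  by split_cont; try exact: contC; apply: cont_disc => //; exact: contF_comb.
by apply/funext => p; rewrite disc_diffE.
Qed.

Lemma cont_qform h (v : 'rV[R]_3) : contF h -> cont (fun p => qform_eval (h p) v).
Proof. by move=> hc; rewrite /qform_eval; cbv beta zeta; prove_cont. Qed.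

End ContinuousForms.

Lemma contF_fst : contF (fun p : forms2 => p.1).
Proof.
move=> i p; apply: (@continuous_comp _ _ _ (fun p : forms2 => p.1) (fun x : 'rV[R]_6 => x 0 i)).
  exact: cvg_fst.
exact: coord_continuous.
Qed.

Lemma contF_snd : contF (fun p : forms2 => p.2).
Proof.
move=> i p; apply: (@continuous_comp _ _ _ (fun p : forms2 => p.2) (fun x : 'rV[R]_6 => x 0 i)).
  exact: cvg_snd.
exact: coord_continuous.
Qed.

Definition posdef q := forall v, v != 0 -> 0 < qform_eval q v.

(** Four times the second leading minor in Sylvester's criterion. *)
Definition minor2 q := 4%:R * q 0 (inord 0) * q 0 (inord 1) - q 0 (inord 5) ^+ 2.

Lemma posdefP q : posdef q <-> [/\ 0 < q 0 (inord 0), 0 < minor2 q & 0 < disc q].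
Proof.
rewrite (q6_eta q); move: (q 0 (inord 0)) (q 0 (inord 1)) (q 0 (inord 2))
  (q 0 (inord 3)) (q 0 (inord 4)) (q 0 (inord 5)) => a b c d e h.
rewrite /minor2 !q6E discE; split=> [pd|[a0 m0 D0] v].
  have a0 : 0 < a.
    have := pd (v3 1 0 0); rewrite v3_neq0 oner_neq0 /= => /(_ isT).
    by rewrite (_ : qform_eval _ _ = a)// qform_evalE; ring.
  have m0 : 0 < 4%:R * a * b - h ^+ 2.
    have := pd (v3 (- h) (2%:R * a) 0); rewrite v3_neq0 (mulf_neq0 two (lt0r_neq0 a0)) /= orbT => /(_ isT).
    rewrite (_ : qform_eval _ _ = a * (4%:R * a * b - h ^+ 2)); last by rewrite qform_evalE; ring.
    by rewrite pmulr_rgt0.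
  split=> //; set m := 4%:R * a * b - h ^+ 2 in m0.
  (* This row of cofactors of the Gram matrix is polar to the first two basis vectors. *)
  have := pd (v3 (h * d - 2%:R * b * e) (h * e - 2%:R * a * d) m).
  rewrite v3_neq0 (gt_eqF m0) /= !orbT => /(_ isT).
  rewrite (_ : qform_eval _ _ =
      m * (4%:R * a * b * c + d * e * h - a * d ^+ 2 - b * e ^+ 2 - c * h ^+ 2));
    last by rewrite qform_evalE /m; ring.
  by rewrite pmulr_rgt0.
rewrite (v3_eta v) v3_neq0; move: (v 0 (inord 0)) (v 0 (inord 1)) (v 0 (inord 2)) => x y z v0.
rewrite qform_evalE; set Q := _ + _.
set m := 4%:R * a * b - h ^+ 2 in m0; set D := _ - _ in D0.
(* Lagrange's reduction to a sum of squares, cleared of denominators. *)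
have E : 4%:R * a * m * Q = m * (2%:R * a * x + h * y + e * z) ^+ 2
    + (m * y + (2%:R * a * d - e * h) * z) ^+ 2 + 4%:R * a * D * z ^+ 2.
  by rewrite /m /Q /D; ring.
have am : 0 < 4%:R * a * m by rewrite !mulr_gt0.
rewrite -(pmulr_rgt0 _ am) E; have aD : 0 < 4%:R * a * D by rewrite !mulr_gt0.
have s1 := sqr_ge0 (2%:R * a * x + h * y + e * z).
have s2 := sqr_ge0 (m * y + (2%:R * a * d - e * h) * z).
have t1 : 0 <= m * (2%:R * a * x + h * y + e * z) ^+ 2 by rewrite mulr_ge0// ltW.
have t3 : 0 <= 4%:R * a * D * z ^+ 2 by rewrite mulr_ge0 ?sqr_ge0// ltW.
rewrite lt_neqAle !addr_ge0// andbT; apply/eqP => /esym E0.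
have /eqP : m * (2%:R * a * x + h * y + e * z) ^+ 2 = 0 by lra.
have /eqP : (m * y + (2%:R * a * d - e * h) * z) ^+ 2 = 0 by lra.
have /eqP : 4%:R * a * D * z ^+ 2 = 0 by lra.
rewrite (mulf_eq0 (_ * D)) (mulf_eq0 m) (gt_eqF aD) (gt_eqF m0) /= !sqrf_eq0 => /eqP z0.
rewrite z0 !mulr0 !addr0 mulf_eq0 (gt_eqF m0) /= => /eqP y0.
rewrite y0 !mulr0 !addr0 !mulf_eq0 (negbTE two) (gt_eqF a0) /= => /eqP x0.
by move: v0; rewrite x0 y0 z0 eqxx.
Qed.

(** Sylvester's criterion replaces positivity on all vectors by three strict inequalities. *)
Lemma open_posdef (T : topologicalType) (h : T -> 'rV[R]_6) :
  contF h -> open [set p | posdef (h p)].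
Proof.
move=> hc.
have -> : [set p | posdef (h p)] = [set p | 0 < h p 0 (inord 0)] `&`
    ([set p | 0 < minor2 (h p)] `&` [set p | 0 < disc (h p)]).
  apply/seteqP; split=> p /=; first by move=> /posdefP[].
  by move=> [? [? ?]]; apply/posdefP.
apply: openI; first by apply: open_pos; exact: hc.
apply: openI; last by apply: open_pos; exact: cont_disc.
by apply: open_pos; rewrite /minor2; prove_cont.
Qed.

Definition indefinite f := exists v w, 0 < qform_eval f v /\ qform_eval f w < 0.
Definition definite f := posdef f \/ posdef (-1 *: f).

Lemma open_indefinite (T : topologicalType) (h : T -> 'rV[R]_6) :
  contF h -> open [set p | indefinite (h p)].
Proof.
move=> hc; have -> : [set p | indefinite (h p)] = \bigcup_(vw in [set: 'rV[R]_3 * 'rV[R]_3])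
    ([set p | 0 < qform_eval (h p) vw.1] `&` [set p | qform_eval (h p) vw.2 < 0]).
  apply/seteqP; split=> p /=; first by move=> [v [w [? ?]]]; exists (v, w).
  by move=> [[v w] _ [? ?]]; exists v, w.
apply: bigcup_open => -[v w] _; apply: openI.
  by apply: open_pos; exact: cont_qform.
by apply: open_neg; exact: cont_qform.
Qed.

Lemma open_definite (T : topologicalType) (h : T -> 'rV[R]_6) :
  contF h -> open [set p | definite (h p)].
Proof.
move=> hc; apply: openU; first exact: open_posdef.
by apply: open_posdef; exact: contFZ.
Qed.

(** An isotropic vector of a semidefinite form lies in its kernel, so a nondegenerate form that is
    not indefinite is definite. *)
Lemma nondegenerate_definite f : disc f != 0 -> indefinite f \/ definite f.
Proof.
move=> /nondegenerateP nd.
have zero q : Defs.nondegenerate q -> (forall v, 0 <= qform_eval q v) -> posdef q.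
  move=> nq pos v v0; rewrite lt_neqAle pos andbT eq_sym; apply/eqP => qv.
  move/eqP: v0; apply; apply: nq => w.
  have P s : 0 <= s * polar_form q v w + s ^+ 2 * qform_eval q w.
    have := pos (v + s *: w).
    have -> : qform_eval q (v + s *: w) = qform_eval q v + s * polar_form q v w
        + s ^+ 2 * qform_eval q w.
      by rewrite polar_formE /qform_eval !mxE; ring.
    by rewrite qv add0r.
  set p := polar_form q v w in P *; set r := qform_eval q w in P *.
  have r0 : 0 <= r by exact: pos.
  have rp : 0 < 1 + r by lra.
  (* The minimum over s would be at -p / (2 r); the denominator 1 + r is nonzero even for r = 0, and
     the value obtained is minus a square. *)
  have := P (- p / (1 + r)).
  have -> : - p / (1 + r) * p + (- p / (1 + r)) ^+ 2 * r = - (p / (1 + r)) ^+ 2.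
    by field; rewrite gt_eqF.
  rewrite oppr_ge0 => h; have /eqP : (p / (1 + r)) ^+ 2 = 0.
    by apply/le_anti; rewrite h sqr_ge0.
  by rewrite sqrf_eq0 mulf_eq0 invr_eq0 (gt_eqF rp) orbF => /eqP.
have [[v fv]|npos] := pselect (exists v, 0 < qform_eval f v).
  have [[w fw]|nneg] := pselect (exists w, qform_eval f w < 0).
    by left; exists v, w.
  right; left; apply: zero => // w; rewrite leNgt; apply/negP => fw.
  by apply: nneg; exists w.
right; right; apply: zero => [v H|w].
  apply: nd => w; have := H w; rewrite !polar_formE !mxE => E.
  by apply: (@mulfI _ (-1)); rewrite ?oppr_eq0 ?oner_neq0// mulr0 -[RHS]E; ring.
rewrite qform_evalZ mulN1r oppr_ge0 leNgt; apply/negP => fw.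
by apply: npos; exists w.
Qed.

Lemma definite_no_zero f : definite f -> ~ has_zero f.
Proof.
move=> [] pd [v v0 fv]; have := pd v v0; rewrite ?qform_evalZ fv ?mulr0 ltxx //.
Qed.

(** On the line v + r w the form is quadratic in r with positive constant term and negative leading
    coefficient, so it has a real root. *)
Lemma indefinite_has_zero f : indefinite f -> has_zero f.
Proof.
move=> [v [w [fv fw]]]; pose a := qform_eval f w; pose b := polar_form f v w.
pose c := qform_eval f v; pose s := Num.sqrt (b ^+ 2 - 4%:R * a * c).
have D : 0 <= b ^+ 2 - 4%:R * a * c.
  have : 0 <= b ^+ 2 by exact: sqr_ge0.
  have : 0 < - a * c by rewrite mulr_gt0// oppr_gt0.
  by lra.
have s2 : s ^+ 2 = b ^+ 2 - 4%:R * a * c by rewrite sqr_sqrtr.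
have a0 : a != 0 by rewrite lt_eqF.
pose r := (- b + s) / (2%:R * a).
have E : qform_eval f (v + r *: w) = c + r * b + r ^+ 2 * a.
  by rewrite /b /c /a polar_formE /qform_eval !mxE; ring.
exists (v + r *: w).
  apply/eqP => vr; have vE : v = (- r) *: w by apply/eqP; rewrite -subr_eq0 scaleNr opprK vr.
  have := fv; rewrite vE qform_eval_scale sqrrN ltNge.
  by rewrite mulr_ge0_le0 ?sqr_ge0// ltW.
rewrite E; transitivity ((s ^+ 2 - (b ^+ 2 - 4%:R * a * c)) / (4%:R * a)).
  by rewrite /r; field; rewrite a0.
by rewrite s2 subrr mul0r.
Qed.

End FormsContinuity.

(** * Open invariants of a pair of forms *)

Section LabelSets.
Variable R : realType.
Implicit Types (f g q : 'rV[R]_6) (M N : 'M[R]_3) (t : pencil_type) (m n k l : R) (i j : nat).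
Local Notation forms2 := ('rV[R]_6 * 'rV[R]_6)%type.

(* Write disc (s f + t g) = p3 s^3 + p2 s^2 t + p1 s t^2 + p0 t^3, so that
   p3 = disc f, p2 = disc_diff f g, p1 = disc_diff g f and p0 = disc g. The
   conditions below are invariant under rescaling f and g. *)
Definition nested f g :=
  0 < disc_diff f g * disc g /\ 0 < disc_diff g f * disc f.

(** When the cubic has only real nonzero roots, [nested] says that they all have the same sign, so
    that the degenerate members lie in one of the two arcs cut out by f and g, and [crossing] says
    that both arcs contain some. *)
Definition crossing f g :=
  disc_diff f g * disc g < 0 \/ disc_diff g f * disc f < 0.

(* The first factor is 27 p3^2 times the value of the cubic at its inflection
   point: for a double root it tells on which side the simple root lies. *)
Definition pencil_hess f g :=
  (2%:R * disc_diff f g ^+ 3 - 9%:R * disc f * disc_diff f g * disc_diff g f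
   + 27%:R * disc f ^+ 2 * disc g) * disc g.

(* For a triple root, 3 p3 g - p2 f is the degenerate member of the pencil, a
   double line, hence semidefinite. *)
Definition line_sign f g (v : 'rV[R]_3) :=
  disc f * disc g * (3%:R * disc f * qform_eval g v - disc_diff f g * qform_eval f v).

(* In type Ia the members of the pencil that are definite form an interval of
   the real projective line, and the label is its position relative to f and g. *)
Definition label_set t i : set forms2 :=
  match t, i with
  | Type_I, 0 => [set p | nested p.1 p.2]
  | Type_I, 2 => [set p | crossing p.1 p.2]
  | (Type_II | Type_IIa | Type_III | Type_IIIa), 0 =>
      [set p | nested p.1 p.2 /\ 0 < pencil_hess p.1 p.2]
  | (Type_II | Type_IIa | Type_III | Type_IIIa), 1 =>
      [set p | nested p.1 p.2 /\ pencil_hess p.1 p.2 < 0]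
  | (Type_II | Type_IIa | Type_III | Type_IIIa), 2 => [set p | crossing p.1 p.2]
  | Type_Ia, 0 => [set p | exists a b, [/\ posdef (a *: p.1 + b *: p.2),
      a * disc p.1 < 0 & 0 < b * disc p.2]]
  | Type_Ia, 1 => [set p | exists a b, [/\ posdef (a *: p.1 + b *: p.2),
      0 < a * disc p.1 & b * disc p.2 < 0]]
  | Type_Ia, 2 => [set p | exists a b, [/\ posdef (a *: p.1 + b *: p.2),
      a * disc p.1 < 0 & b * disc p.2 < 0]]
  | Type_V, 0 => [set p | exists v, 0 < line_sign p.1 p.2 v]
  | Type_V, 1 => [set p | exists v, line_sign p.1 p.2 v < 0]
  | (Type_Ib | Type_IV), 0 => setT
  | _, _ => set0
  end.

Let fst_c := @contF_fst R.
Let snd_c := @contF_snd R.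
Let p3c : cont (fun p : forms2 => disc p.1). Proof. exact: cont_disc. Qed.
Let p0c : cont (fun p : forms2 => disc p.2). Proof. exact: cont_disc. Qed.
Let p2c : cont (fun p : forms2 => disc_diff p.1 p.2). Proof. exact: cont_disc_diff. Qed.
Let p1c : cont (fun p : forms2 => disc_diff p.2 p.1). Proof. exact: cont_disc_diff. Qed.
Ltac cont_label := split_cont; first [exact: contC | exact: p3c | exact: p0c
  | exact: p2c | exact: p1c | by apply: cont_qform; exact: fst_c | by apply: cont_qform; exact: snd_c].

Lemma open_nested : open [set p : forms2 | nested p.1 p.2].
Proof. by apply: openI; apply: open_pos; cont_label. Qed.

Lemma open_crossing : open [set p : forms2 | crossing p.1 p.2].
Proof. by apply: openU; apply: open_neg; cont_label. Qed.

Lemma cont_pencil_hess : cont (fun p : forms2 => pencil_hess p.1 p.2).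
Proof. by rewrite /pencil_hess; cont_label. Qed.

Lemma cont_line_sign v : cont (fun p : forms2 => line_sign p.1 p.2 v).
Proof. by rewrite /line_sign; cont_label. Qed.

Lemma open_label_set t i : open (label_set t i).
Proof.
have o0 : open (set0 : set forms2) by exact: open0.
have oT : open (setT : set forms2) by exact: openT.
have oN := open_nested; have oC := open_crossing.
have oNp : open [set p : forms2 | nested p.1 p.2 /\ 0 < pencil_hess p.1 p.2].
  by apply: openI => //; apply: open_pos; exact: cont_pencil_hess.
have oNn : open [set p : forms2 | nested p.1 p.2 /\ pencil_hess p.1 p.2 < 0].
  by apply: openI => //; apply: open_neg; exact: cont_pencil_hess.
have cut (A : set forms2) (P1 P2 : R -> forms2 -> Prop) :
    (forall a, open (P1 a)) -> (forall a, open (P2 a)) ->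
    A = [set p : forms2 | exists a b, [/\ posdef (a *: p.1 + b *: p.2), P1 a p & P2 b p]] -> open A.
  move=> o1 o2 ->; rewrite (_ : [set p | _] = \bigcup_(ab in [set: R * R])
    ([set p : forms2 | posdef (ab.1 *: p.1 + ab.2 *: p.2)] `&` (P1 ab.1 `&` P2 ab.2))).
    apply: bigcup_open => -[a b] _; apply: openI; last by apply: openI.
    by apply: open_posdef; exact: contF_comb.
  apply/seteqP; split=> p /=; first by move=> [a [b [? ? ?]]]; exists (a, b).
  by move=> [[a b] _ [? [? ?]]]; exists a, b.
have cutV (P : R -> Prop) : (forall v, open [set p : forms2 | P (line_sign p.1 p.2 v)]) ->
    open [set p : forms2 | exists v, P (line_sign p.1 p.2 v)].
  move=> oP; rewrite (_ : [set p | _] = \bigcup_(v in [set: 'rV[R]_3])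
    [set p : forms2 | P (line_sign p.1 p.2 v)]); first by apply: bigcup_open.
  by apply/seteqP; split=> p /=; [move=> [v ?]; exists v|move=> [v _ ?]; exists v].
have on1 (a : R) : open (fun p : forms2 => a * disc p.1 < 0) by apply: open_neg; cont_label.
have on2 (a : R) : open (fun p : forms2 => a * disc p.2 < 0) by apply: open_neg; cont_label.
have op1 (a : R) : open (fun p : forms2 => 0 < a * disc p.1) by apply: open_pos; cont_label.
have op2 (a : R) : open (fun p : forms2 => 0 < a * disc p.2) by apply: open_pos; cont_label.
have oV1 := cutV (fun x => 0 < x) (fun v => open_pos (@cont_line_sign v)).
have oV2 := cutV (fun x => x < 0) (fun v => open_neg (@cont_line_sign v)).
case: t; case: i => [|[|[|i]]] //=.
- exact: (cut _ _ _ on1 op2 (erefl _)).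
- exact: (cut _ _ _ op1 on2 (erefl _)).
- exact: (cut _ _ _ on1 on2 (erefl _)).
Qed.

Section Transform.
Variables (f g : 'rV[R]_6) (M : 'M[R]_3) (k l : R).
Hypotheses (k0 : k != 0) (l0 : l != 0) (Mu : M \in unitmx).
Let d := \det M.
Let F := k *: act M f.
Let G := l *: act M g.
Let two : (2%:R : R) != 0. Proof. by rewrite pnatr_eq0. Qed.

Let d0 : d != 0. Proof. by rewrite -unitfE -unitmxE. Qed.

Lemma disc_transform (h : 'rV[R]_6) (x : R) : disc (x *: act M h) = x ^+ 3 * d ^+ 2 * disc h.
Proof. by rewrite discZ disc_act// mulrA. Qed.

Lemma disc_diff_transform (h h' : 'rV[R]_6) (x y : R) :
  disc_diff (x *: act M h) (y *: act M h') = x ^+ 2 * y * d ^+ 2 * disc_diff h h'.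
Proof.
rewrite disc_diffE !scalerA -!actZ -!actD !disc_act// !disc_pencil !discZ -/d.
by field.
Qed.

Let pos4 (x : R) : x != 0 -> 0 < x ^+ 2.
Proof. by move=> x0; rewrite lt_neqAle eq_sym sqrf_eq0 x0 sqr_ge0. Qed.

Lemma posdef_act (h : 'rV[R]_6) : posdef h -> posdef (act M h).
Proof. by move=> H v v0; rewrite qform_eval_act; apply: H; exact: mulmx_unit_neq0. Qed.

(** Each tested quantity is multiplied by a nonzero square whatever the signs of [k], [l] and the
    determinant: this is why the labels descend to conics. The existential weights are divided by
    [k] and [l], and test vectors are moved by the inverse matrix. *)
Lemma label_transform t i : label_set t i (f, g) -> label_set t i (F, G).
Proof.
have c1 : 0 < (k * l ^+ 2 * d ^+ 2) ^+ 2 by rewrite pos4// !mulf_neq0// expf_neq0.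
have c2 : 0 < (k ^+ 2 * l * d ^+ 2) ^+ 2 by rewrite pos4// !mulf_neq0// expf_neq0.
have c3 : 0 < (k ^+ 3 * l ^+ 3 * d ^+ 4) ^+ 2 by rewrite pos4// !mulf_neq0// expf_neq0.
have c4 : 0 < (k ^+ 3 * l ^+ 2 * d ^+ 3) ^+ 2 by rewrite pos4// !mulf_neq0// expf_neq0.
have cd (x : R) : x != 0 -> 0 < (x * d) ^+ 2 by move=> x0; rewrite pos4// mulf_neq0.
have E1 : disc_diff F G * disc G = (k * l ^+ 2 * d ^+ 2) ^+ 2 * (disc_diff f g * disc g).
  by rewrite disc_diff_transform disc_transform; ring.
have E2 : disc_diff G F * disc F = (k ^+ 2 * l * d ^+ 2) ^+ 2 * (disc_diff g f * disc f).
  by rewrite disc_diff_transform disc_transform; ring.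
have E3 : pencil_hess F G = (k ^+ 3 * l ^+ 3 * d ^+ 4) ^+ 2 * pencil_hess f g.
  by rewrite /pencil_hess !disc_diff_transform !disc_transform; ring.
have E4 v : line_sign F G (v *m invmx M) = (k ^+ 3 * l ^+ 2 * d ^+ 3) ^+ 2 * line_sign f g v.
  rewrite /line_sign !disc_diff_transform !disc_transform !qform_evalZ !qform_eval_act mulmxKV//.
  by ring.
have nst : nested f g -> nested F G by rewrite /nested E1 E2 (pmulr_rgt0 _ c1) (pmulr_rgt0 _ c2).
have crs : crossing f g -> crossing F G by rewrite /crossing E1 E2 (pmulr_rlt0 _ c1) (pmulr_rlt0 _ c2).
have hp : (0 < pencil_hess F G) = (0 < pencil_hess f g) by rewrite E3 (pmulr_rgt0 _ c3).
have hn : (pencil_hess F G < 0) = (pencil_hess f g < 0) by rewrite E3 (pmulr_rlt0 _ c3).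
have aE (a x : R) (h : 'rV[R]_6) : x != 0 -> a / x * disc (x *: act M h) = (x * d) ^+ 2 * (a * disc h).
  by move=> x0; rewrite disc_transform; field.
have pE (a b : R) : posdef (a *: f + b *: g) -> posdef (a / k *: F + b / l *: G).
  by move=> /posdef_act; rewrite actD !actZ /F /G !scalerA !mulfVK.
case: t; case: i => [|[|[|i]]] //=;
  try (by move=> [/nst H1 H2]; split; rewrite ?hp ?hn); try (exact: nst); try (exact: crs).
- move=> [a [b [/pE p h1 h2]]]; exists (a / k), (b / l).
  by rewrite !aE// (pmulr_rlt0 _ (cd _ k0)) (pmulr_rgt0 _ (cd _ l0)).
- move=> [a [b [/pE p h1 h2]]]; exists (a / k), (b / l).
  by rewrite !aE// (pmulr_rgt0 _ (cd _ k0)) (pmulr_rlt0 _ (cd _ l0)).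
- move=> [a [b [/pE p h1 h2]]]; exists (a / k), (b / l).
  by rewrite !aE// (pmulr_rlt0 _ (cd _ k0)) (pmulr_rlt0 _ (cd _ l0)).
- by move=> [v H]; exists (v *m invmx M); rewrite E4 (pmulr_rgt0 _ c4).
- by move=> [v H]; exists (v *m invmx M); rewrite E4 (pmulr_rlt0 _ c4).
Qed.
End Transform.

Lemma label_transform_inv f g M k l t i : k != 0 -> l != 0 -> M \in unitmx ->
  label_set t i (k *: act M f, l *: act M g) -> label_set t i (f, g).
Proof.
move=> k0 l0 Mu H; have Vu : invmx M \in unitmx by rewrite unitmx_inv.
have := @label_transform _ _ (invmx M) k^-1 l^-1; rewrite !invr_eq0 => /(_ _ _ k0 l0 Vu _ _ H).
by rewrite !actZ !act_comp mulVmx// !act1 !scalerA !mulVf// !scale1r.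
Qed.

End LabelSets.

(** * Labels of couples in a normal pencil *)

Section MemberLabels.
Variable R : realType.
Implicit Types (f g q : 'rV[R]_6) (M N : 'M[R]_3) (t : pencil_type) (m n k l : R) (i j : nat)
  (c d : conic R * conic R).

Definition member_label t i m n := label_set t i (member t m, member t n).

Definition member_diff t m n : R :=
  match t with
  | Type_I => 4%:R * (m * (1 - m) + m + n - 2%:R * m * n)
  | Type_Ia => 12%:R - m ^+ 2 - 2%:R * m * n
  | Type_Ib => - (12%:R + m ^+ 2 + 2%:R * m * n)
  | Type_II | Type_IIa => - (m ^+ 2 + 2%:R * m * n)
  | Type_III => - (n + 2%:R * m)
  | Type_IIIa => 4%:R * (n + 2%:R * m)
  | Type_IV | Type_V => 3%:R
  end.

Lemma disc_diff_member t m n : disc_diff (member t m) (member t n) = member_diff t m n.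
Proof. by rewrite /member /disc_diff; case: t; rewrite !q6Z !q6D !q6E /=; ring. Qed.

(** Types whose degenerate members are m = 0 and m = infinity, one of them a double root. The sign
    of m n and, when it is positive, the order of |m| and |n| give the position. *)
Definition chain_type t :=
  match t with Type_II | Type_IIa | Type_III | Type_IIIa => true | _ => false end.

Lemma sqr_gt0_factors (x y : R) : x * y != 0 -> 0 < x ^+ 2 /\ 0 < y ^+ 2.
Proof. by rewrite mulf_eq0 negb_or !exprn_even_gt0//= => /andP[]. Qed.

Lemma nested_members t m n : chain_type t -> 0 < m * n -> nested (member t m) (member t n).
Proof.
move=> ct mn; have [m2 n2] := sqr_gt0_factors (lt0r_neq0 mn).
have h1 : 0 < (m * n) * n ^+ 2 by rewrite mulr_gt0.
have h2 : 0 < (m * n) * m ^+ 2 by rewrite mulr_gt0.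
have h3 : 0 < m ^+ 2 * n ^+ 2 by rewrite mulr_gt0.
by rewrite /nested !disc_diff_member !disc_member; case: t ct => //= _; split; lra.
Qed.

Lemma crossing_members t m n : chain_type t -> m * n < 0 -> crossing (member t m) (member t n).
Proof.
move=> ct mn; have [m2 n2] := sqr_gt0_factors (ltr0_neq0 mn).
have h3 : 0 < m ^+ 2 * n ^+ 2 by rewrite mulr_gt0.
(* If both failed, then h1 + 2 h2 would give 0 <= -3 m^2 n^2. *)
have H : n ^+ 2 + 2%:R * m * n < 0 \/ m ^+ 2 + 2%:R * m * n < 0.
  have [a|a] := ltP (n ^+ 2 + 2%:R * m * n) 0; first by left.
  have [b|b] := ltP (m ^+ 2 + 2%:R * m * n) 0; first by right.
  have h1 : 0 <= (n ^+ 2 + 2%:R * m * n) * m ^+ 2 by rewrite mulr_ge0// ltW.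
  have h2 : 0 <= - (m * n) * (m ^+ 2 + 2%:R * m * n) by rewrite mulr_ge0// oppr_ge0 ltW.
  by lra.
rewrite /crossing !disc_diff_member !disc_member; case: t ct => //= _;
  case: H => H; try (by [left; lra|right; lra]).
- by right; have : (n ^+ 2 + 2%:R * m * n) * m ^+ 2 < 0 by [rewrite pmulr_llt0]; lra.
- by left; have : (m ^+ 2 + 2%:R * m * n) * n ^+ 2 < 0 by [rewrite pmulr_llt0]; lra.
- by right; have : (n ^+ 2 + 2%:R * m * n) * m ^+ 2 < 0 by [rewrite pmulr_llt0]; lra.
- by left; have : (m ^+ 2 + 2%:R * m * n) * n ^+ 2 < 0 by [rewrite pmulr_llt0]; lra.
Qed.

(** For m n > 0 the sign compares |m| with |n|. The comparison is reversed between the first two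
    types and the others, because the double root is m = 0 in the former and m = infinity in the
    latter. *)
Lemma hess_members t m n : chain_type t -> pencil_hess (member t m) (member t n) =
  match t with
  | Type_II | Type_IIa => 2%:R * n ^+ 2 * (m * (m - n)) ^+ 3
  | Type_III => 2%:R * n * (n - m) ^+ 3
  | _ => 2%:R * (4%:R ^+ 4) * n * (n - m) ^+ 3
  end.
Proof.
by rewrite /pencil_hess !disc_diff_member !disc_member; case: t => //= _; ring.
Qed.

Lemma nested_crossing f g : nested f g -> crossing f g -> False.
Proof. by move=> [h1 h2] [] h; lra. Qed.

(** For a pair in type I the cubic is proportional to (s + t)(s + x t)(s + y t) with x = n / m and y
    = (1 - n) / (1 - m). The alternatives are e1 e3 < 0 and e2 < 0 for the elementary symmetric
    functions of 1, x, y. *)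
Lemma crossing_ratios (x y : R) : x != 0 -> y != 0 -> x < 0 \/ y < 0 ->
  x * y * (1 + x + y) < 0 \/ x * y + x + y < 0.
Proof.
have main (q r : R) : q < 0 -> r != 0 -> q * r * (1 + q + r) < 0 \/ q * r + q + r < 0.
  move=> q0; rewrite neq_lt => /orP[r0|r0].
    have qr : 0 < q * r by rewrite nmulr_rgt0.
    have [h|h] := ltP (1 + q + r) 0; first by left; rewrite pmulr_rlt0.
    have : q * (1 + r) < 0 by rewrite nmulr_rlt0//; lra.
    by right; lra.
  have [h|h] := ltP (q * r + q + r) 0; first by right.
  have qr : q * r < 0 by rewrite nmulr_rlt0.
  left; rewrite nmulr_rlt0// ltNge; apply/negP => h'.
  have : (1 + q + r) * (1 + r) <= 0 by rewrite mulr_le0_ge0//; lra.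
  by have := sqr_ge0 r; lra.
move=> x0 y0 [h|h]; first exact: main.
by case: (main y x h x0) => H; [left|right]; lra.
Qed.

Lemma nested_I m n : 0 < m * n -> 0 < (1 - m) * (1 - n) -> nested (member Type_I m) (member Type_I n).
Proof.
move=> h1 h2; have [m2 n2] := sqr_gt0_factors (lt0r_neq0 h1).
have [m1 n1] := sqr_gt0_factors (lt0r_neq0 h2).
have k1 : 0 < m ^+ 2 * ((1 - m) * (1 - n)) by rewrite mulr_gt0.
have k2 : 0 < n ^+ 2 * ((1 - m) * (1 - n)) by rewrite mulr_gt0.
have k3 : 0 < m * n * (1 - m) ^+ 2 by rewrite mulr_gt0.
have k4 : 0 < m * n * (1 - n) ^+ 2 by rewrite mulr_gt0.
have k5 : 0 < m * n * ((1 - m) * (1 - n)) by rewrite mulr_gt0.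
by rewrite /nested !disc_diff_member !disc_member /=; split; lra.
Qed.

Lemma crossing_I m n : distinct_members Type_I m n -> m * n < 0 \/ (1 - m) * (1 - n) < 0 ->
  crossing (member Type_I m) (member Type_I n).
Proof.
move=> /distinct_I[mn m0 m1 n0 n1] H.
have m1' : 1 - m != 0 by rewrite subr_eq0 eq_sym.
have n1' : 1 - n != 0 by rewrite subr_eq0 eq_sym.
have A : 0 < (4%:R * m * (1 - m)) ^+ 2 by rewrite exprn_even_gt0//= !mulf_neq0// pnatr_eq0.
have sg (x y : R) : x != 0 -> x * y < 0 -> y / x < 0.
  move=> x0 xy; rewrite (_ : y / x = x * y / x ^+ 2); last by field.
  by rewrite pmulr_llt0// invr_gt0 exprn_even_gt0.
have : n / m < 0 \/ (1 - n) / (1 - m) < 0 by case: H => H; [left|right]; exact: sg.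
case/(crossing_ratios (mulf_neq0 n0 (invr_neq0 m0)) (mulf_neq0 n1' (invr_neq0 m1'))) => h;
  rewrite -(pmulr_rlt0 _ A) in h; [left|right]; rewrite disc_diff_member disc_member /=;
  apply: le_lt_trans h; rewrite le_eqVlt; apply/orP; left; apply/eqP; field;
  by rewrite m0 m1'.
Qed.

(** The weights cancel xz and sum to 1, leaving the definite member m = 0. *)
Lemma combo_Ia m n : m != n ->
  n / (n - m) *: member Type_Ia m + m / (m - n) *: member Type_Ia n = q6 1 1 1 0 0 0.
Proof.
move=> mn; have h1 : m - n != 0 by rewrite subr_eq0.
have h2 : n - m != 0 by rewrite subr_eq0 eq_sym.
by rewrite /member /= !q6Z !q6D !q6Z !q6D; congr q6; field; rewrite h1 h2.
Qed.

Lemma posdef_combo_Ia m n : m != n ->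
  posdef (n / (n - m) *: member Type_Ia m + m / (m - n) *: member Type_Ia n).
Proof.
move=> mn; rewrite combo_Ia//; apply/posdefP; rewrite /minor2 discE !q6E; split; lra.
Qed.

Lemma line_sign_V m n v :
  line_sign (member Type_V m) (member Type_V n) v = 3%:R * (n - m) * v 0 (inord 0) ^+ 2.
Proof.
rewrite /line_sign disc_diff_member !disc_member /member /= !q6Z !q6D (v3_eta v) !qform_evalE v3E.
by ring.
Qed.

Lemma member_label_exists t m n : distinct_members t m n ->
  has_zero (member t m) -> has_zero (member t n) -> exists i, member_label t i m n.
Proof.
have chain t' m' n' : chain_type t' -> distinct_members t' m' n' -> m' != 0 -> n' != 0 ->
    exists i, member_label t' i m' n'.
  move=> ct [mn _ _] m0 n0.
  have : m' * n' != 0 by rewrite mulf_neq0.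
  rewrite neq_lt => /orP[neg|pos].
    by exists 2%N; have := crossing_members ct neg; case: t' ct.
  have N := nested_members ct pos.
  have : pencil_hess (member t' m') (member t' n') != 0.
    have two : (2%:R : R) != 0 by rewrite pnatr_eq0.
    have four : (4%:R : R) ^+ 4 != 0 by rewrite expf_neq0// pnatr_eq0.
    have n2 : n' ^+ 2 != 0 by rewrite sqrf_eq0.
    have d1 : (m' * (m' - n')) ^+ 3 != 0 by rewrite expf_neq0// mulf_neq0// subr_eq0.
    have d2 : (n' - m') ^+ 3 != 0 by rewrite expf_neq0// subr_eq0 eq_sym.
    rewrite hess_members//; case: (t') ct => // _.
    - exact: mulf_neq0 (mulf_neq0 two n2) d1.
    - exact: mulf_neq0 (mulf_neq0 two n2) d1.
    - exact: mulf_neq0 (mulf_neq0 two n0) d2.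
    - exact: mulf_neq0 (mulf_neq0 (mulf_neq0 two four) n0) d2.
  rewrite neq_lt => /orP[h|h]; [exists 1%N|exists 0%N]; case: t' ct N h => // _ N h;
    exact: (conj N h).
case: t => mn zm zn.
- have [neq m0 m1 n0 n1] := (distinct_I m n).1 mn.
  have [h1|h1] := ltP (m * n) 0; first by exists 2%N; apply: (crossing_I mn); left.
  have [h2|h2] := ltP ((1 - m) * (1 - n)) 0; first by exists 2%N; apply: (crossing_I mn); right.
  exists 0%N; apply: nested_I; rewrite lt_neqAle eq_sym ?h1 ?h2 andbT mulf_neq0//.
    by rewrite subr_eq0 eq_sym.
  by rewrite subr_eq0 eq_sym.
- have [neq dm dn] := mn; have hm := has_zero_Ia dm zm; have hn := has_zero_Ia dn zn.
  have pd := posdef_combo_Ia neq.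
  have neg (x : R) : 2 < x \/ x < -2 -> 4%:R - x ^+ 2 < 0 by move=> [] ?; nra.
  have dm' := neg _ hm; have dn' := neg _ hn.
  have h1 : m - n != 0 by rewrite subr_eq0.
  have h2 : n - m != 0 by rewrite subr_eq0 eq_sym.
  have a0 : n / (n - m) != 0 by rewrite mulf_neq0 ?invr_eq0//; apply/eqP => E; lra.
  have b0 : m / (m - n) != 0 by rewrite mulf_neq0 ?invr_eq0//; apply/eqP => E; lra.
  (* Weights of sum 1 are not both negative; the three remaining sign patterns are the three labels,
     both discriminants being negative. *)
  have ab : n / (n - m) + m / (m - n) = 1 by field; rewrite h1 h2.
  move: pd ab; set a := n / _ in a0 *; set b := m / _ in b0 * => pd ab.
  move: a0 b0; rewrite !neq_lt => /orP[a0|a0] /orP[b0|b0].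
  + by exfalso; lra.
  + exists 1%N; rewrite /member_label /=; exists a, b; rewrite !disc_member /=.
    by split=> //; [rewrite nmulr_rgt0|rewrite pmulr_rlt0].
  + exists 0%N; rewrite /member_label /=; exists a, b; rewrite !disc_member /=.
    by split=> //; [rewrite pmulr_rlt0|rewrite nmulr_rgt0].
  + exists 2%N; rewrite /member_label /=; exists a, b; rewrite !disc_member /=.
    by split=> //; [rewrite pmulr_rlt0|rewrite pmulr_rlt0].
- by exists 0%N.
- have [_ dm dn] := mn; apply: chain => //.
    by move: dm; rewrite /= oppr_eq0 sqrf_eq0.
  by move: dn; rewrite /= oppr_eq0 sqrf_eq0.
- have [_ dm dn] := mn; apply: chain => //.
    by move: dm; rewrite /= oppr_eq0 sqrf_eq0.
  by move: dn; rewrite /= oppr_eq0 sqrf_eq0.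
- have [_ dm dn] := mn; apply: chain => //.
    by move: dm; rewrite /= oppr_eq0.
  by move: dn; rewrite /= oppr_eq0.
- have [_ dm dn] := mn; apply: chain => //.
    by move: dm; rewrite /= mulf_eq0 negb_or => /andP[].
  by move: dn; rewrite /= mulf_eq0 negb_or => /andP[].
- by exists 0%N.
- have [] := mn; rewrite neq_lt => /orP[lt|lt] _ _; [exists 0%N|exists 1%N];
    by exists (v3 1 0 0); rewrite line_sign_V v3E; lra.
Qed.

(** At a real zero v of f the definite combination reduces to b g(v) > 0, so the sign of b does not
    depend on the combination; symmetrically for a. *)
Lemma cut_signs f g (a b a' b' : R) : has_zero f -> has_zero g ->
  posdef (a *: f + b *: g) -> posdef (a' *: f + b' *: g) -> 0 < a * a' /\ 0 < b * b'.
Proof.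
have main (p q : 'rV[R]_6) (x y x' y' : R) : has_zero p -> posdef (x *: p + y *: q) ->
    posdef (x' *: p + y' *: q) -> 0 < y * y'.
  move=> [v v0 pv] /(_ v v0) + /(_ v v0); rewrite !qform_evalD !qform_evalZ pv !mulr0 !add0r => h h'.
  have : 0 < (y * qform_eval q v) * (y' * qform_eval q v) by rewrite mulr_gt0.
  rewrite mulrACA -expr2 pmulr_lgt0// exprn_even_gt0//=.
  by apply: contraTneq h => ->; rewrite mulr0 ltxx.
move=> zf zg pd pd'; split; last exact: main zf pd pd'.
by rewrite addrC in pd; rewrite addrC in pd'; exact: main zg pd pd'.
Qed.

Lemma member_label_uniq t i j m n : has_zero (member t m) -> has_zero (member t n) ->
  member_label t i m n -> member_label t j m n -> i = j.
Proof.
move=> zm zn; rewrite /member_label.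
have dich f g : nested f g -> crossing f g -> False by exact: nested_crossing.
have cut (a b a' b' : R) : posdef (a *: member t m + b *: member t n) ->
    posdef (a' *: member t m + b' *: member t n) -> 0 < a * a' /\ 0 < b * b' by exact: cut_signs.
have sgn (a a' x : R) : 0 < a * a' -> a * x < 0 -> 0 < a' * x -> False.
  by move=> h h1 h2; have := mulr_gt0 h2 h; have : a' * x * (a * a') = a' ^+ 2 * (a * x) by [ring]; move=> ->;
    rewrite ltNge mulr_ge0_le0 ?sqr_ge0// ltW.
have sgn' (a a' x : R) : 0 < a * a' -> 0 < a * x -> a' * x < 0 -> False.
  by move=> h h1 h2; apply: (sgn a' a x) => //; rewrite mulrC.
have line v w : 0 < line_sign (member Type_V m) (member Type_V n) v ->
    line_sign (member Type_V m) (member Type_V n) w < 0 -> False.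
  rewrite !line_sign_V => h h'; have h2 : 0 <= v 0 (inord 0) ^+ 2 by exact: sqr_ge0.
  have h3 : 0 <= w 0 (inord 0) ^+ 2 by exact: sqr_ge0.
  have [d|d] := leP 0 (3%:R * (n - m)).
    by move: h'; rewrite ltNge mulr_ge0.
  by move: h; rewrite ltNge mulr_le0_ge0// ltW.
have sgn0 (P Q : Prop) (x : R) : P /\ 0 < x -> Q /\ x < 0 -> False by move=> [_ h] [_ h']; lra.
case: t i zm zn cut => [] [|[|[|i]]] zm zn cut; case: j => [|[|[|j]]] H1 H2 => //; exfalso;
  first [exact: H1 | exact: H2 | exact: dich H1 H2 | exact: dich H2 H1 | exact: dich H1.1 H2
    | exact: dich H2.1 H1 | exact: sgn0 H1 H2 | exact: sgn0 H2 H1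
    | by move: H1 H2 => [v h] [w h']; first [exact: line h h'|exact: line h' h]
    | move: H1 H2 => [a [b [p h1 h2]]] [a' [b' [p' h1' h2']]]; have [ha hb] := cut _ _ _ _ p p';
      first [exact: sgn ha h1 h1' | exact: sgn' ha h1 h1' | exact: sgn hb h2 h2' | exact: sgn' hb h2 h2']].
Qed.

(** The arbitrary representatives are harmless: [label_transform] with the identity matrix allows
    any rescaling. *)
Definition label_couples t i : set (conic R * conic R) :=
  [set c | label_set t i (proj_repr c.1, proj_repr c.2)].

Lemma open_label_couples t i : open (label_couples t i).
Proof.
apply: open_saturated; first exact: open_label_set.
move=> a b v w a0 b0 H.
by have := label_transform a0 b0 (unitmx1 R 3) H; rewrite !act1.
Qed.

Definition pencil_couple t : conic R * conic R := couple (pencil_fst R t) (pencil_snd R t).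

Lemma same_intersections_members t m n M k l c : M \in unitmx -> k != 0 -> l != 0 ->
  m != n -> proj_repr c.1 = k *: act M (member t m) -> proj_repr c.2 = l *: act M (member t n) ->
  same_intersections c (pencil_couple t).
Proof.
move=> Mu k0 l0 mn E1 E2; have Vu : invmx M \in unitmx by rewrite unitmx_inv.
have f1 : act M (member t m) != 0 by rewrite act_eq0// member_neq0.
have g1 : act M (member t n) != 0 by rewrite act_eq0// member_neq0.
have [p1 p2] := independent_neq0 (@pencil_independent R t).
rewrite (couple_repr c) E1 E2 (couple_scale k0 l0 f1 g1).
apply: (same_intersections_pencil f1 g1 p1 p2).
have H := @projectively_equivalent_act R (act M (member t m)) (act M (member t n)) _ Vu.
rewrite !act_comp mulVmx// !act1 in H.
exact: (projectively_equivalent_trans H (projectively_equivalent_span (same_span_members t mn))).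
Qed.

Definition has_type t c := proper_nonempty_couple c /\ same_intersections c (pencil_couple t).

Lemma typed_form t c : has_type t c -> exists M m n k l,
  [/\ M \in unitmx, k != 0, l != 0, distinct_members t m n &
  [/\ proj_repr c.1 = k *: act M (member t m), proj_repr c.2 = l *: act M (member t n),
    has_zero (member t m) & has_zero (member t n)]].
Proof.
move=> [[pc n1 n2] tc]; have [t' [M [m [n [k [l [Mu k0 l0 mn [E1 E2]]]]]]]] := normal_form pc.
have := mn => -[ne _ _].
(* The type delivered by the classification is recognised by its base points. *)
have tt' : t = t'.
  apply: (@same_intersections_type R); apply: same_intersections_trans (same_intersections_sym tc) _.
  exact: same_intersections_members Mu k0 l0 ne E1 E2.
rewrite tt'; exists M, m, n, k, l; split=> //; split=> //.
  by move/nonempty_zero: n1; rewrite E1 => /(has_zeroZ _ k0)/(has_zero_act _ Mu).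
by move/nonempty_zero: n2; rewrite E2 => /(has_zeroZ _ l0)/(has_zero_act _ Mu).
Qed.

Lemma label_couples_exists t c : has_type t c -> exists i, label_couples t i c.
Proof.
move=> /typed_form[M [m [n [k [l [Mu k0 l0 mn [E1 E2 z1 z2]]]]]]].
have [i H] := member_label_exists mn z1 z2; exists i.
rewrite /label_couples /= E1 E2; exact: label_transform.
Qed.

Lemma label_couples_uniq t i j c : has_type t c ->
  label_couples t i c -> label_couples t j c -> i = j.
Proof.
move=> /typed_form[M [m [n [k [l [Mu k0 l0 mn [E1 E2 z1 z2]]]]]]].
rewrite /label_couples /= E1 E2 => /(label_transform_inv k0 l0 Mu) Hi.
by move=> /(label_transform_inv k0 l0 Mu); exact: member_label_uniq Hi.
Qed.

Lemma indefiniteZ k f : k != 0 -> indefinite f -> indefinite (k *: f).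
Proof.
move=> k0 [v [w [fv fw]]]; move: k0; rewrite neq_lt => /orP[kn|kp].
  by exists w, v; rewrite !qform_evalZ nmulr_rgt0// nmulr_rlt0.
by exists v, w; rewrite !qform_evalZ pmulr_rgt0// pmulr_rlt0.
Qed.

Lemma definiteZ k f : k != 0 -> definite f -> definite (k *: f).
Proof.
have pos x q : 0 < x -> posdef q -> posdef (x *: q).
  by move=> x0 H v v0; rewrite qform_evalZ pmulr_rgt0//; exact: H.
rewrite neq_lt => /orP[kn|kp] [] H.
- right; rewrite scalerA mulN1r; by apply: pos; rewrite ?oppr_gt0.
- have -> : k *: f = (- k) *: (-1 *: f) by rewrite scalerA mulrN1 opprK.
  by left; apply: pos; rewrite ?oppr_gt0.
- by left; exact: pos.
- by right; rewrite scalerA mulrC -scalerA; exact: pos.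
Qed.

(** Among proper conics, indefinite and definite are complementary open conditions, and the definite
    ones are the empty ones; a connected path cannot pass from one to the other. *)
Lemma nonempty_isotopic c c' : proper_nonempty_couple c -> rigidly_isotopic c c' ->
  proper_nonempty_couple c'.
Proof.
move=> [pc n1 n2] /rigidly_isotopicP[gamma [gc g0 g1 gp]].
pose U : set (conic R * conic R) := [set d | indefinite (proj_repr d.1) /\ indefinite (proj_repr d.2)].
pose V : set (conic R * conic R) := [set d | definite (proj_repr d.1) \/ definite (proj_repr d.2)].
have oU : open U.
  apply: (@open_saturated R 5 [set p | indefinite p.1 /\ indefinite p.2]).
    by apply: openI; apply: open_indefinite; [exact: contF_fst|exact: contF_snd].
  by move=> a b v w a0 b0 /= [? ?]; split; exact: indefiniteZ.
have oV : open V.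
  apply: (@open_saturated R 5 [set p | definite p.1 \/ definite p.2]).
    by apply: openU; apply: open_definite; [exact: contF_fst|exact: contF_snd].
  by move=> a b v w a0 b0 /= [?|?]; [left|right]; exact: definiteZ.
have excl f : indefinite f -> definite f -> False.
  by move=> /indefinite_has_zero z /definite_no_zero.
have nd (d : conic R * conic R) : proper_couple d -> disc (proj_repr d.1) != 0 /\ disc (proj_repr d.2) != 0.
  by move=> /proper_couple_good[].
have UV s : 0 <= s <= 1 -> U (gamma s) \/ V (gamma s).
  move=> /gp[/nd[d1 d2] _]; have [h1|h1] := nondegenerate_definite d1; last by right; left.
  have [h2|h2] := nondegenerate_definite d2; last by right; right.
  by left.
have nUV s : 0 <= s <= 1 -> U (gamma s) -> V (gamma s) -> False.
  by move=> _ [h1 h2] []; exact: excl.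
have U0 : U (gamma 0).
  rewrite g0; have [d1 d2] := nd _ pc; split.
    have [//|/definite_no_zero] := nondegenerate_definite d1.
    by case; apply/nonempty_zero.
  have [//|/definite_no_zero] := nondegenerate_definite d2.
  by case; apply/nonempty_zero.
have one : 0 <= (1 : R) <= 1 by rewrite ler01 lexx.
have := path_open_invariant gc oU oV UV nUV U0 one; rewrite g1 => -[h1 h2].
have [+ _] := gp 1 one; rewrite g1 => pc'; split=> //; apply/nonempty_zero; exact: indefinite_has_zero.
Qed.

Lemma has_type_isotopic t c c' : has_type t c -> rigidly_isotopic c c' -> has_type t c'.
Proof.
move=> [pn tc] H; split; first exact: nonempty_isotopic H.
have /rigidly_isotopicP[gamma [_ _ g1 gp]] := H.
have one : 0 <= (1 : R) <= 1 by rewrite ler01 lexx.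
have [_] := gp 1 one; rewrite g1 => sc; exact: same_intersections_trans (same_intersections_sym sc) tc.
Qed.

(** An initial piece of the path, rescaled to [0, 1]. *)
Lemma rigidly_isotopic_along (gamma : R -> conic R * conic R) c : {within `[0, 1], continuous gamma} ->
  gamma 0 = c -> (forall s, 0 <= s <= 1 -> proper_couple (gamma s) /\ same_intersections c (gamma s)) ->
  forall s, 0 <= s <= 1 -> rigidly_isotopic c (gamma s).
Proof.
move=> gc g0 gp s /andP[s0 s1]; apply/rigidly_isotopicP; exists (gamma \o (fun u => s * u)).
have in01 u : 0 <= u <= 1 -> 0 <= s * u <= 1.
  by move=> /andP[u0 u1]; rewrite mulr_ge0//= mulr_ile1.
split=> /=; [|by rewrite mulr0|by rewrite mulr1|by move=> u /in01; exact: gp].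
apply: (@within_comp R R _ _ `[0 : R, 1]%classic (fun u : R => s * u) gamma _ _ gc).
  exact: mulrl_continuous.
by move=> x /=; rewrite !in_itv /=; exact: in01.
Qed.

(** The type persists along the path, so exactly one label holds at each time; label i and the union
    of the others are disjoint open sets covering the path. *)
Lemma label_isotopic t i c c' : has_type t c -> rigidly_isotopic c c' ->
  label_couples t i c -> label_couples t i c'.
Proof.
move=> tc /rigidly_isotopicP[gamma [gc g0 g1 gp]] Li.
pose V := \bigcup_(j in [set j | j != i]) label_couples t j.
have oV : open V by apply: bigcup_open => j _; exact: open_label_couples.
have tg s : 0 <= s <= 1 -> has_type t (gamma s).
  by move=> s01; apply: has_type_isotopic tc _; exact: rigidly_isotopic_along gp s s01.
rewrite -g1; apply: (path_open_invariant gc (@open_label_couples t i) oV).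
- move=> s /tg/label_couples_exists[j Lj]; have [<-|ji] := eqVneq j i; first by left.
  by right; exists j.
- by move=> s /tg ts H [j /= /eqP ji Lj]; apply: ji; exact: label_couples_uniq ts Lj H.
- by rewrite g0.
- by rewrite ler01 lexx.
Qed.

End MemberLabels.

(** * The twenty representatives are pairwise non-isotopic *)

Section Representatives.
Variable R : realType.
Implicit Types (f g : 'rV[R]_6) (t : pencil_type) (m n k l : R) (i j : nat)
  (c r : conic R * conic R).

Definition indefinite_range t m : bool :=
  match t with Type_Ia => 4%:R < m ^+ 2 | Type_IIIa => m < 0 | _ => true end.

Lemma member_has_zero t m : indefinite_range t m -> has_zero (member t m).
Proof.
move=> H; have point x y z : v3 x y z != 0 -> qform_eval (member t m) (v3 x y z) = 0 ->
    has_zero (member t m) by move=> v0 E; exists (v3 x y z).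
have ev x y z : qform_eval (member t m) (v3 x y z) =
    qform_eval (pencil_fst R t) (v3 x y z) + m * qform_eval (pencil_snd R t) (v3 x y z).
  by rewrite /member qform_evalD qform_evalZ.
case: t H point ev => H point ev.
- by apply: (point 1 1 1); rewrite ?v3_neq0 ?oner_neq0// ev /= !qform_evalE; ring.
- apply: indefinite_has_zero; exists (v3 0 1 0).
  (* The sign of xz is chosen against that of m, which gives the value 2 - |m|. *)
  have [m0|m0] := leP 0 m; [exists (v3 1 0 (-1))|exists (v3 1 0 1)];
    rewrite !ev /= !qform_evalE; move: H => /=; split; nra.
- by apply: (point 0 1 1); rewrite ?v3_neq0 ?oner_neq0 ?orbT// ev /= !qform_evalE; ring.
- by apply: (point 1 0 0); rewrite ?v3_neq0 ?oner_neq0// ev /= !qform_evalE; ring.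
- by apply: (point 1 0 0); rewrite ?v3_neq0 ?oner_neq0// ev /= !qform_evalE; ring.
- by apply: (point 1 0 0); rewrite ?v3_neq0 ?oner_neq0// ev /= !qform_evalE; ring.
- apply: indefinite_has_zero; exists (v3 1 0 0), (v3 0 0 1).
  by rewrite !ev /= !qform_evalE; move: H => /=; split; lra.
- by apply: (point 0 0 1); rewrite ?v3_neq0 ?oner_neq0 ?orbT// ev /= !qform_evalE; ring.
- by apply: (point 0 0 1); rewrite ?v3_neq0 ?oner_neq0 ?orbT// ev /= !qform_evalE; ring.
Qed.

Lemma normal_couple_proper_nonempty t m n : distinct_members t m n ->
  indefinite_range t m -> indefinite_range t n -> proper_nonempty_couple (normal_couple t m n).
Proof.
move=> mn im in_; split; first exact/good_forms_couple/good_members.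
- by apply/nonempty_pt; [exact: member_neq0|exact: member_has_zero].
- by apply/nonempty_pt; [exact: member_neq0|exact: member_has_zero].
Qed.

Lemma normal_couple_type t m n : distinct_members t m n ->
  indefinite_range t m -> indefinite_range t n -> has_type t (normal_couple t m n).
Proof.
move=> mn im in_; split; first exact: normal_couple_proper_nonempty.
have [ne _ _] := mn; have [p1 p2] := independent_neq0 (@pencil_independent R t).
exact: (same_intersections_pencil (member_neq0 t m) (member_neq0 t n) p1 p2
  (projectively_equivalent_span (same_span_members t ne))).
Qed.

Lemma normal_couple_label t i m n : member_label t i m n -> label_couples t i (normal_couple t m n).
Proof.
rewrite /label_couples /=; have [a a0 ->] := proj_repr_pt (member_neq0 t m).
have [b b0 ->] := proj_repr_pt (member_neq0 t n).
by move=> H; have := label_transform a0 b0 (unitmx1 R 3) H; rewrite !act1.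
Qed.

(** A numeric code, so that the distinctness of the twenty pairs of type and label is decided by
    computation. *)
Definition type_rank t : nat :=
  match t with
  | Type_I => 0 | Type_Ia => 1 | Type_Ib => 2 | Type_II => 3 | Type_IIa => 4
  | Type_III => 5 | Type_IIIa => 6 | Type_IV => 7 | Type_V => 8
  end.

(** In the order of [params]: the couples named S carry the label 2, and a starred couple and its
    swap share the labels 0 and 1. *)
Definition param_labels : seq nat :=
  [:: 0; 2; 2; 0; 2; 2; 2; 0; 0; 1; 1; 0; 0; 0; 1; 0; 0; 1; 1; 1]%N.

Definition param i := nth (Type_I, 0, 0) (params R) i.

Lemma label_chain0 t m n : chain_type t -> 0 < m * n ->
  0 < pencil_hess (member t m) (member t n) -> member_label t 0 m n.
Proof. by move=> ct /(nested_members ct) N h; case: t ct N h => // _ N h; exact: (conj N h). Qed.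

Lemma label_chain1 t m n : chain_type t -> 0 < m * n ->
  pencil_hess (member t m) (member t n) < 0 -> member_label t 1 m n.
Proof. by move=> ct /(nested_members ct) N h; case: t ct N h => // _ N h; exact: (conj N h). Qed.

Lemma label_Ia i m n : m != n ->
  match i with
  | 0 => n * (n - m) * (4%:R - m ^+ 2) < 0 /\ 0 < m * (m - n) * (4%:R - n ^+ 2)
  | 1 => 0 < n * (n - m) * (4%:R - m ^+ 2) /\ m * (m - n) * (4%:R - n ^+ 2) < 0
  | 2 => n * (n - m) * (4%:R - m ^+ 2) < 0 /\ m * (m - n) * (4%:R - n ^+ 2) < 0
  | _ => False
  end -> member_label Type_Ia i m n.
Proof.
move=> mn; have pd := posdef_combo_Ia mn.
have E (x y z : R) : y != 0 -> x / y * z = x * y * z / y ^+ 2 by move=> y0; field.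
have h1 : n - m != 0 by rewrite subr_eq0 eq_sym.
have h2 : m - n != 0 by rewrite subr_eq0.
have sq (y : R) : y != 0 -> 0 < (y ^+ 2)^-1 by move=> y0; rewrite invr_gt0 exprn_even_gt0.
have [s1 s2] := (sq _ h1, sq _ h2).
case: i => [|[|[|i]]] // [k1 k2]; exists (n / (n - m)), (m / (m - n));
  rewrite !disc_member /= !E//; split; rewrite ?(pmulr_llt0 _ s1) ?(pmulr_llt0 _ s2)
    ?(pmulr_lgt0 _ s1) ?(pmulr_lgt0 _ s2)//.
Qed.

Lemma label_V i m n : match i with 0 => m < n | 1 => n < m | _ => false end ->
  member_label Type_V i m n.
Proof.
by case: i => [|[|i]] //= lt; exists (v3 1 0 0); rewrite line_sign_V v3E; lra.
Qed.

Lemma param_facts i : (i < 20)%N -> let: (t, m, n) := param i in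
  [/\ distinct_members t m n, indefinite_range t m, indefinite_range t n
    & member_label t (nth 0%N param_labels i) m n].
Proof.
have D t m n : m != n -> member_disc t m != 0 -> member_disc t n != 0 -> distinct_members t m n.
  by split.
have ne (x : R) : x < 0 \/ 0 < x -> x != 0 by move=> [] ?; rewrite neq_lt; apply/orP; [left|right].
do 20 try (case: i => [_|i] /=; first (split;
  [apply: D; rewrite /=; first [by apply: ne; left; lra|by apply: ne; right; lra|by apply/eqP => E; lra]
  |by rewrite /=; first [exact: isT|lra]|by rewrite /=; first [exact: isT|lra]|])).
all: try by [].
- by apply: nested_I; lra.
- by apply: crossing_I; [apply: D; rewrite /=; apply/eqP => E; lra|right; lra].
- by apply: (@label_Ia 2); [apply/eqP => E; lra|split; lra].
- by apply: (@crossing_members R Type_II) => //; lra.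
- by apply: (@crossing_members R Type_IIa) => //; lra.
- by apply: (@crossing_members R Type_III) => //; lra.
- by apply: (@label_Ia 0); [apply/eqP => E; lra|split; lra].
- by apply: (@label_chain1 Type_II) => //; rewrite ?hess_members//=; lra.
- by apply: (@label_chain1 Type_IIa) => //; rewrite ?hess_members//=; lra.
- by apply: (@label_chain0 Type_III) => //; rewrite ?hess_members//=; lra.
- by apply: (@label_chain0 Type_IIIa) => //; rewrite ?hess_members//=; lra.
- by apply: (@label_V 0); lra.
- by apply: (@label_Ia 1); [apply/eqP => E; lra|split; lra].
- by apply: (@label_chain0 Type_II) => //; rewrite ?hess_members//=; lra.
- by apply: (@label_chain0 Type_IIa) => //; rewrite ?hess_members//=; lra.
- by apply: (@label_chain1 Type_III) => //; rewrite ?hess_members//=; lra.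
- by apply: (@label_chain1 Type_IIIa) => //; rewrite ?hess_members//=; lra.
- by apply: (@label_V 1); lra.
Qed.

Definition rep i : conic R * conic R := param_couple (param i).

Lemma rep_nth i : (i < 20)%N -> rep i = nth (param_couple (Type_I, 0, 0)) (representatives R) i.
Proof. by move=> i20; rewrite representatives_params (nth_map (Type_I, 0, 0)). Qed.

Lemma representativeP r : r \in representatives R -> exists2 i, (i < 20)%N & r = rep i.
Proof.
move=> /(nthP (param_couple (Type_I, 0, 0)))[k]; rewrite {1}representatives_params => k20 <-.
by exists k => //; rewrite rep_nth.
Qed.

Definition rep_type i := (param i).1.1.

Lemma rep_facts i : (i < 20)%N -> has_type (rep_type i) (rep i) /\
  label_couples (rep_type i) (nth 0%N param_labels i) (rep i).
Proof.
move=> /param_facts; rewrite /rep_type /rep; case: (param i) => [[t m] n] [mn im in_ L].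
by split; [exact: normal_couple_type|exact: normal_couple_label].
Qed.

(** The pair of type and label is constant along an isotopy and takes twenty different values on the
    representatives. *)
Lemma rep_isotopic_inj i j : (i < 20)%N -> (j < 20)%N -> rigidly_isotopic (rep i) (rep j) -> i = j.
Proof.
move=> i20 j20 H; have [ti li] := rep_facts i20; have [tj lj] := rep_facts j20.
have tij := has_type_isotopic ti H.
have E : rep_type i = rep_type j.
  apply: (@same_intersections_type R).
  exact: same_intersections_trans (same_intersections_sym (proj2 tij)) (proj2 tj).
have lij := label_isotopic ti H li; rewrite -E in lj.
have L := label_couples_uniq tij lij lj.
pose code i := (type_rank (rep_type i), nth 0%N param_labels i).
have U : uniq [seq code i | i <- iota 0 20] by [].
have C : code i = code j by rewrite /code E L.
have nc p : (p < 20)%N -> nth (code 0%N) [seq code i | i <- iota 0 20] p = code p.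
  by move=> p20; rewrite (nth_map 0%N) ?size_iota// nth_iota.
by apply/eqP; rewrite -(nth_uniq (code 0%N) _ _ U) ?size_map ?size_iota// !nc// C.
Qed.

Lemma rep_proper_nonempty i : (i < 20)%N -> proper_nonempty_couple (rep i).
Proof. by move=> /rep_facts[[]]. Qed.

End Representatives.

Theorem theorem3 (R : realType) :
  [/\ rigid_classes R #= `I_20,
      (forall r : conic R * conic R, r \in representatives R -> proper_nonempty_couple r)
    & forall c : conic R * conic R, proper_nonempty_couple c ->
        exists! r : conic R * conic R, r \in representatives R /\ rigidly_isotopic r c].
Proof.
split.
- pose F i := rigid_class (rep R i).
  have -> : rigid_classes R = F @` `I_20.
    apply/seteqP; split=> [_ [c pc <-]|_ [i i20 <-]].
      have [r /representativeP[i i20 ->] cr] := proper_nonempty_represented pc.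
      exists i => //; apply/esym/rigid_class_eq => //; exact: rep_proper_nonempty.
    by exists (rep R i) => //; exact: rep_proper_nonempty.
  apply: inj_card_eq => i j; rewrite !inE => i20 j20 E.
  apply: (@rep_isotopic_inj R) => //.
  have [pj _] := rep_proper_nonempty R j20.
  (* A class contains its own representative, so equal classes have isotopic representatives. *)
  have : F j (rep R j) by split; [exact: rep_proper_nonempty|exact: rigidly_isotopic_refl].
  by rewrite -E => -[].
- by move=> r /representativeP[i i20 ->]; exact: rep_proper_nonempty.
move=> c pc; have [r rR cr] := proper_nonempty_represented pc.
exists r; split; first by split=> //; exact: rigidly_isotopic_sym.
move=> r' [/representativeP[j j20 ->] r'c].
have [i i20 rE] := representativeP rR; rewrite rE in cr *.
by rewrite (rep_isotopic_inj i20 j20 (rigidly_isotopic_sym (rigidly_isotopic_trans r'c cr))).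
Qed.
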